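(* Let $k$ be a field and let $\Lambda=kQ/I$ be an admissible quotient of the path algebra $kQ$. Suppose that there are arrows $a_i\colon v_{e_i}\to v_{f_i}$ in $Q$ for $i=1,2,\dots,t$ which do not occur in a set of minimal generators of $I$ in $kQ$ and that $\operatorname{Hom}_\Lambda(e_i\Lambda,f_j\Lambda)=0$ for all $i$ and $j$ in $\{1,2,\dots,t\}$. Let $\overline a_i=a_i+I$ and $\Gamma=\Lambda/\Lambda\{\overline a_i\}_{i=1}^t\Lambda$. Consider the functors $\mathsf i=\operatorname{Hom}_\Gamma({}_\Lambda\Gamma_\Gamma,-)\colon\operatorname{mod}\text{-}\Gamma\to\operatorname{mod}\text{-}\Lambda$, $\mathsf e=\operatorname{Hom}_\Lambda({}_\Gamma\Lambda_\Lambda,-)\colon\operatorname{mod}\text{-}\Lambda\to\operatorname{mod}\text{-}\Gamma$, $\mathsf l=-\otimes_\Gamma{}_\Gamma\Lambda_\Lambda$ and $\mathsf r=\operatorname{Hom}_\Gamma({}_\Lambda\Lambda_\Gamma,-)\colon\operatorname{mod}\text{-}\Gamma\to\operatorname{mod}\text{-}\Lambda$, and the associated endofunctors $F$ of $\operatorname{mod}\text{-}\Gamma$ and $G$ of $\operatorname{mod}\text{-}\Lambda$. Then: (i) $\mathsf e$ is faithful exact. (ii) $(\mathsf l,\mathsf e)$ is an adjoint pair of functors. (iii) $\mathsf e\mathsf i\simeq1_{\operatorname{mod}\text{-}\Gamma}$. (iv) $\mathsf l$ and $\mathsf r$ are exact functors. (v) $\mathsf e$ preserves projectives. (vi) $\operatorname{Im}F\subseteq\operatorname{proj}(\Gamma)$.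 (vii) $F^2=0$. In particular, $(\operatorname{mod}\text{-}\Gamma,\operatorname{mod}\text{-}\Lambda,\mathsf e,\mathsf l,\mathsf i)$ is a cleft extension $\operatorname{mod}\text{-}\Lambda$ of $\operatorname{mod}\text{-}\Gamma$ such that $\mathsf l$ is exact, $\mathsf e$ preserves projectives, every object in the essential image of $F$ is a projective $\Gamma$-module and every object in the essential image of $G$ is a projective $\Lambda$-module.
   Context: Admissible quotient means: $Q$ is a finite quiver and $I$ is a two-sided ideal of $kQ$ with $J^m\subseteq I\subseteq J^2$ for some $m\ge2$, where $J$ is the ideal generated by the arrows. Paths are composed from left to right; for a trivial path (primitive idempotent) $e$ the corresponding vertex is $v_e$, and an arrow $a\colon v_e\to v_f$ satisfies $a=eaf$. ''The arrows $a_1,\dots,a_t$ do not occur in a set of minimal generators of $I$'' means that there is a minimal generating set of the two-sided ideal $I$ such that none of the $a_i$ occurs in any path appearing (with non-zero coefficient) in any element of that set. $\operatorname{mod}\text{-}\Lambda$ is the category of finitely generated right $\Lambda$-modules, and $\operatorname{proj}(\Gamma)$ the finitely generated projective ones over $\Gamma$. $\operatorname{Im}F$ denotes the essential image. Let $\pi\colon\Lambda\to\Gamma$ be the canonical surjection. With $Q^*$ the quiver $Q$ with $a_1,\dots,a_t$ removed, one has $\Gamma\simeq kQ^*/(I\cap kQ^* )$ via the map induced by $kQ^*\subseteq kQ$, and this inclusion induces an injective algebra homomorphism $\nu\colon\Gamma\to\Lambda$ with $\pi\nu=\mathrm{id}_\Gamma$. In the functors above, $\Lambda$ is a $\Gamma$-module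 (left or right) via $\nu$, and $\Gamma$ is a $\Lambda$-module via $\pi$; thus $\mathsf i$ is restriction along $\pi$ and $\mathsf e$ is restriction along $\nu$. A cleft extension $(\mathscr B,\mathscr A,\mathsf e,\mathsf l,\mathsf i)$ of an abelian category $\mathscr B$ is an abelian category $\mathscr A$ with functors $\mathsf i\colon\mathscr B\to\mathscr A$, $\mathsf e\colon\mathscr A\to\mathscr B$, $\mathsf l\colon\mathscr B\to\mathscr A$ such that $\mathsf e$ is faithful exact, $(\mathsf l,\mathsf e)$ is an adjoint pair, and $\mathsf e\mathsf i\simeq\mathrm{Id}_{\mathscr B}$ naturally. With $\mu\colon\mathsf l\mathsf e\to\mathrm{Id}_{\mathscr A}$ the counit (each $\mu_A$ is an epimorphism), $G(A)=\operatorname{Ker}\mu_A$ and $F(B)=\mathsf e(G(\mathsf i(B)))$, so that there are exact sequences $0\to G\to\mathsf l\mathsf e\to\mathrm{Id}_{\mathscr A}\to0$ and $0\to F\to\mathsf e\mathsf l\to\mathrm{Id}_{\mathscr B}\to0$ of functors. *)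

(* Defs.v *)
From HB Require Import structures.
From mathcomp Require Import all_boot all_order all_algebra.
From mathcomp Require Import finmap.
From mathcomp Require Import boolp classical_sets.
From mathcomp.multinomials Require Import monalg.

Set Implicit Arguments.
Unset Strict Implicit.
Unset Printing Implicit Defensive.

Import GRing.Theory.

Local Open Scope ring_scope.
Local Open Scope classical_set_scope.
Local Open Scope quotient_scope.

Section LinearExtension.
Variables (k : comNzRingType) (K : choiceType) (V : lmodType k).

Definition lin_ext (f : K -> V) (x : {malg k[K]}) : V :=
  \sum_(p <- msupp x) x@_p *: f p.

Lemma lin_extEw (f : K -> V) (d : {fset K}) x : (msupp x `<=` d)%fset ->
  lin_ext f x = \sum_(p <- d) x@_p *: f p.
Proof.
move=> le; rewrite /lin_ext; apply/(big_fset_incl _ le) => p _ pn.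
by rewrite mcoeff_outdom // scale0r.
Qed.

Lemma lin_ext_is_linear (f : K -> V) : linear (lin_ext f).
Proof.
move=> c x y; pose d := (msupp (c *: x + y) `|` (msupp x `|` msupp y))%fset.
rewrite !(@lin_extEw f d); last first.
- exact: fsubsetUl.
- exact: fsubset_trans (fsubsetUl _ _) (fsubsetUr _ _).
- exact: fsubset_trans (fsubsetUr _ _) (fsubsetUr _ _).
rewrite scaler_sumr -big_split /=; apply: eq_bigr => p _.
by rewrite mcoeffD mcoeffZ scalerDl scalerA.
Qed.

HB.instance Definition _ f :=
  GRing.isLinear.Build k {malg k[K]} V *:%R (lin_ext f) (lin_ext_is_linear f).

Lemma lin_extU f p : lin_ext f << p >> = f p.
Proof.
by rewrite (@lin_extEw _ [fset p]%fset) ?msuppU_le // big_seq_fset1 mcoeffUU scale1r.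
Qed.

Lemma malgUZ (c : k) (p : K) : << c *g p >> = c *: << p >> :> {malg k[K]}.
Proof. by apply/malgP => q; rewrite mcoeffZ !mcoeffU mulr_natr. Qed.

Lemma lin_extD f x y : lin_ext f (x + y) = lin_ext f x + lin_ext f y.
Proof. exact: linearD. Qed.

Lemma lin_extZ f c x : lin_ext f (c *: x) = c *: lin_ext f x.
Proof. exact: linearZ. Qed.

Lemma lin_ext_sum f (I : finType) (F : I -> {malg k[K]}) :
  lin_ext f (\sum_i F i) = \sum_i lin_ext f (F i).
Proof. exact: linear_sum. Qed.
End LinearExtension.

Record quiver := Quiver {
  vertex : finType;
  arrow : finType;
  src : arrow -> vertex;
  tgt : arrow -> vertex }.

Section Paths.
Variable Q : quiver.

Fixpoint walk (v : vertex Q) (s : seq (arrow Q)) : bool :=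
  if s is a :: s' then (src a == v) && walk (tgt a) s' else true.

(* A path is its starting vertex (needed for the trivial paths) together with
   its arrows, listed from left to right. *)
Record path := Path { path_val : vertex Q * seq (arrow Q);
                      path_walk : walk path_val.1 path_val.2 }.
HB.instance Definition _ := [isSub for path_val].
HB.instance Definition _ := [Choice of path by <:].

Definition arrows (p : path) : seq (arrow Q) := (path_val p).2.
Definition start (p : path) : vertex Q := (path_val p).1.
Definition finish (p : path) : vertex Q :=
  last (start p) [seq tgt a | a <- arrows p].

Definition triv_path (v : vertex Q) : path := @Path (v, [::]) isT.

Lemma arrow_path_walk (a : arrow Q) : walk (src a) [:: a].
Proof. by rewrite /= eqxx. Qed.
Definition arrow_path (a : arrow Q) : path := @Path (src a, [:: a]) (arrow_path_walk a).

Lemma walk_cat v s1 s2 :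
  walk v (s1 ++ s2) = walk v s1 && walk (last v [seq tgt a | a <- s1]) s2.
Proof. by elim: s1 v => //= a s1 IH v; rewrite IH andbA. Qed.

Lemma pcat_walk (p q : path) : finish p = start q ->
  walk (start p) (arrows p ++ arrows q).
Proof.
by move=> e; rewrite walk_cat (path_walk p) -/(finish p) e; case: q {e}.
Qed.

Definition pcat (p q : path) (e : finish p = start q) : path :=
  @Path (start p, arrows p ++ arrows q) (pcat_walk e).

Lemma finish_pcat p q e : finish (@pcat p q e) = finish q.
Proof.
by rewrite /finish /pcat /arrows /start /= map_cat last_cat -/(finish p) e.
Qed.
End Paths.

Definition pathalg (k : fieldType) (Q : quiver) : Type := {malg k[path Q]}.
HB.instance Definition _ k Q := GRing.Zmodule.on (pathalg k Q).

(* The operations are locked: unifying unlocked ones is prohibitively slow. *)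
HB.lock Definition pa_scale (k : fieldType) (Q : quiver) (c : k) (x : pathalg k Q)
    : pathalg k Q :=
  c *: (x : {malg k[path Q]}).

Section PathAlgebraLmod.
Variables (k : fieldType) (Q : quiver).
Local Notation scale := (@pa_scale k Q).

Lemma pa_scalerA c d v : scale c (scale d v) = scale (c * d) v.
Proof. by rewrite pa_scale.unlock scalerA. Qed.
Lemma pa_scale1r : left_id 1 scale.
Proof. by move=> v; rewrite pa_scale.unlock scale1r. Qed.
Lemma pa_scalerDr : right_distributive scale +%R.
Proof. by move=> c u v; rewrite pa_scale.unlock; exact: scalerDr. Qed.
Lemma pa_scalerDl v : {morph scale^~ v : c d / c + d}.
Proof. by move=> c d; rewrite pa_scale.unlock; exact: scalerDl. Qed.

HB.instance Definition _ := GRing.Zmodule_isLmodule.Build k (pathalg k Q)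
  pa_scalerA pa_scale1r pa_scalerDr pa_scalerDl.

Lemma pa_scaleE c (x : pathalg k Q) : c *: x = c *: (x : {malg k[path Q]}).
Proof. by rewrite /GRing.scale /= pa_scale.unlock. Qed.
End PathAlgebraLmod.

HB.lock Definition pbase (k : fieldType) (Q : quiver) (p : path Q) : pathalg k Q :=
  << p >>.

Definition pmul (k : fieldType) (Q : quiver) (p q : path Q) : pathalg k Q :=
  if eqVneq (finish p) (start q) is EqNotNeq e then pbase k (pcat e) else 0.

HB.lock Definition pa_mul (k : fieldType) (Q : quiver) (x y : pathalg k Q)
    : pathalg k Q :=
  \sum_(p <- msupp x) \sum_(q <- msupp y) (x@_p * y@_q) *: pmul k p q.

HB.lock Definition pa_one (k : fieldType) (Q : quiver) : pathalg k Q :=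
  \sum_(v : vertex Q) pbase k (triv_path v).

Section PathAlgebra.
Variables (k : fieldType) (Q : quiver).
Local Notation A := (pathalg k Q).
Local Notation B := (pbase k).
Local Notation mul := (@pa_mul k Q).
Implicit Types (x y z : A) (c : k) (p q r : path Q).

Lemma pmulE p q e : pmul k p q = B (@pcat Q p q e).
Proof.
rewrite /pmul; case: eqVneq => [e'|]; last by rewrite e eqxx.
by rewrite (eq_irrelevance e e').
Qed.

Lemma pmul0 p q : finish p != start q -> pmul k p q = 0.
Proof. by rewrite /pmul; case: eqVneq. Qed.

Lemma pa_mulE x y : mul x y = lin_ext (fun p => lin_ext (pmul k p) y) x.
Proof.
rewrite pa_mul.unlock /lin_ext; apply: eq_bigr => p _.
by rewrite scaler_sumr; apply: eq_bigr => q _; rewrite scalerA.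
Qed.

Lemma pa_mulDl : left_distributive mul +%R.
Proof. by move=> x y z; rewrite !pa_mulE; exact: lin_extD. Qed.

Lemma pa_mulDr : right_distributive mul +%R.
Proof.
move=> x y z; rewrite !pa_mulE /lin_ext -big_split /=; apply: eq_bigr => p _.
by rewrite -scalerDr; congr (_ *: _); exact: lin_extD.
Qed.

Lemma pa_scaleAl c x y : mul (c *: x) y = c *: mul x y.
Proof. by rewrite !pa_mulE pa_scaleE; exact: lin_extZ. Qed.

Lemma pa_scaleAr c x y : mul x (c *: y) = c *: mul x y.
Proof.
rewrite pa_scaleE !pa_mulE /lin_ext scaler_sumr; apply: eq_bigr => p _.
rewrite scalerA mulrC -scalerA; congr (_ *: _); exact: lin_extZ.
Qed.

Lemma pa_mulBB p q : mul (B p) (B q) = pmul k p q.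
Proof. by rewrite pa_mulE pbase.unlock !lin_extU. Qed.

Lemma pa_mul0l x : mul 0 x = 0.
Proof. by have := pa_scaleAl 0 0 x; rewrite !scale0r. Qed.

Lemma pa_mul0r x : mul x 0 = 0.
Proof. by have := pa_scaleAr 0 x 0; rewrite !scale0r. Qed.

Lemma pa_ind (P : A -> Prop) :
  (forall x y, P x -> P y -> P (x + y)) -> P 0 ->
  (forall c p, P (c *: B p)) -> forall x, P x.
Proof.
move=> PD P0 PU x; rewrite (monalgE x); apply: (big_ind P) => // p _.
by rewrite malgUZ; have := PU x@_p p; rewrite pa_scaleE pbase.unlock.
Qed.

Lemma pa_mulBBA p q r : mul (B p) (mul (B q) (B r)) = mul (mul (B p) (B q)) (B r).
Proof.
rewrite (pa_mulBB p q) (pa_mulBB q r).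
have [pq|pq] := eqVneq (finish p) (start q); last first.
  rewrite (pmul0 pq) pa_mul0l.
  have [qr|qr] := eqVneq (finish q) (start r).
    by rewrite (pmulE qr) pa_mulBB pmul0.
  by rewrite (pmul0 qr) pa_mul0r.
rewrite (pmulE pq) (pa_mulBB (pcat pq) r).
have [qr|qr] := eqVneq (finish q) (start r); last first.
  by rewrite (pmul0 qr) pa_mul0r pmul0 // finish_pcat.
have e1 : finish p = start (pcat qr) by [].
have e2 : finish (pcat pq) = start r by rewrite finish_pcat.
rewrite (pmulE qr) pa_mulBB (pmulE e1) (pmulE e2); congr (B _).
by apply/val_inj; rewrite /= /arrows /= catA.
Qed.

Lemma pa_mulA : associative mul.
Proof.
move=> x y z; elim/pa_ind: x => [x1 x2 h1 h2||c p].
- by rewrite !pa_mulDl h1 h2.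
- by rewrite !pa_mul0l.
rewrite !pa_scaleAl; congr (_ *: _).
elim/pa_ind: y => [x1 x2 h1 h2||d q].
- by rewrite pa_mulDl !pa_mulDr pa_mulDl h1 h2.
- by rewrite pa_mul0l pa_mul0r pa_mul0l.
rewrite pa_scaleAl !pa_scaleAr pa_scaleAl; congr (_ *: _).
elim/pa_ind: z => [x1 x2 h1 h2||e r].
- by rewrite !pa_mulDr h1 h2.
- by rewrite !pa_mul0r.
by rewrite !pa_scaleAr pa_mulBBA.
Qed.

Lemma pa_mul1l : left_id (pa_one k Q) mul.
Proof.
move=> x; elim/pa_ind: x => [x y hx hy||c p].
- by rewrite pa_mulDr hx hy.
- by rewrite pa_mul0r.
rewrite pa_scaleAr; congr (_ *: _).
have mul_suml (F : vertex Q -> A) y : mul (\sum_v F v) y = \sum_v mul (F v) y.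
  by apply: (big_morph (mul^~ y)) => [u v|]; rewrite (pa_mulDl, pa_mul0l).
rewrite pa_one.unlock mul_suml (bigD1 (start p)) //= pa_mulBB big1 ?addr0.
  have e : finish (triv_path (start p)) = start p by [].
  rewrite (pmulE e); congr (B _); apply/val_inj => /=.
  by case: p e => -[].
by move=> v vp; rewrite pa_mulBB pmul0.
Qed.

Lemma pa_mul1r : right_id (pa_one k Q) mul.
Proof.
move=> x; elim/pa_ind: x => [x y hx hy||c p].
- by rewrite pa_mulDl hx hy.
- by rewrite pa_mul0l.
rewrite pa_scaleAl; congr (_ *: _).
have mul_sumr (F : vertex Q -> A) y : mul y (\sum_v F v) = \sum_v mul y (F v).
  by apply: (big_morph (mul y)) => [u v|]; rewrite (pa_mulDr, pa_mul0r).
rewrite pa_one.unlock mul_sumr (bigD1 (finish p)) //= pa_mulBB big1 ?addr0.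
  have e : finish p = start (triv_path (finish p)) by [].
  rewrite (pmulE e); congr (B _); apply/val_inj => /=.
  by rewrite /arrows /= cats0; case: p e => -[].
by move=> v vp; rewrite pa_mulBB pmul0 // eq_sym.
Qed.

HB.instance Definition _ := GRing.Zmodule_isPzRing.Build A
  pa_mulA pa_mul1l pa_mul1r pa_mulDl pa_mulDr.
End PathAlgebra.

Notation vert k v := (pbase k (triv_path v)).
Notation arr k a := (pbase k (arrow_path a)).

Section AdditiveQuotient.
Variable V : zmodType.

Definition is_subgroup (H : set V) : Prop :=
  H 0 /\ forall x y, H x -> H y -> H (x - y).

Record subgrp := Subgrp { subgrp_set :> set V; subgrpP : is_subgroup subgrp_set }.

Definition subgrp_pred (H : subgrp) : V -> bool := fun x => `[< subgrp_set H x >].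

Lemma subgrp_zmod_closed H : zmod_closed (subgrp_pred H).
Proof.
case: (subgrpP H) => H0 HB; split=> [|x y]; rewrite !unfold_in /subgrp_pred.
  exact/asboolP.
by move=> /asboolP Hx /asboolP Hy; apply/asboolP/HB.
Qed.

HB.instance Definition _ H :=
  GRing.isZmodClosed.Build V (subgrp_pred H) (subgrp_zmod_closed H).
Definition subgrp_zmodClosed (H : subgrp) : zmodClosed V :=
  GRing.ZmodClosed.clone V (subgrp_pred H) _.

Lemma smallest_subgroup (X : set V) : is_subgroup (smallest is_subgroup X).
Proof.
split=> [A [[A0 _] _] //|x y hx hy A hA].
by have [[_ AB] _] := hA; apply: AB; [exact: hx | exact: hy].
Qed.

Definition subgrp_gen (X : set V) : subgrp := Subgrp (smallest_subgroup X).

Definition zquot (H : subgrp) : Type := Quotient.quot (subgrp_zmodClosed H).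
HB.instance Definition _ H := GRing.Zmodule.on (zquot H).

Definition zpi (H : subgrp) (x : V) : zquot H := \pi_(Quotient.quot (subgrp_zmodClosed H)) x.
Definition zrepr (H : subgrp) (x : zquot H) : V :=
  repr (x : Quotient.quot (subgrp_zmodClosed H)).

Lemma zreprK H : cancel (@zrepr H) (@zpi H).
Proof. by move=> x; exact: reprK. Qed.

Lemma zpi_eq H x y : zpi H x = zpi H y <-> subgrp_set H (x - y).
Proof.
have e := Quotient.idealrBE (subgrp_zmodClosed H) x y; split=> [/eqP h|h].
  by apply/asboolP; change (is_true (x - y \in subgrp_zmodClosed H)); rewrite e.
apply/eqP; change (is_true (x == y %[mod Quotient.quot (subgrp_zmodClosed H)])).
by rewrite -e; apply/asboolP.
Qed.

Lemma zpi_is_zmod_morphism H : zmod_morphism (zpi H).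
Proof. by move=> x y; rewrite /zpi (raddfB (\pi_(Quotient.quot _))). Qed.
HB.instance Definition _ H :=
  GRing.isZmodMorphism.Build V (zquot H) (zpi H) (zpi_is_zmod_morphism H).
End AdditiveQuotient.

Section Ideals.
Variable R : pzRingType.

Definition two_sided_ideal (I : set R) : Prop :=
  [/\ I 0, forall x y, I x -> I y -> I (x + y),
      forall a x, I x -> I (a * x) & forall x a, I x -> I (x * a)].

Record ideal := Ideal { ideal_set :> set R; idealP : two_sided_ideal ideal_set }.

Lemma ideal_subgroup (I : ideal) : is_subgroup I.
Proof.
case: I => I [I0 ID IMl IMr]; split=> //= x y Ix Iy; apply: ID => //.
by rewrite -mulN1r; exact: IMl.
Qed.
Definition ideal_subgrp (I : ideal) : subgrp R := Subgrp (ideal_subgroup I).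

Lemma smallest_ideal (X : set R) : two_sided_ideal (smallest two_sided_ideal X).
Proof.
split=> [A [[A0 _ _ _] _] //|x y hx hy A hA|a x hx A hA|x a hx A hA];
  have [[_ AD AMl AMr] _] := hA.
- by apply: AD; [exact: hx | exact: hy].
- exact: AMl (hx _ hA).
- exact: AMr (hx _ hA).
Qed.
Definition ideal_gen (X : set R) : ideal := Ideal (smallest_ideal X).

Lemma ideal_setT : two_sided_ideal [set: R]. Proof. by []. Qed.

Definition ideal_mul (I J : ideal) : ideal :=
  ideal_gen [set z | exists x y, [/\ ideal_set I x, ideal_set J y & z = x * y]].
Fixpoint ideal_pow (I : ideal) (n : nat) : ideal :=
  if n is m.+1 then ideal_mul (ideal_pow I m) I else Ideal ideal_setT.

Definition minimal_generating_set (I : ideal) (X : set R) : Prop :=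
  ideal_gen X = I :> set R /\
  forall Y : set R, Y `<=` X -> ideal_gen Y = I :> set R -> Y = X.

Definition quot_ring (I : ideal) : Type := zquot (ideal_subgrp I).
HB.instance Definition _ I := GRing.Zmodule.on (quot_ring I).

Definition quot_pi (I : ideal) (x : R) : quot_ring I := zpi (ideal_subgrp I) x.
HB.instance Definition _ I := GRing.isZmodMorphism.Build R (quot_ring I)
  (quot_pi I) (zpi_is_zmod_morphism (ideal_subgrp I)).

Definition quot_mul (I : ideal) (x y : quot_ring I) : quot_ring I :=
  quot_pi I (zrepr x * zrepr y).

Lemma quot_piP I (x : quot_ring I) : exists v, x = quot_pi I v.
Proof. by exists (zrepr x); rewrite /quot_pi zreprK. Qed.

Lemma quot_mulE I x y : quot_mul (quot_pi I x) (quot_pi I y) = quot_pi I (x * y).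
Proof.
have [I0 ID IMl IMr] := idealP I.
have repr_pi v : ideal_set I (zrepr (quot_pi I v) - v).
  by apply/(zpi_eq (ideal_subgrp I)); rewrite zreprK.
apply/(zpi_eq (ideal_subgrp I)); set x' := zrepr _; set y' := zrepr _ => /=.
have -> : x' * y' - x * y = (x' - x) * y' + x * (y' - y).
  by rewrite mulrBl mulrBr addrA subrK.
by apply: ID; [exact: IMr (repr_pi _) | exact: IMl (repr_pi _)].
Qed.

Lemma quot_mulA I : associative (@quot_mul I).
Proof.
move=> x y z; have [[u ->] [v ->] [w ->]] := And3 (quot_piP x) (quot_piP y) (quot_piP z).
by rewrite !quot_mulE mulrA.
Qed.
Lemma quot_mul1l I : left_id (quot_pi I 1) (@quot_mul I).
Proof. by move=> x; have [u ->] := quot_piP x; rewrite quot_mulE mul1r. Qed.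
Lemma quot_mul1r I : right_id (quot_pi I 1) (@quot_mul I).
Proof. by move=> x; have [u ->] := quot_piP x; rewrite quot_mulE mulr1. Qed.
Lemma quot_mulDl I : left_distributive (@quot_mul I) +%R.
Proof.
move=> x y z; have [[u ->] [v ->] [w ->]] := And3 (quot_piP x) (quot_piP y) (quot_piP z).
by rewrite -raddfD !quot_mulE mulrDl raddfD.
Qed.
Lemma quot_mulDr I : right_distributive (@quot_mul I) +%R.
Proof.
move=> x y z; have [[u ->] [v ->] [w ->]] := And3 (quot_piP x) (quot_piP y) (quot_piP z).
by rewrite -raddfD !quot_mulE mulrDr raddfD.
Qed.
HB.instance Definition _ I := GRing.Zmodule_isPzRing.Build (quot_ring I)
  (@quot_mulA I) (@quot_mul1l I) (@quot_mul1r I) (@quot_mulDl I) (@quot_mulDr I).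

Lemma quot_pi_is_monoid_morphism I : monoid_morphism (quot_pi I).
Proof. by split=> // x y; rewrite -quot_mulE. Qed.
HB.instance Definition _ I := GRing.isMonoidMorphism.Build R (quot_ring I)
  (quot_pi I) (quot_pi_is_monoid_morphism I).
End Ideals.

(* Right R-modules are left modules over the opposite ring R^c: the right
   action of r on x is [(r : R^c) *: x]. *)
Notation rmodType R := (lmodType R^c).

Section LinearMaps.
Variable R : pzRingType.
Implicit Types U V : lmodType R.

HB.instance Definition _ U V := gen_eqMixin {linear U -> V}.
HB.instance Definition _ U V := gen_choiceMixin {linear U -> V}.

Lemma linear_ext U V (f g : {linear U -> V}) : f =1 g -> f = g.
Proof.
case: f g => [f [[a] [b]]] [g [[c] [d]]] /= /funext fg; subst g.
by rewrite (Prop_irrelevance a c) (Prop_irrelevance b d).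
Qed.

Definition lin_add U V (f g : {linear U -> V}) : {linear U -> V} := f \+ g.
Definition lin_opp U V (f : {linear U -> V}) : {linear U -> V} := \- f.
Definition lin_zero U V : {linear U -> V} := \0.

Lemma lin_addA U V : associative (@lin_add U V).
Proof. by move=> f g h; apply: linear_ext => x; exact: addrA. Qed.
Lemma lin_addC U V : commutative (@lin_add U V).
Proof. by move=> f g; apply: linear_ext => x; exact: addrC. Qed.
Lemma lin_add0 U V : left_id (lin_zero U V) (@lin_add U V).
Proof. by move=> f; apply: linear_ext => x; exact: add0r. Qed.
Lemma lin_addN U V : left_inverse (lin_zero U V) (@lin_opp U V) (@lin_add U V).
Proof. by move=> f; apply: linear_ext => x; exact: addNr. Qed.

HB.instance Definition _ U V := GRing.isZmodule.Build {linear U -> V}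
  (@lin_addA U V) (@lin_addC U V) (@lin_add0 U V) (@lin_addN U V).
End LinearMaps.

(* The right ideal eR as a right R-module. *)
Section PrincipalRightIdeal.
Variables (R : pzRingType) (e : R).

Definition pright_pred : R^c^o -> bool := fun x => `[< exists y : R, x = e * y >].

Lemma pright_submod_closed : submod_closed pright_pred.
Proof.
split=> [|r x y]; first by apply/asboolP; exists 0; rewrite mulr0.
move=> /asboolP[u ->] /asboolP[v ->]; apply/asboolP.
exists (u * r + v); rewrite mulrDr mulrA; reflexivity.
Qed.

HB.instance Definition _ :=
  GRing.isSubmodClosed.Build R^c R^c^o pright_pred pright_submod_closed.

Record pright := PRight { pright_val : R^c^o; pright_valP : pright_pred pright_val }.
HB.instance Definition _ := [isSub for pright_val].
HB.instance Definition _ := [Choice of pright by <:].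
HB.instance Definition _ := [SubChoice_isSubLmodule of pright by <:].
End PrincipalRightIdeal.

Record bimodule (S R : pzRingType) := Bimodule {
  bimod_rmod :> rmodType R;
  lact : S -> {linear bimod_rmod -> bimod_rmod};
  lact1 : forall b, lact 1 b = b;
  lactM : forall s t b, lact (s * t) b = lact s (lact t b);
  lactD : forall s t b, lact (s + t) b = lact s b + lact t b }.

(* A ring T as an (S, R)-bimodule via ring homomorphisms S -> T and R -> T. *)
Section RingBimodule.
Variables (S R T : pzRingType) (f : {rmorphism S -> T}) (g : {rmorphism R -> T}).

Definition restr (h : {rmorphism R -> T}) : Type := T.
HB.instance Definition _ h := GRing.Zmodule.on (restr h).

Definition restr_scale h (r : R^c) (x : restr h) : restr h := (x : T) * h r.

Lemma restr_scaleA h a b v :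
  @restr_scale h a (restr_scale b v) = restr_scale (a * b) v.
Proof. by rewrite /restr_scale -mulrA -rmorphM. Qed.
Lemma restr_scale1 h : left_id 1 (@restr_scale h).
Proof. by move=> v; rewrite /restr_scale rmorph1 mulr1. Qed.
Lemma restr_scaleDr h : right_distributive (@restr_scale h) +%R.
Proof. by move=> a u v; exact: mulrDl. Qed.
Lemma restr_scaleDl h v : {morph (@restr_scale h)^~ v : a b / a + b}.
Proof. by move=> a b; rewrite /restr_scale rmorphD; exact: mulrDr. Qed.

HB.instance Definition _ h := GRing.Zmodule_isLmodule.Build R^c (restr h)
  (@restr_scaleA h) (@restr_scale1 h) (@restr_scaleDr h) (@restr_scaleDl h).

Definition ring_lact_fun (s : S) (x : restr g) : restr g := f s * (x : T).

Lemma ring_lact_is_linear s : linear (ring_lact_fun s).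
Proof. by move=> a x y; rewrite /ring_lact_fun mulrDr mulrA. Qed.
HB.instance Definition _ s := GRing.isLinear.Build R^c (restr g) (restr g) *:%R
  (ring_lact_fun s) (ring_lact_is_linear s).

Definition ring_lact (s : S) : {linear restr g -> restr g} := ring_lact_fun s.

Lemma ring_lact1 b : ring_lact 1 b = b.
Proof. by rewrite /ring_lact /= /ring_lact_fun rmorph1 mul1r. Qed.
Lemma ring_lactM s t b : ring_lact (s * t) b = ring_lact s (ring_lact t b).
Proof. by rewrite /ring_lact /= /ring_lact_fun rmorphM mulrA. Qed.
Lemma ring_lactD s t b : ring_lact (s + t) b = ring_lact s b + ring_lact t b.
Proof. by rewrite /ring_lact /= /ring_lact_fun rmorphD; exact: mulrDl. Qed.

Definition ring_bimodule : bimodule S R :=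
  Bimodule ring_lact1 ring_lactM ring_lactD.
End RingBimodule.

Section HomModule.
Variables (S R : pzRingType) (B : bimodule S R) (M : rmodType R).

Definition bihom : Type := {linear B -> M}.
HB.instance Definition _ := GRing.Zmodule.on bihom.

Definition bihom_scale (s : S^c) (f : bihom) : bihom :=
  (f : {linear B -> M}) \o lact B s.

Lemma bihom_scaleA a b v : bihom_scale a (bihom_scale b v) = bihom_scale (a * b) v.
Proof. by apply: linear_ext => x; rewrite /= lactM. Qed.
Lemma bihom_scale1 : left_id 1 bihom_scale.
Proof. by move=> f; apply: linear_ext => x; rewrite /= lact1. Qed.
Lemma bihom_scaleDr : right_distributive bihom_scale +%R.
Proof. by move=> a u v; apply: linear_ext. Qed.
Lemma bihom_scaleDl v : {morph bihom_scale^~ v : a b / a + b}.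
Proof. by move=> a b; apply: linear_ext => x; rewrite /= lactD; exact: raddfD. Qed.

HB.instance Definition _ := GRing.Zmodule_isLmodule.Build S^c bihom
  bihom_scaleA bihom_scale1 bihom_scaleDr bihom_scaleDl.
End HomModule.

(* N (x)_S B as the free abelian group on N x B modulo the usual relations. *)
Section TensorProduct.
Variables (S R : pzRingType) (N : rmodType S) (B : bimodule S R).

Inductive tensor_rel : set {malg int[(N * B)%type]} :=
| tensor_rel_Dl n n' b :
    tensor_rel (<< (n + n', b) >> - << (n, b) >> - << (n', b) >>)
| tensor_rel_Dr n b b' :
    tensor_rel (<< (n, b + b') >> - << (n, b) >> - << (n, b') >>)
| tensor_rel_bal n (s : S) b :
    tensor_rel (<< ((s : S^c) *: n, b) >> - << (n, lact B s b) >>).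

Definition tensor : Type := zquot (subgrp_gen tensor_rel).
HB.instance Definition _ := GRing.Zmodule.on tensor.

Definition tensor_pi (z : {malg int[(N * B)%type]}) : tensor := zpi _ z.
HB.instance Definition _ := GRing.isZmodMorphism.Build {malg int[(N * B)%type]} tensor
  tensor_pi (zpi_is_zmod_morphism (subgrp_gen tensor_rel)).

Lemma tensor_piB z z' : tensor_pi (z - z') = tensor_pi z - tensor_pi z'.
Proof. exact: raddfB. Qed.

Definition tens (n : N) (b : B) : tensor := tensor_pi << (n, b) >>.

Lemma tensDl n n' b : tens (n + n') b = tens n b + tens n' b.
Proof.
apply/eqP; rewrite -subr_eq0 opprD addrA -!raddfB; apply/eqP.
rewrite -(raddf0 tensor_pi); apply/zpi_eq; rewrite subr0 => A [_]; apply.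
exact: tensor_rel_Dl.
Qed.
Lemma tensDr n b b' : tens n (b + b') = tens n b + tens n b'.
Proof.
apply/eqP; rewrite -subr_eq0 opprD addrA -!raddfB; apply/eqP.
rewrite -(raddf0 tensor_pi); apply/zpi_eq; rewrite subr0 => A [_]; apply.
exact: tensor_rel_Dr.
Qed.
Lemma tens_bal n (s : S) b : tens ((s : S^c) *: n) b = tens n (lact B s b).
Proof. by apply/zpi_eq => A [_]; apply; exact: tensor_rel_bal. Qed.

Lemma tensor_ind (P : tensor -> Prop) :
  P 0 -> (forall x y, P x -> P y -> P (x - y)) -> (forall n b, P (tens n b)) ->
  forall x, P x.
Proof.
move=> P0 PB Pt x; rewrite -[x]zreprK; move: (zrepr x) => z; rewrite [z]monalgE.
have PN y : P y -> P (- y) by rewrite -(sub0r y); exact: PB.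
have PD y z' : P y -> P z' -> P (y + z').
  by move=> Py Pz; rewrite -(opprK z'); exact: PB Py (PN _ Pz).
rewrite (raddf_sum tensor_pi); apply: (big_ind P) => // -[n b] _.
have PM m : P (tens n b *+ m) by elim: m => // m IH; rewrite mulrS; exact: PD.
have -> c : << c *g (n, b) >> = << (n, b) >> *~ c :> {malg int[(N * B)%type]}.
  by rewrite -(raddfMz (mkmalgU (n, b))) intz.
rewrite raddfMz; case: z@__ => m; first exact: PM.
by rewrite NegzE mulrNz; apply: PN; exact: PM.
Qed.
End TensorProduct.

Section TensorMap.
Variables (S R : pzRingType) (N N' : rmodType S) (B : bimodule S R).

Definition tensor_fun (f : N -> N') (g : B -> B) (x : tensor N B) : tensor N' B :=
  tensor_pi (lin_ext (fun p : N * B => << (f p.1, g p.2) >> : {malg int[(N' * B)%type]})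
                     (zrepr x)).

Variables (f : {linear N -> N'}) (g : {additive B -> B}).
Hypothesis g_lact : forall (s : S) b, g (lact B s b) = lact B s (g b).

Lemma tensor_fun_pi z : tensor_fun f g (tensor_pi z) =
  tensor_pi (lin_ext (fun p : N * B => << (f p.1, g p.2) >>) z).
Proof.
rewrite /tensor_fun; set h := lin_ext _.
have hB x y : h (x - y) = h x - h y by exact: (linearB h).
have hU p : h << p >> = << (f p.1, g p.2) >> by exact: lin_extU.
have hK w : subgrp_set (subgrp_gen (@tensor_rel S R N B)) w -> tensor_pi (h w) = 0.
  move=> /(_ [set v | tensor_pi (h v) = 0]); apply; split; first split.
  - by rewrite /= -(subrr 0) hB subrr raddf0.
  - by move=> x y hx hy; rewrite /= hB tensor_piB [X in X - _]hx [X in _ - X]hy subr0.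
  - move=> _ [n n' b|n b b'|n s b]; rewrite /= !(hB, hU) !tensor_piB.
    + by rewrite raddfD; have := tensDl (f n) (f n') (g b); rewrite /tens => ->;
        rewrite addrAC addrK subrr.
    + by rewrite raddfD; have := tensDr (f n) (g b) (g b'); rewrite /tens => ->;
        rewrite addrAC addrK subrr.
    + by apply/eqP; rewrite subr_eq0; apply/eqP; rewrite linearZ g_lact; exact: tens_bal.
apply/eqP; rewrite -subr_eq0 -raddfB -hB; apply/eqP/hK.
by apply/zpi_eq; rewrite zreprK.
Qed.

Lemma tensor_fun_tens n b : tensor_fun f g (tens n b) = tens (f n) (g b).
Proof. by rewrite /tens tensor_fun_pi lin_extU. Qed.

Lemma tensor_fun_zmod_morphism : zmod_morphism (tensor_fun f g).
Proof.
move=> x y; rewrite -[x]zreprK -[y]zreprK.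
by rewrite -(raddfB (@tensor_pi _ _ N B)) !tensor_fun_pi linearB raddfB.
Qed.
End TensorMap.

Section TensorModule.
Variables (S R : pzRingType) (N : rmodType S) (B : bimodule S R).

Definition bimod_ract (r : R^c) : B -> B := *:%R r.
HB.instance Definition _ r :=
  GRing.isZmodMorphism.Build B B (bimod_ract r) (scalerBr r).

Lemma bimod_ract_lact (r : R^c) s b :
  bimod_ract r (lact B s b) = lact B s (bimod_ract r b).
Proof. by rewrite /bimod_ract linearZ. Qed.

Definition tensor_scale (r : R^c) (x : tensor N B) : tensor N B :=
  tensor_fun idfun (bimod_ract r) x.

Lemma tensor_scale_tens r n b : tensor_scale r (tens n b) = tens n (r *: b).
Proof. exact: (tensor_fun_tens idfun (bimod_ract_lact r)). Qed.

Lemma tensor_scale_zmod_morphism r : zmod_morphism (tensor_scale r).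
Proof. exact: (tensor_fun_zmod_morphism idfun (bimod_ract_lact r)). Qed.
HB.instance Definition _ r := GRing.isZmodMorphism.Build (tensor N B) (tensor N B)
  (tensor_scale r) (tensor_scale_zmod_morphism r).

Lemma tensor_scaleB r x y : tensor_scale r (x - y) = tensor_scale r x - tensor_scale r y.
Proof. exact: raddfB. Qed.
Lemma tensor_scale0 r : tensor_scale r 0 = 0.
Proof. exact: raddf0. Qed.

Lemma tensor_scaleA a b v : tensor_scale a (tensor_scale b v) = tensor_scale (a * b) v.
Proof.
elim/tensor_ind: v => [|x y hx hy|n c]; first by rewrite !tensor_scale0.
- by rewrite !tensor_scaleB hx hy.
- by rewrite !tensor_scale_tens scalerA.
Qed.
Lemma tensor_scale1 : left_id 1 tensor_scale.
Proof.
elim/tensor_ind=> [|x y hx hy|n c]; first by rewrite !tensor_scale0.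
- by rewrite !tensor_scaleB hx hy.
- by rewrite !tensor_scale_tens scale1r.
Qed.
Lemma tensor_scaleDr : right_distributive tensor_scale +%R.
Proof. by move=> a u v; exact: raddfD. Qed.
Lemma tensor_scaleDl v : {morph tensor_scale^~ v : a b / a + b}.
Proof.
move=> a b; elim/tensor_ind: v => [|x y hx hy|n c].
- by rewrite !tensor_scale0 addr0.
- by rewrite !tensor_scaleB hx hy opprD addrACA.
- by rewrite !tensor_scale_tens scalerDl tensDr.
Qed.

HB.instance Definition _ := GRing.Zmodule_isLmodule.Build R^c (tensor N B)
  tensor_scaleA tensor_scale1 tensor_scaleDr tensor_scaleDl.
End TensorModule.

Section TensorFunctoriality.
Variables (S R : pzRingType) (B : bimodule S R).

Lemma tensor_linear_ext (N : rmodType S) (M : rmodType R)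
    (f g : {linear tensor N B -> M}) :
  (forall n b, f (tens n b) = g (tens n b)) -> f = g.
Proof.
have hB (h : {linear tensor N B -> M}) u v : h (u - v) = h u - h v by exact: raddfB.
move=> fg; apply: linear_ext; elim/tensor_ind=> // [|x y hx hy].
  by rewrite -(subrr 0) !hB !subrr.
by rewrite !hB hx hy.
Qed.

Definition tensor_map_fun (N N' : rmodType S) (f : {linear N -> N'}) :
  tensor N B -> tensor N' B := tensor_fun f idfun.

Lemma tensor_map_tens (N N' : rmodType S) (f : {linear N -> N'}) n b :
  tensor_map_fun f (tens n b) = tens (f n) b.
Proof. exact: (@tensor_fun_tens _ _ _ _ _ f idfun (fun s b => erefl)). Qed.

Lemma tensor_map_is_linear (N N' : rmodType S) (f : {linear N -> N'}) : linear (tensor_map_fun f).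
Proof.
have fB : zmod_morphism (tensor_map_fun f).
  exact: (@tensor_fun_zmod_morphism _ _ _ _ _ f idfun (fun s b => erefl)).
have f0 : tensor_map_fun f 0 = 0 by rewrite -(subrr 0) fB !subrr.
have fN x : tensor_map_fun f (- x) = - tensor_map_fun f x by rewrite -sub0r fB f0 sub0r.
move=> a x y; rewrite -{1}(opprK y) fB fN opprK; congr (_ + _).
elim/tensor_ind: x => [|u v hu hv|n b]; first by rewrite scaler0 f0 scaler0.
- by rewrite scalerBr !fB hu hv scalerBr.
- by rewrite [a *: _]tensor_scale_tens !tensor_map_tens [RHS]tensor_scale_tens.
Qed.
HB.instance Definition _ N N' f := GRing.isLinear.Build R^c (tensor N B) (tensor N' B)
  *:%R (@tensor_map_fun N N' f) (tensor_map_is_linear f).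

Definition tensor_map (N N' : rmodType S) (f : {linear N -> N'}) :
  {linear tensor N B -> tensor N' B} := tensor_map_fun f.
End TensorFunctoriality.

(* Preadditive categories. *)
Record category := Category {
  obj :> Type;
  hom : obj -> obj -> zmodType;
  idm : forall X, hom X X;
  comp : forall X Y Z, hom Y Z -> hom X Y -> hom X Z;
  comp_idl : forall X Y (f : hom X Y), comp (idm Y) f = f;
  comp_idr : forall X Y (f : hom X Y), comp f (idm X) = f;
  compA : forall W X Y Z (h : hom Y Z) (g : hom X Y) (f : hom W X),
    comp h (comp g f) = comp (comp h g) f;
  compDl : forall X Y Z (g g' : hom Y Z) (f : hom X Y),
    comp (g + g') f = comp g f + comp g' f;
  compDr : forall X Y Z (g : hom Y Z) (f f' : hom X Y),
    comp g (f + f') = comp g f + comp g f' }.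
Arguments idm {c} X.
Notation "g \oc f" := (comp g f) (at level 40, left associativity).

Section CategoryNotions.
Variable C : category.
Implicit Types X Y Z : C.

Definition mono X Y (f : hom X Y) : Prop :=
  forall W (g h : hom W X), f \oc g = f \oc h -> g = h.
Definition epi X Y (f : hom X Y) : Prop :=
  forall Z (g h : hom Y Z), g \oc f = h \oc f -> g = h.

Definition isomorphic X Y : Prop := exists (f : hom X Y) (g : hom Y X),
  g \oc f = idm X /\ f \oc g = idm Y.

Definition is_zero_obj Z : Prop :=
  forall X, (forall f : hom X Z, f = 0) /\ (forall f : hom Z X, f = 0).

Definition is_biproduct X Y P (i1 : hom X P) (i2 : hom Y P) (p1 : hom P X)
    (p2 : hom P Y) : Prop :=
  [/\ p1 \oc i1 = idm X, p2 \oc i2 = idm Y, p1 \oc i2 = 0, p2 \oc i1 = 0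
    & i1 \oc p1 + i2 \oc p2 = idm P].

Definition is_kernel X Y Z (i : hom X Y) (f : hom Y Z) : Prop :=
  f \oc i = 0 /\
  forall W (h : hom W Y), f \oc h = 0 -> exists! h' : hom W X, i \oc h' = h.
Definition is_cokernel X Y Z (p : hom Y Z) (f : hom X Y) : Prop :=
  p \oc f = 0 /\
  forall W (h : hom Y W), h \oc f = 0 -> exists! h' : hom Z W, h' \oc p = h.

Definition short_exact X Y Z (f : hom X Y) (g : hom Y Z) : Prop :=
  is_kernel f g /\ is_cokernel g f.

Definition projective P : Prop :=
  forall X Y (g : hom X Y) (f : hom P Y), epi g -> exists h, g \oc h = f.

Record abelian : Prop := Abelian {
  abelian_zero : exists Z, is_zero_obj Z;
  abelian_biproduct : forall X Y, exists P i1 i2 p1 p2,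
    @is_biproduct X Y P i1 i2 p1 p2;
  abelian_kernel : forall Y Z (f : hom Y Z), exists X (i : hom X Y), is_kernel i f;
  abelian_cokernel : forall X Y (f : hom X Y), exists Z (p : hom Y Z), is_cokernel p f;
  abelian_mono : forall X Y (f : hom X Y), mono f ->
    exists Z (g : hom Y Z), is_kernel f g;
  abelian_epi : forall X Y (f : hom X Y), epi f ->
    exists W (g : hom W X), is_cokernel f g }.
End CategoryNotions.

Definition full_subcategory (C : category) (P : C -> Prop) : category :=
  @Category {X : C | P X} (fun X Y => hom (sval X) (sval Y)) (fun X => idm (sval X))
    (fun X Y Z g f => g \oc f) (fun X Y f => comp_idl f) (fun X Y f => comp_idr f)
    (fun W X Y Z h g f => compA h g f) (fun X Y Z g g' f => compDl g g' f)
    (fun X Y Z g f f' => compDr g f f').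

Record functor (C D : category) := Functor {
  fobj :> C -> D;
  fmap : forall X Y, hom X Y -> hom (fobj X) (fobj Y);
  fmap_id : forall X, fmap (idm X) = idm (fobj X);
  fmap_comp : forall X Y Z (g : hom Y Z) (f : hom X Y),
    fmap (g \oc f) = fmap g \oc fmap f }.

Definition id_functor (C : category) : functor C C :=
  @Functor C C id (fun X Y f => f) (fun X => erefl) (fun X Y Z g f => erefl).

Section FunctorComposition.
Variables (C D E : category) (G : functor D E) (F : functor C D).

Lemma fcomp_id X : fmap G (fmap F (idm X)) = idm (G (F X)).
Proof. by rewrite !fmap_id. Qed.
Lemma fcomp_comp X Y Z (g : hom Y Z) (f : hom X Y) :
  fmap G (fmap F (g \oc f)) = fmap G (fmap F g) \oc fmap G (fmap F f).
Proof. by rewrite !fmap_comp. Qed.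

Definition fcomp : functor C E :=
  @Functor C E (fun X => G (F X)) (fun X Y f => fmap G (fmap F f)) fcomp_id fcomp_comp.
End FunctorComposition.
Notation "G \of F" := (fcomp G F) (at level 40, left associativity).

Record nat_trans (C D : category) (F G : functor C D) := NatTrans {
  ntc :> forall X, hom (F X) (G X);
  ntc_natural : forall X Y (f : hom X Y), ntc Y \oc fmap F f = fmap G f \oc ntc X }.

Definition naturally_isomorphic (C D : category) (F G : functor C D) : Prop :=
  exists (a : nat_trans F G) (b : nat_trans G F),
    forall X, b X \oc a X = idm (F X) /\ a X \oc b X = idm (G X).

Record adjunction (C D : category) (L : functor C D) (R : functor D C) := Adjunction {
  adj_unit : nat_trans (id_functor C) (R \of L);
  adj_counit : nat_trans (L \of R) (id_functor D);
  adj_triangleL : forall X : C, adj_counit (L X) \oc fmap L (adj_unit X) = idm (L X);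
  adj_triangleR : forall Y : D, fmap R (adj_counit Y) \oc adj_unit (R Y) = idm (R Y) }.

Section FunctorNotions.
Variables (C D : category).
Implicit Type F : functor C D.

Definition faithful F : Prop :=
  forall X Y (f g : hom X Y), fmap F f = fmap F g -> f = g.

Definition exact_functor F : Prop :=
  (forall X Y (f g : hom X Y), fmap F (f + g) = fmap F f + fmap F g) /\
  forall X Y Z (f : hom X Y) (g : hom Y Z),
    short_exact f g -> short_exact (fmap F f) (fmap F g).

Definition preserves_projectives F : Prop := forall P, projective P -> projective (F P).

Definition essential_image F (Y : D) : Prop := exists X, isomorphic (F X) Y.

Definition zero_functor F : Prop := forall X, is_zero_obj (F X).

(* A functor G with a natural transformation G -> F which is objectwise a kernel
   of a; it exists if D has kernels, and is then unique up to isomorphism. *)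
Record kernel_functor (F H : functor C D) (a : nat_trans F H) := KernelFunctor {
  kerf :> functor C D;
  kerf_incl : nat_trans kerf F;
  kerf_is_kernel : forall X, is_kernel (kerf_incl X) (a X) }.
End FunctorNotions.

Record cleft_extension (B A : category) (e : functor A B) (l i : functor B A) : Prop :=
  CleftExtension {
    cleft_base_abelian : abelian B;
    cleft_abelian : abelian A;
    cleft_faithful : faithful e;
    cleft_exact : exact_functor e;
    cleft_adjunction : inhabited (adjunction l e);
    cleft_section : naturally_isomorphic (e \of i) (id_functor B) }.

Section Restriction.
Variables (C D : category) (P : C -> Prop) (P' : D -> Prop) (F : functor C D).
Hypothesis F_P : forall X, P X -> P' (F X).

Definition restrict_functor : functor (full_subcategory P) (full_subcategory P') :=
  @Functor (full_subcategory P) (full_subcategory P')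
    (fun X => exist P' (F (sval X)) (F_P (svalP X)))
    (fun X Y f => fmap F f) (fun X => fmap_id F (sval X))
    (fun X Y Z g f => fmap_comp F g f).
End Restriction.

Section ModuleCategories.
Variable R : pzRingType.

Definition lin_comp (X Y Z : rmodType R) (g : {linear Y -> Z}) (f : {linear X -> Y}) :
  {linear X -> Z} := g \o f.

Lemma lin_comp_idl (X Y : rmodType R) (f : {linear X -> Y}) : lin_comp idfun f = f.
Proof. exact: linear_ext. Qed.
Lemma lin_comp_idr (X Y : rmodType R) (f : {linear X -> Y}) : lin_comp f idfun = f.
Proof. exact: linear_ext. Qed.
Lemma lin_compA (W X Y Z : rmodType R) (h : {linear Y -> Z}) (g : {linear X -> Y})
  (f : {linear W -> X}) : lin_comp h (lin_comp g f) = lin_comp (lin_comp h g) f.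
Proof. exact: linear_ext. Qed.
Lemma lin_compDl (X Y Z : rmodType R) (g g' : {linear Y -> Z}) (f : {linear X -> Y}) :
  lin_comp (g + g') f = lin_comp g f + lin_comp g' f.
Proof. exact: linear_ext. Qed.
Lemma lin_compDr (X Y Z : rmodType R) (g : {linear Y -> Z}) (f f' : {linear X -> Y}) :
  lin_comp g (f + f') = lin_comp g f + lin_comp g f'.
Proof. by apply: linear_ext => x; exact: raddfD. Qed.

Definition Mod : category :=
  @Category (rmodType R) (fun X Y => {linear X -> Y} : zmodType)
    (fun X => idfun : {linear X -> X}) lin_comp
    lin_comp_idl lin_comp_idr lin_compA lin_compDl lin_compDr.

Definition fin_gen (M : Mod) : Prop :=
  exists (n : nat) (g : 'I_n -> (M : rmodType R)),
    forall x : (M : rmodType R), exists c : 'I_n -> R^c, x = \sum_i c i *: g i.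

Definition mod : category := full_subcategory fin_gen.

Definition projective_module (P : rmodType R) : Prop :=
  forall (M N : rmodType R) (g : {linear M -> N}) (f : {linear P -> N}),
    (forall y, exists x, g x = y) -> exists h : {linear P -> M}, g \o h =1 f.

(* The objects of mod are finitely generated, so this is proj(R). *)
Definition proj (P : mod) : Prop := projective_module (sval P).
End ModuleCategories.

Section HomTensorFunctors.
Variables (S R : pzRingType) (B : bimodule S R).

Definition bihom_post_fun (M N : rmodType R) (f : {linear M -> N}) (h : bihom B M) :
  bihom B N := (f \o (h : {linear B -> M}) : {linear B -> N}).
Lemma bihom_post_is_linear M N f : linear (@bihom_post_fun M N f).
Proof. by move=> s h h'; apply: linear_ext => x; exact: raddfD. Qed.
HB.instance Definition _ M N f := GRing.isLinear.Build S^c (bihom B M) (bihom B N) *:%R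
  (@bihom_post_fun M N f) (bihom_post_is_linear f).
Definition bihom_post (M N : rmodType R) (f : {linear M -> N}) : {linear bihom B M -> bihom B N} := @bihom_post_fun M N f.

Lemma bihom_post_id (M : rmodType R) : bihom_post (idfun : {linear M -> M}) = idfun.
Proof. by apply: linear_ext => h; apply: linear_ext. Qed.
Lemma bihom_post_comp (X Y Z : rmodType R) (g : {linear Y -> Z}) (f : {linear X -> Y}) :
  bihom_post (lin_comp g f) = lin_comp (bihom_post g) (bihom_post f).
Proof. by apply: linear_ext => h; apply: linear_ext. Qed.

Definition Hom_functor : functor (Mod R) (Mod S) :=
  @Functor (Mod R) (Mod S) (fun M => bihom B M) (fun M N f => bihom_post f)
    bihom_post_id bihom_post_comp.

Lemma tensor_map_id (N : rmodType S) : tensor_map B (idfun : {linear N -> N}) = idfun.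
Proof. by apply: tensor_linear_ext => n b; exact: tensor_map_tens. Qed.
Lemma tensor_map_comp (X Y Z : rmodType S) (g : {linear Y -> Z}) (f : {linear X -> Y}) :
  tensor_map B (lin_comp g f) = lin_comp (tensor_map B g) (tensor_map B f).
Proof.
by apply: tensor_linear_ext => n b; rewrite /= !tensor_map_tens.
Qed.

Definition Tensor_functor : functor (Mod S) (Mod R) :=
  @Functor (Mod S) (Mod R) (fun N => tensor N B) (fun M N f => tensor_map B f)
    tensor_map_id tensor_map_comp.
End HomTensorFunctors.

Section ArrowRemoval.
Variables (k : fieldType) (Q : quiver).

Definition arrow_ideal : ideal (pathalg k Q) := ideal_gen (range (fun a => arr k a)).

Definition admissible (I : ideal (pathalg k Q)) : Prop :=
  exists m, [/\ (2 <= m)%N, ideal_pow arrow_ideal m `<=` I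
              & I `<=` ideal_pow arrow_ideal 2].

Variables (t : nat) (a : 'I_t -> arrow Q).

(* Equivalently, x lies in kQ*, the path algebra of Q without the arrows a_i. *)
Definition avoids (x : pathalg k Q) : Prop :=
  forall p, p \in msupp x -> forall i, a i \notin arrows p.

Definition not_in_minimal_generators (I : ideal (pathalg k Q)) : Prop :=
  exists X, minimal_generating_set I X /\ forall x, X x -> avoids x.

(* The ideal of Lambda = kQ/I whose quotient is Gamma. *)
Definition removal_ideal (I : ideal (pathalg k Q)) : ideal (quot_ring I) :=
  ideal_gen (range (fun i => quot_pi I (arr k (a i)))).
End ArrowRemoval.

(* Main.v *)
(* Since I is generated by elements avoiding the arrows a_i, the map x |-> sum of
   m(u, v) over the factorisations x = u a_i v of a path x descends to Lam, for
   every k-balanced biadditive m on Lam; write Delta_i(m) for it.  It satisfies a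
   Leibniz rule, vanishes on the image of nu, and for Gam-balanced m it telescopes:
   the sum over i of Delta_i((u, v) |-> m(u, a_i v) - m(u a_i, v)) maps x to
   m(1, x) - m(x, 1).  In effect Lam is the tensor ring over Gam of the bimodule
   spanned by the a_i.
   For suitable m, built from a k-dual basis of Lam or of a module X, telescoping
   gives explicit dual bases: of Lam as a right and as a left Gam-module (hence r and
   l are exact and e preserves projectives), and of the kernel of the counit
   eX (x)_Gam Lam -> X as a right Lam-module, with generators x (x) a_i - x a_i (x) 1.
   So the image of G is projective, hence so is that of F.
   The hypothesis Hom(e_i Lam, f_j Lam) = f_j Lam e_i = 0 enters through F^2 = 0:
   if the a_i annihilate X then the e_j annihilate the kernel of the counit of X, and
   when the a_i and the e_i both annihilate X, the above generators are zero. *)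

Require Import Defs.
From HB Require Import structures.
From mathcomp Require Import all_boot all_order all_algebra.
From mathcomp Require Import finmap.
From mathcomp Require Import boolp classical_sets.
From mathcomp.multinomials Require Import monalg.
(* Again, because vector.hom shadows the hom of categories. *)
Require Import Defs.

Set Implicit Arguments.
Unset Strict Implicit.
Unset Printing Implicit Defensive.
Import GRing.Theory.
Local Open Scope ring_scope.

(** Underlying [Delta] is a derivation of Lam with values in a direct sum of copies of Lam (x)_k
    Lam, one for each removed arrow. This tensor product is never built: the derivation is only ever
    paired with a k-balanced m, and a list of pairs stands for a tensor. The list depends on a
    chosen representative; its sums against balanced m do not. A k-dual basis suffices because an
    arrow a: v_e -> v_f that no relation involves spans the bimodule Gam e (x)_k f Gam. Tensoring a
    right module X over Gam with it and inducing to Lam gives X e (x)_k f Lam, that is, copies of f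
    Lam indexed by a k-basis of X e, whatever X is over Gam. This is why every value of G is
    projective. F and G are to be treated for every adjunction between l and e and every kernel of
    its counit, while computations need one explicit counit. Two counits for the same functors
    differ by an automorphism of l e X, which carries kernels to kernels. That I contains a power of
    the arrow ideal gives finite dimension over k: hence the k-dual bases, the kernels in mod, and
    the finite generation of the values of i, e and r. *)

Definition linear_map (A : pzRingType) (U V : lmodType A) (f : U -> V)
    (flin : linear f) : {linear U -> V} :=
  let m := GRing.isLinear.Build A U V *:%R f flin in
  HB.pack_for {linear U -> V} f m.

(** * Finite-dimensional vector spaces *)

Section FiniteDimension.
Variables (k : fieldType) (V : lmodType k).

(** The [g i] need not lie in W, so the notion passes to subsets of W without change. *)
Definition spanned_by n (g : 'I_n -> V) (W : set V) : Prop :=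
  forall x, W x -> exists c : 'I_n -> k, x = \sum_i c i *: g i.

(** Gaussian elimination on one generator: W' collects the elements of W expressible without
    [g ord0]. If W' is not all of W, any w0 in W outside W' has a nonzero coefficient there, and W
    is spanned by W' together with w0. *)
Lemma spanned_subspace n (g : 'I_n -> V) (W : set V) :
  (forall c x y, W x -> W y -> W (c *: x + y)) -> W 0 -> spanned_by g W ->
  exists m (w : 'I_m -> V), (forall i, W (w i)) /\ spanned_by w W.
Proof.
elim: n g W => [|n IH] g W Wlin W0 gW.
  exists 0%N, g; split; first by case.
  by [].
pose g' i := g (lift ord0 i).
pose W' := [set x | W x /\ exists c : 'I_n -> k, x = \sum_i c i *: g' i]%classic.
have W'lin c x y : W' x -> W' y -> W' (c *: x + y).
  move=> [Wx [a xE]] [Wy [b yE]]; split; first exact: Wlin.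
  exists (fun i => c * a i + b i); rewrite xE yE.
  by rewrite scaler_sumr -big_split; apply: eq_bigr => i _; rewrite scalerDl scalerA.
have W'0 : W' 0.
  by split=> //; exists (fun=> 0); rewrite big1 // => i _; rewrite scale0r.
have W'span : spanned_by g' W' by move=> x [].
have [m [w [wW' wspan]]] := IH g' W' W'lin W'0 W'span.
have [WW'|] := pselect (forall x, W x -> W' x).
  exists m, w; split=> [i|x /WW']; [by case: (wW' i) | exact: wspan].
move=> /existsNP[w0 /not_implyP[Ww0 nW'w0]].
have [c0 cE] := gW _ Ww0.
have c0n0 : c0 ord0 != 0.
  apply/eqP => c00; apply: nW'w0; split=> //.
  by exists (fun i => c0 (lift ord0 i)); rewrite cE big_ord_recl c00 scale0r add0r.
exists m.+1, (fun i => if unlift ord0 i is Some j then w j else w0); split.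
  by move=> i; case: unliftP => [j _|_] //; case: (wW' j).
(* The ratio r is chosen so that x - r w0 has coefficient zero at [g ord0], hence lies in W'. *)
move=> x Wx; have [c xE] := gW _ Wx; pose r := c ord0 / c0 ord0.
have [|d dE] := wspan (x - r *: w0).
  split; first by rewrite addrC -scaleNr; apply: Wlin.
  exists (fun i => c (lift ord0 i) - r * c0 (lift ord0 i)).
  rewrite xE {1}cE !big_ord_recl /= scalerDr scaler_sumr opprD addrACA scalerA.
  rewrite divfK // subrr add0r -sumrB; apply: eq_bigr => i _.
  by rewrite scalerBl scalerA.
exists (fun i => if unlift ord0 i is Some j then d j else r).
rewrite big_ord_recl unlift_none -[LHS](subrK (r *: w0)) addrC dE; congr (_ + _).
by apply: eq_bigr => i _; rewrite liftK.
Qed.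

(** A spanning family of least length is free, since a relation would allow one member to be
    dropped. Coordinates, picked by choice, are then unique and therefore linear. *)
Lemma finite_dual_basis n (g : 'I_n -> V) : spanned_by g [set: V]%classic ->
  exists m (x : 'I_m -> V) (phi : 'I_m -> {linear V -> k^o}),
    forall v, v = \sum_i phi i v *: x i.
Proof.
move=> gspan.
have ex : exists n, `[< exists g : 'I_n -> V, spanned_by g [set: V]%classic >].
  by exists n; apply/asboolP; exists g.
have [m /asboolP[x xspan] minm] := ex_minnP ex.
have free (c : 'I_m -> k) : \sum_i c i *: x i = 0 -> forall j, c j = 0.
  case: m x xspan minm c => [|m] x xspan minm c; first by move=> _ [].
  move=> c0 j; apply/eqP; apply/negP => /negP cj.
  suff: (m.+1 <= m)%N by rewrite ltnn.
  apply: minm; apply/asboolP; exists (fun i => x (lift j i)) => v _.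
  have [d ->] := xspan v I.
  exists (fun i => d (lift j i) - d j / c j * c (lift j i)).
  move: c0; rewrite (bigD1_ord j) //= (bigD1_ord j) //= => /eqP.
  rewrite addrC addr_eq0 => /eqP c0.
  have -> : x j = - ((c j)^-1 *: \sum_(i < m) c (lift j i) *: x (lift j i)).
    by rewrite c0 scalerN opprK scalerA mulVf // scale1r.
  rewrite scalerN scalerA addrC scaler_sumr -sumrB.
  by apply: eq_bigr => i _; rewrite scalerA scalerBl.
have coord_ex v : exists c : 'I_m -> k, v = \sum_i c i *: x i by exact: xspan.
pose phi i v := projT1 (cid (coord_ex v)) i.
have phiE v : v = \sum_i phi i v *: x i by rewrite /phi; case: cid.
have philin i : linear (phi i : V -> k^o).
  move=> a u v; apply/eqP; rewrite -subr_eq0; apply/eqP.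
  apply: (free (fun i => phi i (a *: u + v) - (a *: (phi i u : k^o) + phi i v))).
  under eq_bigr do rewrite scalerBl scalerDl -scalerA.
  by rewrite sumrB big_split /= -scaler_sumr -!phiE subrr.
by exists m, x, (fun i => linear_map (philin i)).
Qed.
End FiniteDimension.

Section ScalarRestriction.
Variables (k : fieldType) (R : pzRingType).

(* The morphism is a phantom argument: it selects the [k]-module structure. *)
Definition scalars (h : {rmorphism k -> R}) (M : rmodType R) : Type := M.
HB.instance Definition _ h M := GRing.Zmodule.on (scalars h M).

Definition scalars_scale h (M : rmodType R) (c : k) (x : scalars h M) : scalars h M :=
  (h c : R^c) *: (x : M).

Lemma scalars_scaleA h M a b v :
  @scalars_scale h M a (scalars_scale b v) = scalars_scale (a * b) v.
Proof. by rewrite /scalars_scale scalerA mulrC rmorphM. Qed.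
Lemma scalars_scale1 h M : left_id 1 (@scalars_scale h M).
Proof. by move=> v; rewrite /scalars_scale rmorph1 scale1r. Qed.
Lemma scalars_scaleDr h M : right_distributive (@scalars_scale h M) +%R.
Proof. by move=> a u v; exact: scalerDr. Qed.
Lemma scalars_scaleDl h M v : {morph (@scalars_scale h M)^~ v : a b / a + b}.
Proof. by move=> a b; rewrite /scalars_scale rmorphD; exact: scalerDl. Qed.

HB.instance Definition _ h M := GRing.Zmodule_isLmodule.Build k (scalars h M)
  (@scalars_scaleA h M) (@scalars_scale1 h M) (@scalars_scaleDr h M)
  (@scalars_scaleDl h M).
End ScalarRestriction.

(** * Submodules, quotients and dual bases of modules *)

Section Submodule.
Variables (A : pzRingType) (M : lmodType A).

Definition is_submodule (W : set M) : Prop :=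
  W 0 /\ forall a x y, W x -> W y -> W (a *: x + y).

Record submodule := Submodule { submodule_set :> set M;
                                submoduleP : is_submodule submodule_set }.
Variable W : submodule.

Definition submodule_pred : M -> bool := fun x => `[< submodule_set W x >].

Lemma submodule_pred_closed : submod_closed submodule_pred.
Proof.
case: (submoduleP W) => W0 Wlin; split=> [|r x y]; rewrite ?unfold_in.
  exact/asboolP.
by move=> /asboolP Wx /asboolP Wy; apply/asboolP; exact: Wlin.
Qed.
HB.instance Definition _ :=
  GRing.isSubmodClosed.Build A M submodule_pred submodule_pred_closed.

Record subm := SubM { subm_val : M; subm_valP : submodule_pred subm_val }.
HB.instance Definition _ := [isSub for subm_val].
HB.instance Definition _ := [Choice of subm by <:].
HB.instance Definition _ := [SubChoice_isSubLmodule of subm by <:].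

Definition subm_incl : {linear subm -> M} := val.

Lemma subm_incl_inj : injective subm_incl.
Proof. exact: val_inj. Qed.

Lemma subm_inclP (x : subm) : submodule_set W (subm_incl x).
Proof. by case: x => x Wx; apply/asboolP. Qed.

Lemma subm_incl_onto x : submodule_set W x -> exists y, subm_incl y = x.
Proof. by move=> /asboolP Wx; exists (SubM Wx). Qed.

Lemma submodule_subgroup : is_subgroup W.
Proof.
case: (submoduleP W) => W0 Wlin; split=> // x y Wx Wy.
by rewrite -scaleN1r addrC; exact: Wlin.
Qed.

Definition quotm : Type := zquot (Subgrp submodule_subgroup).
HB.instance Definition _ := GRing.Zmodule.on quotm.

Definition quotm_proj_fun (x : M) : quotm := zpi (Subgrp submodule_subgroup) x.
HB.instance Definition _ := GRing.isZmodMorphism.Build M quotm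
  quotm_proj_fun (zpi_is_zmod_morphism (Subgrp submodule_subgroup)).

Lemma quotm_proj_fun_eq x y : quotm_proj_fun x = quotm_proj_fun y <-> submodule_set W (x - y).
Proof. exact: zpi_eq. Qed.

Lemma quotm_proj_fun_surj (y : quotm) : exists x, quotm_proj_fun x = y.
Proof. by exists (zrepr y); exact: zreprK. Qed.

Definition quotm_scale (a : A) (y : quotm) : quotm := quotm_proj_fun (a *: zrepr y).

Lemma quotm_scaleE a x : quotm_scale a (quotm_proj_fun x) = quotm_proj_fun (a *: x).
Proof.
apply/quotm_proj_fun_eq; rewrite -scalerBr -[_ *: _]addr0.
case: (submoduleP W) => W0 Wlin; apply: Wlin => //.
by apply/quotm_proj_fun_eq; exact: zreprK.
Qed.

Lemma quotm_scaleA a b v : quotm_scale a (quotm_scale b v) = quotm_scale (a * b) v.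
Proof. by have [x <-] := quotm_proj_fun_surj v; rewrite !quotm_scaleE scalerA. Qed.
Lemma quotm_scale1 : left_id 1 quotm_scale.
Proof.
by move=> v; have [x <-] := quotm_proj_fun_surj v; rewrite quotm_scaleE scale1r.
Qed.
Lemma quotm_scaleDr : right_distributive quotm_scale +%R.
Proof.
move=> a u v; have [x <-] := quotm_proj_fun_surj u.
have [y <-] := quotm_proj_fun_surj v.
by rewrite -raddfD !quotm_scaleE scalerDr raddfD.
Qed.
Lemma quotm_scaleDl v : {morph quotm_scale^~ v : a b / a + b}.
Proof.
move=> a b; have [x <-] := quotm_proj_fun_surj v.
by rewrite !quotm_scaleE scalerDl raddfD.
Qed.
HB.instance Definition _ := GRing.Zmodule_isLmodule.Build A quotm
  quotm_scaleA quotm_scale1 quotm_scaleDr quotm_scaleDl.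

Lemma quotm_proj_linear : linear quotm_proj_fun.
Proof. by move=> a x y; rewrite [LHS]raddfD; congr (_ + _); rewrite -[LHS]quotm_scaleE. Qed.

Definition quotm_proj : {linear M -> quotm} := linear_map quotm_proj_linear.

Lemma quotm_proj_eq0 x : quotm_proj x = 0 <-> submodule_set W x.
Proof. by rewrite -(raddf0 quotm_proj); have := quotm_proj_fun_eq x 0; rewrite subr0. Qed.

Lemma quotm_proj_surj (y : quotm) : exists x, quotm_proj x = y.
Proof. exact: quotm_proj_fun_surj. Qed.
End Submodule.

Section LinearMaps.
Variable A : pzRingType.
Implicit Types X Y Z W : lmodType A.

Lemma ker_is_submodule Y Z (f : {linear Y -> Z}) :
  is_submodule [set x | f x = 0]%classic.
Proof.
split=> /= [|a x y fx fy]; first exact: raddf0.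
by rewrite linearP fx fy scaler0 addr0.
Qed.
Definition ker Y Z (f : {linear Y -> Z}) := Submodule (ker_is_submodule f).

Lemma im_is_submodule Y Z (f : {linear Y -> Z}) :
  is_submodule [set y | exists x, f x = y]%classic.
Proof.
split=> /= [|a _ _ [x <-] [y <-]]; first by exists 0; exact: raddf0.
by exists (a *: x + y); rewrite linearP.
Qed.
Definition im Y Z (f : {linear Y -> Z}) := Submodule (im_is_submodule f).

Lemma inj_kerP Y Z (f : {linear Y -> Z}) :
  (forall x, f x = 0 -> x = 0) -> injective f.
Proof.
by move=> f0 x y /eqP; rewrite -subr_eq0 -raddfB => /eqP /f0 /eqP; rewrite subr_eq0 => /eqP.
Qed.

Lemma factor_inj X Y W (i : {linear X -> Y}) (h : {linear W -> Y}) :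
  injective i -> (forall w, exists x, i x = h w) ->
  exists h' : {linear W -> X}, forall w, i (h' w) = h w.
Proof.
move=> inj_i /choice[h' h'E]; have h'lin : linear h'.
  by move=> a x y; apply: inj_i; rewrite linearP !h'E linearP.
by exists (linear_map h'lin).
Qed.

Lemma factor_surj X Y Z (p : {linear Y -> Z}) (h : {linear Y -> X}) :
  (forall z, exists y, p y = z) -> (forall y, p y = 0 -> h y = 0) ->
  exists h' : {linear Z -> X}, forall y, h' (p y) = h y.
Proof.
move=> /choice[s sE] ph; have hE y y' : p y = p y' -> h y = h y'.
  move=> e; apply/eqP; rewrite -subr_eq0 -raddfB; apply/eqP/ph.
  by rewrite linearB e subrr.
have h'lin : linear (h \o s).
  by move=> a x y; rewrite /= -linearP; apply: hE; rewrite linearP !sE.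
by exists (linear_map h'lin) => y; apply: hE; rewrite sE.
Qed.

Lemma orbit_is_linear X (x : X) : linear (fun a : A^o => (a : A) *: x).
Proof. by move=> a b c; rewrite scalerDl scalerA. Qed.
Definition orbit_map X (x : X) : {linear A^o -> X} := linear_map (orbit_is_linear x).

Lemma combination_is_linear X n (g : 'I_n -> X) :
  linear (fun c : {ffun 'I_n -> A^o} => \sum_i (c i : A) *: g i).
Proof.
move=> a b c; rewrite scaler_sumr -big_split; apply: eq_bigr => i _.
by rewrite !ffunE scalerDl scalerA.
Qed.
Definition combination X n (g : 'I_n -> X) : {linear {ffun 'I_n -> A^o} -> X} :=
  linear_map (combination_is_linear g).

Lemma coordinate_is_linear n (i : 'I_n) : linear (fun c : {ffun 'I_n -> A^o} => c i).
Proof. by move=> a b c; rewrite !ffunE. Qed.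
Definition coordinate n (i : 'I_n) : {linear {ffun 'I_n -> A^o} -> A^o} :=
  linear_map (coordinate_is_linear i).

(** The working form of finitely generated projective. It passes to retracts, and it yields both
    versions of projectivity in use: lifting along epimorphisms of mod, and lifting along
    surjections of arbitrary modules. *)
Definition dual_basis X (J : finType) (g : J -> X) (d : J -> {linear X -> A^o}) : Prop :=
  forall x, x = \sum_j (d j x : A) *: g j.

Definition has_dual_basis X : Prop :=
  exists (J : finType) (g : J -> X) (d : J -> {linear X -> A^o}), dual_basis g d.

Lemma dual_basis_retract X Y (r : {linear X -> Y}) (s : {linear Y -> X}) :
  cancel s r -> has_dual_basis X -> has_dual_basis Y.
Proof.
move=> sK [J [g [d dg]]].
exists J, (fun j => r (g j)), (fun j => d j \o s : {linear _ -> _}) => y.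
rewrite -{1}(sK y) (dg (s y)) raddf_sum; apply: eq_bigr => j _.
exact: linearZ.
Qed.

Lemma dual_basis_lift (P M N : lmodType A) (g : {linear M -> N}) (f : {linear P -> N}) :
  has_dual_basis P -> (forall y, exists x, g x = y) ->
  exists h : {linear P -> M}, g \o h =1 f.
Proof.
move=> [J [b [d db]]] /choice[s sE].
have hlin : linear (fun x => \sum_j (d j x : A) *: s (f (b j))).
  move=> a x y; rewrite scaler_sumr -big_split; apply: eq_bigr => j _.
  by rewrite linearP scalerDl scalerA.
exists (linear_map hlin) => x; rewrite [in RHS](db x) /= !raddf_sum.
by apply: eq_bigr => j _; rewrite [LHS]linearZ [RHS]linearZ /= sE.
Qed.
End LinearMaps.

(** * Kernels and adjunctions in preadditive categories *)

Section CategoryLemmas.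
Implicit Types C D : category.

Lemma comp0r C (X Y Z : C) (f : hom Y Z) : f \oc (0 : hom X Y) = 0.
Proof. by apply: (addrI (f \oc 0)); rewrite -compDr !addr0. Qed.

Lemma comp0l C (X Y Z : C) (f : hom X Y) : (0 : hom Y Z) \oc f = 0.
Proof. by apply: (addrI (0 \oc f)); rewrite -compDl !addr0. Qed.

Lemma kernel_cancel C (X Y Z W : C) (i : hom X Y) (f : hom Y Z) (g h : hom W X) :
  is_kernel i f -> i \oc g = i \oc h -> g = h.
Proof.
move=> [fi0 ker_i] e; have [|h' [_ uniq]] := ker_i W (i \oc h).
  by rewrite compA fi0 comp0l.
by rewrite -(uniq g e) (uniq h erefl).
Qed.

(** Kernels are chosen objectwise; their universal property gives the action on maps, and the
    functor laws hold because they hold after composing with the kernel inclusions. *)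
Lemma kernel_functor_exists C D (F H : functor C D) (a : nat_trans F H) :
  (forall X Y (f : @hom D X Y), exists K (i : hom K X), is_kernel i f) ->
  inhabited (kernel_functor a).
Proof.
move=> has_ker.
have obj_ex X : {K : D & {i : hom K (F X) | is_kernel i (a X)}}.
  by have /cid[K /cid[i ker_i]] := has_ker _ _ (a X); exists K; exists i.
pose K X := projT1 (obj_ex X).
pose i X : hom (K X) (F X) := sval (projT2 (obj_ex X)).
have ker_i X : is_kernel (i X) (a X) := svalP (projT2 (obj_ex X)).
have map_ex X Y (f : hom X Y) : {g : hom (K X) (K Y) | i Y \oc g = fmap F f \oc i X}.
  have [_ ker_iY] := ker_i Y.
  have /ker_iY /cid[g [gE _]] : a Y \oc (fmap F f \oc i X) = 0; last by exists g.
  by rewrite compA ntc_natural -compA; case: (ker_i X) => -> _; rewrite comp0r.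
pose Kmap X Y (f : hom X Y) := sval (map_ex X Y f).
have KmapE X Y (f : hom X Y) : i Y \oc Kmap X Y f = fmap F f \oc i X.
  exact: (svalP (map_ex X Y f)).
have Kmap_id X : Kmap X X (idm X) = idm (K X).
  by apply: (kernel_cancel (ker_i X)); rewrite KmapE fmap_id comp_idl comp_idr.
have Kmap_comp X Y Z (g : hom Y Z) (f : hom X Y) :
    Kmap X Z (g \oc f) = Kmap Y Z g \oc Kmap X Y f.
  apply: (kernel_cancel (ker_i Z)).
  by rewrite KmapE fmap_comp compA KmapE -!compA KmapE.
pose KF := Functor Kmap_id Kmap_comp.
exists; exists KF (@NatTrans C D KF F i KmapE); exact: ker_i.
Qed.

Section AdjunctionUniqueness.
Variables (C D : category) (L : functor C D) (R : functor D C).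

(** The automorphism of L R Y relating the counits of two adjunctions with the same functors. It
    transfers what is known of the explicit tensor-hom counit to an arbitrary one. *)
Definition counit_comparison (adj adj' : adjunction L R) (Y : D) : hom (L (R Y)) (L (R Y)) :=
  adj_counit adj (L (R Y)) \oc fmap L (adj_unit adj' (R Y)).

Lemma counit_comparisonE adj adj' Y :
  adj_counit adj' Y \oc counit_comparison adj adj' Y = adj_counit adj Y.
Proof.
rewrite /counit_comparison compA.
have := ntc_natural (adj_counit adj) (adj_counit adj' Y) => /= <-.
by rewrite -compA -fmap_comp adj_triangleR fmap_id comp_idr.
Qed.

(** Naturality moves both counits of the composite to the left and both units to the right; what
    remains is one triangle identity for [adj] followed by one for [adj']. *)
Lemma counit_comparisonK adj adj' Y :
  counit_comparison adj adj' Y \oc counit_comparison adj' adj Y = idm (L (R Y)).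
Proof.
rewrite /counit_comparison.
have e1 := ntc_natural (adj_counit adj') (fmap L (adj_unit adj' (R Y))).
have e2 := ntc_natural (adj_counit adj') (adj_counit adj (L (R Y))).
have e3 := ntc_natural (adj_unit adj) (adj_unit adj' (R Y)).
rewrite /= in e1 e2 e3.
rewrite /= -compA (compA (fmap L (adj_unit adj' _))) -e1.
rewrite -(compA (adj_counit adj' _)) (compA (adj_counit adj _)) -e2.
rewrite -compA -!fmap_comp -e3 compA adj_triangleR comp_idl.
exact: adj_triangleL.
Qed.
End AdjunctionUniqueness.

Lemma kernel_iso C (X Y Y' Z : C) (i : hom X Y) (f : hom Y Z) (f' : hom Y' Z)
    (u : hom Y Y') (v : hom Y' Y) :
  v \oc u = idm Y -> u \oc v = idm Y' -> f' \oc u = f ->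
  is_kernel i f -> is_kernel (u \oc i) f'.
Proof.
move=> vu uv f'u [fi0 ker_i]; split; first by rewrite compA f'u.
move=> W h f'h; have [|h' [h'E uniq]] := ker_i W (v \oc h).
  by rewrite -f'u -compA (compA u) uv comp_idl.
exists h'; split; first by rewrite -compA h'E compA uv comp_idl.
by move=> h'' e; apply: uniq; rewrite -e !compA vu comp_idl.
Qed.

Lemma kernel_counit_independent C D (L : functor C D) (R : functor D C)
    (adj adj' : adjunction L R) (X Y : D) (i : hom X (L (R Y))) :
  is_kernel i (adj_counit adj Y) ->
  is_kernel (counit_comparison adj adj' Y \oc i) (adj_counit adj' Y).
Proof.
apply: kernel_iso; [exact: counit_comparisonK | exact: counit_comparisonK |].
exact: counit_comparisonE.
Qed.

Definition restrict_adjunction C D (P : C -> Prop) (P' : D -> Prop) (L : functor C D)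
    (R : functor D C) (L_P : forall X, P X -> P' (L X)) (R_P : forall Y, P' Y -> P (R Y)) :
  adjunction L R -> adjunction (restrict_functor L_P) (restrict_functor R_P).
Proof.
move=> [eta eps triL triR].
pose eta' := @NatTrans (full_subcategory P) _ (id_functor _)
  (restrict_functor R_P \of restrict_functor L_P)
  (fun X => eta (sval X)) (fun X Y f => @ntc_natural _ _ _ _ eta (sval X) (sval Y) f).
pose eps' := @NatTrans (full_subcategory P') _
  (restrict_functor L_P \of restrict_functor R_P) (id_functor _)
  (fun X => eps (sval X)) (fun X Y f => @ntc_natural _ _ _ _ eps (sval X) (sval Y) f).
exists eta' eps'; [by move=> X; exact: triL | by move=> Y; exact: triR].
Defined.

End CategoryLemmas.

(** * Finitely generated modules *)

Lemma linZ (A : pzRingType) (U V : lmodType A) (f : {linear U -> V}) a x :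
  f (a *: x) = a *: f x.
Proof. exact: linearZ. Qed.

Section FinitelyGeneratedModules.
Variable R : pzRingType.
Implicit Types X Y Z : mod R.

Definition carrier X : rmodType R := sval X.
Definition lin X Y (f : hom X Y) : {linear carrier X -> carrier Y} := f.

Lemma hom_ext X Y (f g : hom X Y) : lin f =1 lin g -> f = g.
Proof. exact: linear_ext. Qed.

Lemma homE X Y (f g : hom X Y) x : f = g -> lin f x = lin g x.
Proof. by move=> ->. Qed.

Lemma fin_gen_surj (M N : rmodType R) (f : {linear M -> N}) :
  (forall y, exists x, f x = y) -> fin_gen (M : Mod R) -> fin_gen (N : Mod R).
Proof.
move=> fsurj [n [g gM]]; exists n, (fun i => f (g i)) => y.
have [x <-] := fsurj y; have [c ->] := gM x; exists c.
by rewrite linear_sum; apply: eq_bigr => i _; rewrite linZ.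
Qed.

Lemma fin_gen_free n : fin_gen ({ffun 'I_n -> R^c^o} : Mod R).
Proof.
exists n, (fun i => [ffun j => (i == j)%:R]) => x; exists x.
apply/ffunP => j; rewrite sum_ffunE (bigD1 j) //= !ffunE eqxx big1.
  by rewrite addr0; exact/esym/mulr1.
by move=> i ij; rewrite !ffunE (negbTE ij); exact: scaler0.
Qed.
Definition free_mod n : mod R := exist _ _ (fin_gen_free n).

Lemma fin_gen_regular : fin_gen (R^c^o : Mod R).
Proof.
exists 1%N, (fun=> 1) => x; exists (fun=> x).
by rewrite big_ord1; exact/esym/mulr1.
Qed.
Definition regular_mod : mod R := exist _ _ fin_gen_regular.

Lemma fin_gen_quot (M : rmodType R) (W : submodule M) :
  fin_gen (M : Mod R) -> fin_gen (quotm W : Mod R).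
Proof. by apply: (@fin_gen_surj M (quotm W) (quotm_proj W)); exact: quotm_proj_surj. Qed.
Definition quot_mod X (W : submodule (carrier X)) : mod R :=
  exist _ _ (fin_gen_quot W (svalP X)).

(** An element x is the same as a map from the regular module, which belongs to mod; two such maps,
    given by x and by 0, are compared. Dually, epimorphisms are tested on the quotient by the image,
    which is again finitely generated. *)
Lemma mono_injective X Y (f : hom X Y) : mono f -> injective (lin f).
Proof.
move=> fmono; apply: inj_kerP => x fx.
have := fmono regular_mod (orbit_map x) 0.
have -> : f \oc (orbit_map x : hom regular_mod X) = f \oc 0.
  apply: hom_ext => a; transitivity (0 : carrier Y); last exact/esym/(raddf0 (lin f)).
  by transitivity (lin f ((a : R^c) *: x)) => //; rewrite linZ fx scaler0.
move=> /(_ erefl) e; rewrite -[LHS](scale1r x).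
exact: (@homE regular_mod X (orbit_map x) 0 (1 : R^c^o) e).
Qed.

Lemma epi_surjective X Y (f : hom X Y) : epi f -> forall y, exists x, lin f x = y.
Proof.
move=> fepi y; pose q : hom Y (quot_mod (im (lin f))) := quotm_proj (im (lin f)).
have e : q = 0.
  by apply: fepi; apply: hom_ext => x; apply/quotm_proj_eq0; exists x.
apply: (proj1 (quotm_proj_eq0 (im (lin f)) y)).
by have := homE y e.
Qed.

Lemma surjective_epi X Y (f : hom X Y) :
  (forall y, exists x, lin f x = y) -> epi f.
Proof.
move=> fsurj Z g h e; apply: hom_ext => y; have [x <-] := fsurj y.
by have := homE x e.
Qed.

Lemma cokernel_epi X Y Z (p : hom Y Z) (f : hom X Y) : is_cokernel p f -> epi p.
Proof.
move=> [pf0 coker_p] W g h e; have [|h' [_ uniq]] := coker_p W (h \oc p).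
  by rewrite -compA pf0 comp0r.
by rewrite -(uniq g e) (uniq h erefl).
Qed.

Lemma kernelP X Y Z (i : hom X Y) (f : hom Y Z) :
  is_kernel i f <->
  injective (lin i) /\ forall y, lin f y = 0 <-> exists x, lin i x = y.
Proof.
split=> [ker_i|[inj_i ex]].
  split; first by apply: mono_injective => W g h; exact: (kernel_cancel ker_i).
  case: ker_i => fi0 ker_i y; split=> [fy|[x <-]].
    have [|h [hE _]] := ker_i regular_mod (orbit_map y).
      apply: hom_ext => a; transitivity (lin f ((a : R^c) *: y)) => //.
      by rewrite linZ fy scaler0.
    exists (lin h (1 : R^c^o)); have := @homE regular_mod Y _ _ (1 : R^c^o) hE.
    by move=> e; transitivity ((1 : R^c) *: y) => //; exact: scale1r.
  by have := homE x fi0.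
split; first by apply: hom_ext => x; apply/ex; exists x.
move=> W h fh; have [|h' h'E] := @factor_inj _ _ _ _ (lin i) (lin h) inj_i.
  by move=> w; apply/ex; have := homE w fh.
exists h'; split; first by apply: hom_ext.
move=> h'' e; apply: hom_ext => w; apply: inj_i; rewrite [LHS]h'E.
by have := homE w e.
Qed.

Lemma cokernelP X Y Z (p : hom Y Z) (f : hom X Y) :
  is_cokernel p f <->
  (forall z, exists y, lin p y = z) /\ forall y, lin p y = 0 <-> exists x, lin f x = y.
Proof.
split=> [coker_p|[psurj ex]].
  split; first exact/epi_surjective/(cokernel_epi coker_p).
  case: coker_p => pf0 coker_p y; split=> [py|[x <-]].
    pose q : hom Y (quot_mod (im (lin f))) := quotm_proj (im (lin f)).
    have [|h [hE _]] := coker_p _ q.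
      by apply: hom_ext => x; apply/quotm_proj_eq0; exists x.
    apply/(quotm_proj_eq0 (im (lin f))); have := homE y hE.
    by move=> <-; transitivity (lin h (lin p y)) => //; rewrite py; exact: raddf0.
  by have := homE x pf0.
split; first by apply: hom_ext => x; apply/ex; exists x.
move=> W h hf; have [|h' h'E] := @factor_surj _ _ _ _ (lin p) (lin h) psurj.
  by move=> y /ex[x <-]; have := homE x hf.
exists h'; split; first by apply: hom_ext.
move=> h'' e; apply: hom_ext => z; have [y <-] := psurj z; rewrite [LHS]h'E.
by have := homE y e.
Qed.

Lemma short_exactP X Y Z (f : hom X Y) (g : hom Y Z) :
  short_exact f g <->
  [/\ injective (lin f), forall z, exists y, lin g y = z
    & forall y, lin g y = 0 <-> exists x, lin f x = y].
Proof.
by split=> [[/kernelP[finj ex] /cokernelP[gsurj _]]|[finj gsurj ex]] //; split;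
  [apply/kernelP | apply/cokernelP].
Qed.

Definition noetherian : Prop := forall X (W : submodule (carrier X)),
  fin_gen (subm W : Mod R).

Lemma mod_biproduct X Y : exists P i1 i2 p1 p2, @is_biproduct (mod R) X Y P i1 i2 p1 p2.
Proof.
pose P := ((carrier X * carrier Y)%type : rmodType R).
have l1 : linear (fun x : carrier X => (x, 0) : P).
  by move=> a x y; congr (_, _); rewrite /= ?scaler0 ?addr0.
have l2 : linear (fun y : carrier Y => (0, y) : P).
  by move=> a x y; congr (_, _); rewrite /= ?scaler0 ?addr0.
have l3 : linear (fun p : P => p.1) by [].
have l4 : linear (fun p : P => p.2) by [].
have Pfg : fin_gen (P : Mod R).
  have [n [g gX]] := svalP X; have [m [h hY]] := svalP Y.
  exists (n + m)%N, (fun i => match split i with inl j => (g j, 0) | inr j => (0, h j) end).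
  move=> [x y]; have [c xE] := gX x; have [d yE] := hY y.
  exists (fun i => match split i with inl j => c j | inr j => d j end).
  rewrite big_split_ord /=.
  under eq_bigr => i _ do rewrite -[lshift _ _]/(unsplit (inl i)) unsplitK.
  under [X in _ + X]eq_bigr => i _ do rewrite -[rshift _ _]/(unsplit (inr i)) unsplitK.
  have -> : \sum_i c i *: ((g i, 0) : P) = (x, 0).
    rewrite xE; transitivity (\sum_i linear_map l1 (c i *: g i)); last by rewrite -linear_sum.
    by apply: eq_bigr => i _; rewrite linZ.
  have -> : \sum_i d i *: ((0, h i) : P) = (0, y).
    rewrite yE; transitivity (\sum_i linear_map l2 (d i *: h i)); last by rewrite -linear_sum.
    by apply: eq_bigr => i _; rewrite linZ.
  by congr (_, _); rewrite ?addr0 ?add0r.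
exists (exist _ _ Pfg), (linear_map l1), (linear_map l2), (linear_map l3), (linear_map l4).
split; apply: hom_ext => //.
by move=> [x y]; congr (_, _); [exact: addr0 | exact: add0r].
Qed.

(** Noetherianity supplies the kernels; cokernels are quotients of finitely generated modules.
    Monomorphisms and epimorphisms are normal because they are exactly the injective and surjective
    maps. *)
Lemma mod_abelian : noetherian -> abelian (mod R).
Proof.
move=> noeth.
have has_ker X Y (f : hom X Y) : exists K (i : hom K X), is_kernel i f.
  exists (exist _ _ (noeth _ (ker (lin f)))), (subm_incl (ker (lin f))).
  apply/kernelP; split; first exact: subm_incl_inj.
  by move=> x; split=> [/(subm_incl_onto (W := ker (lin f)))|[y <-]] //;
    exact: (subm_inclP y).
have has_coker X Y (f : hom X Y) : exists C (p : hom Y C), is_cokernel p f.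
  exists (quot_mod (im (lin f))), (quotm_proj (im (lin f))).
  apply/cokernelP; split; first exact: quotm_proj_surj.
  exact: quotm_proj_eq0.
split=> //.
- exists (free_mod 0) => X; split=> f.
    by apply: hom_ext => x; apply/ffunP => -[].
  apply: hom_ext => x; have -> : x = 0 by apply/ffunP => -[].
  exact: raddf0.
- exact: mod_biproduct.
- move=> X Y f /mono_injective finj; have [C [p coker_p]] := has_coker _ _ f.
  by exists C, p; apply/kernelP; split=> //; case/cokernelP: coker_p.
- move=> X Y f /epi_surjective fsurj; have [K [i ker_i]] := has_ker _ _ f.
  by exists K, i; apply/cokernelP; split=> //; case/kernelP: ker_i.
Qed.

(** The cover of P by a free module of finite rank is an epimorphism inside mod, so it splits and P
    inherits the coordinate dual basis as a retract. *)
Lemma mod_projective_dual_basis (P : mod R) : projective P -> has_dual_basis (carrier P).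
Proof.
move=> projP; have [n [g gP]] := svalP P.
have comb_epi : epi (combination g : hom (free_mod n) P).
  apply: surjective_epi => x; have [c ->] := gP x; exists (finfun c).
  by apply: eq_bigr => i _; rewrite ffunE.
have [h hE] := projP _ _ _ (idm P) comb_epi.
apply: (@dual_basis_retract _ _ _ (combination g) (lin h)).
  by move=> x; have := homE x hE.
exists 'I_n, (fun i => [ffun j => (i == j)%:R]), (@coordinate R^c n) => x.
apply/ffunP => j; rewrite sum_ffunE (bigD1 j) //= !ffunE eqxx big1.
  by rewrite addr0; exact/esym/mulr1.
by move=> i ij; rewrite !ffunE (negbTE ij); exact: scaler0.
Qed.

Lemma dual_basis_mod_projective (P : mod R) : has_dual_basis (carrier P) -> projective P.
Proof.
move=> dbP X Y g f /epi_surjective gsurj.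
have [h hE] := dual_basis_lift (lin f) dbP gsurj.
by exists h; apply: hom_ext.
Qed.

Lemma dual_basis_projective_module (P : rmodType R) :
  has_dual_basis P -> projective_module P.
Proof. by move=> dbP M N g f; exact: dual_basis_lift. Qed.

Lemma dual_basis_isomorphic X Y :
  isomorphic X Y -> has_dual_basis (carrier X) -> has_dual_basis (carrier Y).
Proof.
move=> [f [g [_ fg]]]; apply: (@dual_basis_retract _ _ _ (lin f) (lin g)) => y.
by have := homE y fg.
Qed.
End FinitelyGeneratedModules.

(** * Hom and tensor functors *)

Section TensorUniversalProperty.
Variables (S R : pzRingType) (N : rmodType S) (B : bimodule S R).

Definition balanced_map (V : zmodType) (b : N -> B -> V) : Prop :=
  [/\ forall n n' x, b (n + n') x = b n x + b n' x,
      forall n x x', b n (x + x') = b n x + b n x'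
    & forall n (s : S) x, b ((s : S^c) *: n) x = b n (lact B s x)].

(** Evaluated on a chosen representative, so it is meaningful only for balanced [b]. The copy
    [zmodule V] is V as a module over the integers, as required by [lin_ext]. *)
Definition tensor_lift (V : zmodType) (b : N -> B -> V) (t : tensor N B) : V :=
  lin_ext (fun p : N * B => b p.1 p.2 : zmodule V) (zrepr t).

Lemma tensor_lift_pi (V : zmodType) (b : N -> B -> V) z : balanced_map b ->
  tensor_lift b (tensor_pi z) = lin_ext (fun p : N * B => b p.1 p.2 : zmodule V) z.
Proof.
move=> [bDl bDr bal]; rewrite /tensor_lift; set h := lin_ext _.
have hB x y : h (x - y) = h x - h y by exact: (linearB h).
have hU p : h << p >> = b p.1 p.2 by exact: lin_extU.
have hK w : subgrp_set (subgrp_gen (@tensor_rel S R N B)) w -> h w = 0.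
  (* The relation subgroup is the smallest one containing the relations, so it suffices that the
     zero set of [h] is a subgroup containing them. *)
  move=> /(_ [set v | h v = 0]%classic); apply; split; first split.
  - by rewrite /= -(subrr 0) hB subrr.
  - by move=> x y /= hx hy; rewrite hB hx hy subr0.
  - move=> _ [n n' x|n x x'|n s x]; rewrite /= !(hB, hU) /=.
    + by rewrite bDl; apply/eqP; rewrite -addrA -opprD subr_eq0.
    + by rewrite bDr; apply/eqP; rewrite -addrA -opprD subr_eq0.
    + by rewrite bal subrr.
apply/eqP; rewrite -subr_eq0 -hB; apply/eqP/hK.
by apply/zpi_eq; rewrite zreprK.
Qed.

Lemma tensor_lift_tens (V : zmodType) (b : N -> B -> V) n x : balanced_map b ->
  tensor_lift b (tens n x) = b n x.
Proof. by move=> bal; rewrite tensor_lift_pi // lin_extU. Qed.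

Lemma tensor_liftB (V : zmodType) (b : N -> B -> V) t u : balanced_map b ->
  tensor_lift b (t - u) = tensor_lift b t - tensor_lift b u.
Proof.
move=> bal; rewrite -[t]zreprK -[u]zreprK.
rewrite -(raddfB (@tensor_pi _ _ N B)) !tensor_lift_pi //.
set h := lin_ext _; have hB x y : h (x - y) = h x - h y by exact: (linearB h).
exact: hB.
Qed.

Lemma tensor_lift0 (V : zmodType) (b : N -> B -> V) : balanced_map b ->
  tensor_lift b 0 = 0.
Proof. by move=> bal; rewrite -(subrr (0 : tensor N B)) tensor_liftB // subrr. Qed.

Lemma tensor_liftD (V : zmodType) (b : N -> B -> V) t u : balanced_map b ->
  tensor_lift b (t + u) = tensor_lift b t + tensor_lift b u.
Proof.
move=> bal; have liftN v : tensor_lift b (- v) = - tensor_lift b v.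
  by rewrite -(sub0r v) tensor_liftB // tensor_lift0 // sub0r.
by rewrite -[in LHS](opprK u) tensor_liftB // liftN opprK.
Qed.

Lemma tensor_scaleE (r : R^c) n x : r *: (tens n x : tensor N B) = tens n (r *: x).
Proof. exact: tensor_scale_tens. Qed.

Lemma tens0l x : tens 0 x = 0 :> tensor N B.
Proof. by apply: (addrI (tens 0 x)); rewrite -tensDl !addr0. Qed.
Lemma tens0r n : tens n 0 = 0 :> tensor N B.
Proof. by apply: (addrI (tens n 0)); rewrite -tensDr !addr0. Qed.
Lemma tensBl n n' b : tens (n - n') b = tens n b - tens n' b :> tensor N B.
Proof. by apply: (addIr (tens n' b)); rewrite -tensDl !subrK. Qed.
Lemma tens_suml I (r : seq I) (x : I -> N) b :
  tens (\sum_(i <- r) x i) b = \sum_(i <- r) tens (x i) b :> tensor N B.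
Proof.
by apply: (big_morph (fun n => tens n b)) => [u v|]; [exact: tensDl | exact: tens0l].
Qed.
Lemma tens_sumr n I (r : seq I) (x : I -> B) :
  tens n (\sum_(i <- r) x i) = \sum_(i <- r) tens n (x i) :> tensor N B.
Proof.
by apply: (big_morph (tens n)) => [u v|]; [exact: tensDr | exact: tens0r].
Qed.

Lemma tensor_lift_linear (M : rmodType R) (b : N -> B -> M) :
  balanced_map b -> (forall n x (r : R), b n ((r : R^c) *: x) = (r : R^c) *: b n x) ->
  linear (tensor_lift b).
Proof.
move=> bal blin r t u; rewrite tensor_liftD //; congr (_ + _).
elim/tensor_ind: t => [|x y hx hy|n x].
- by rewrite !(scaler0, tensor_lift0).
- by rewrite scalerBr !tensor_liftB // hx hy scalerBr.
- by rewrite tensor_scaleE !tensor_lift_tens // blin.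
Qed.
End TensorUniversalProperty.

Section TensorHomAdjunction.
Variables (S R : pzRingType) (B : bimodule S R).

Definition bihom_lin (M : rmodType R) (f : bihom B M) : {linear B -> M} := f.

Section Unit.
Variable N : rmodType S.
Lemma tens_linear (n : N) : linear (fun x : B => tens n x : tensor N B).
Proof. by move=> a x y; rewrite tensDr tensor_scaleE. Qed.
Definition tens_map (n : N) : bihom B (tensor N B) := linear_map (tens_linear n).
Lemma tens_map_linear : linear tens_map.
Proof.
move=> s n n'; apply: linear_ext => x.
by transitivity (tens ((s : S^c) *: n + n') x : tensor N B) => //; rewrite tensDl tens_bal.
Qed.
Definition hom_unit : {linear N -> bihom B (tensor N B)} := linear_map tens_map_linear.
End Unit.

Section Counit.
Variable M : rmodType R.
Definition eval (f : bihom B M) (x : B) : M := bihom_lin f x.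
Lemma eval_balanced : balanced_map eval.
Proof. by split=> // f x x'; exact: (linearD (bihom_lin f)). Qed.
Lemma eval_linear f x (r : R) : eval f ((r : R^c) *: x) = (r : R^c) *: eval f x.
Proof. exact: linZ. Qed.
Definition hom_counit : {linear tensor (bihom B M) B -> M} :=
  linear_map (tensor_lift_linear eval_balanced eval_linear).
Lemma hom_counit_tens f x : hom_counit (tens f x) = bihom_lin f x.
Proof. exact: (tensor_lift_tens _ _ eval_balanced). Qed.
End Counit.

Definition tensor_hom_unit :
  nat_trans (id_functor (Mod S)) (Hom_functor B \of Tensor_functor B).
Proof.
exists (fun N => hom_unit N) => X Y f.
apply: linear_ext => n; apply: linear_ext => x.
transitivity (tens ((f : {linear _ -> _}) n) x : tensor Y B) => //.
exact/esym/tensor_map_tens.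
Defined.

Definition tensor_hom_counit :
  nat_trans (Tensor_functor B \of Hom_functor B) (id_functor (Mod R)).
Proof.
exists (fun M => hom_counit M) => X Y f.
apply: (tensor_linear_ext (B := B)) => g x.
transitivity (hom_counit Y (tens (bihom_post B f g) x)).
  by congr (hom_counit Y _); exact: tensor_map_tens.
rewrite hom_counit_tens.
transitivity ((f : {linear _ -> _}) (hom_counit X (tens g x))) => //.
by rewrite hom_counit_tens.
Defined.

Definition tensor_hom_adjunction : adjunction (Tensor_functor B) (Hom_functor B).
Proof.
exists tensor_hom_unit tensor_hom_counit.
- move=> N; apply: (tensor_linear_ext (B := B)) => n x.
  transitivity (hom_counit (tensor N B) (tens (hom_unit N n) x)).
    by congr (hom_counit _ _); exact: tensor_map_tens.
  exact: hom_counit_tens.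
- move=> M; apply: linear_ext => f; apply: linear_ext => x.
  by transitivity (hom_counit M (tens f x)) => //; exact: hom_counit_tens.
Defined.
End TensorHomAdjunction.

(** * Finite dimension over the field and noetherianity *)

Section FiniteOverField.
Variables (k : fieldType) (R : pzRingType) (h : {rmorphism k -> R}).

(** Unlike finite generation over a general ring, this condition is inherited by submodules. Over a
    ring that satisfies it, the two conditions agree, whence noetherianity. *)
Definition finite_over (M : rmodType R) : Prop :=
  exists n (g : 'I_n -> scalars h M), spanned_by g [set: _]%classic.

Lemma finite_over_fin_gen (M : rmodType R) : finite_over M -> fin_gen (M : Mod R).
Proof.
move=> [n [g gM]]; exists n, g => x; have [c ->] := gM x I.
by exists (fun i => h (c i)).
Qed.

Lemma finite_over_subm (M : rmodType R) (W : submodule M) :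
  finite_over M -> finite_over (subm W).
Proof.
move=> [n [g gM]]; have [W0 Wlin] := submoduleP W.
have Wk (c : k) (x y : scalars h M) : submodule_set W x -> submodule_set W y ->
  submodule_set W (c *: x + y) by exact: Wlin.
have gW : spanned_by g (submodule_set W : set (scalars h M)) by move=> x _; exact: gM.
have [m [w [Ww wspan]]] := spanned_subspace Wk W0 gW.
have /choice[v vE] : forall i, exists y : subm W, subm_incl W y = w i.
  by move=> i; exact: subm_incl_onto.
exists m, v => x _; have [c cE] := wspan _ (subm_inclP x); exists c.
apply: (@subm_incl_inj _ _ W); rewrite cE.
transitivity (\sum_i subm_incl W ((h (c i) : R^c) *: v i)); last by rewrite -linear_sum.
by apply: eq_bigr => i _; rewrite linZ vE.
Qed.

Hypothesis h_finite : finite_over R^c^o.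

Lemma fin_gen_finite_over (M : rmodType R) : fin_gen (M : Mod R) -> finite_over M.
Proof.
move=> [m [x xM]]; have [n [g gR]] := h_finite.
pose y (p : 'I_m * 'I_n) : M := (g p.2 : R^c) *: x p.1.
exists #|{: 'I_m * 'I_n}|, (fun i => y (enum_val i)) => v _.
have [a ->] := xM v.
have /choice[c cE] : forall i, exists c : 'I_n -> k, a i = \sum_j (h (c j) : R^c) * g j.
  by move=> i; exact: (gR (a i) I).
exists (fun i => c (enum_val i).1 (enum_val i).2).
transitivity (\sum_(p : 'I_m * 'I_n) (h (c p.1 p.2) : R^c) *: y p).
  rewrite -(pair_bigA _ (fun i j => (h (c i j) : R^c) *: y (i, j))) /=.
  apply: eq_bigr => i _; rewrite cE scaler_suml; apply: eq_bigr => j _.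
  by rewrite /y scalerA.
exact: (big_enum_val (fun p => (h (c p.1 p.2) : R^c) *: y p)).
Qed.

Lemma finite_over_noetherian : noetherian R.
Proof.
by move=> X W; apply/finite_over_fin_gen/finite_over_subm/fin_gen_finite_over/svalP.
Qed.

Lemma fin_gen_scalar_dual_basis (M : rmodType R) : fin_gen (M : Mod R) ->
  exists m (x : 'I_m -> M) (phi : 'I_m -> M -> k),
    [/\ forall i u v, phi i (u + v) = phi i u + phi i v,
        forall i c u, phi i ((h c : R^c) *: u) = c * phi i u
      & forall v, v = \sum_i (h (phi i v) : R^c) *: x i].
Proof.
move=> /fin_gen_finite_over[n [g gM]].
have [m [x [phi phiE]]] := finite_dual_basis gM.
exists m, x, (fun i => phi i); split=> //.
- by move=> i; exact: (linearD (phi i)).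
- by move=> i c u; exact: (linZ (phi i) c (u : scalars h M)).
Qed.
End FiniteOverField.

(** * Restriction of scalars as a Hom functor *)

Section RestrictionOfScalars.
Variables (S R : pzRingType) (f : {rmorphism S -> R}).
Let B : bimodule S R := ring_bimodule f idfun.

(** Evaluation at 1 is the bijection from Hom_R(R, M) to M, with inverse [of1]. Through it the Hom
    functor becomes restriction along [f], and equalities of homomorphisms reduce to equalities in
    M. *)
Definition at1 (M : rmodType R) (phi : bihom B M) : M := bihom_lin phi (1 : R).

Lemma at1D M (phi psi : bihom B M) : at1 (phi + psi) = at1 phi + at1 psi.
Proof. by []. Qed.

Lemma at1_scale M (s : S) (phi : bihom B M) :
  at1 ((s : S^c) *: phi) = (f s : R^c) *: at1 phi.
Proof.
rewrite /at1 -linZ; transitivity (bihom_lin phi (lact B s (1 : R))) => //.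
by congr (bihom_lin phi _); exact: etrans (mulr1 (f s)) (esym (mul1r (f s))).
Qed.

Lemma at1E M (phi : bihom B M) (x : R) : bihom_lin phi x = (x : R^c) *: at1 phi.
Proof. by rewrite /at1 -linZ; congr (bihom_lin phi _); exact/esym/mul1r. Qed.

Lemma at1_inj M : injective (@at1 M).
Proof. by move=> phi psi e; apply: linear_ext => x; rewrite [LHS]at1E [RHS]at1E e. Qed.

Lemma of1_linear (M : rmodType R) (m : M) :
  linear (fun x : restr (idfun : {rmorphism R -> R}) => (x : R^c) *: m).
Proof.
move=> a x y; rewrite [LHS]scalerDl; congr (_ + _).
by rewrite scalerA.
Qed.
Definition of1 (M : rmodType R) (m : M) : bihom B M := linear_map (of1_linear m).

Lemma of1K M : cancel (@of1 M) (@at1 M).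
Proof. by move=> m; exact: scale1r. Qed.
Lemma at1K M : cancel (@at1 M) (@of1 M).
Proof. by move=> phi; apply: at1_inj; rewrite of1K. Qed.

Lemma of1D (M : rmodType R) (m m' : M) : of1 (m + m') = of1 m + of1 m'.
Proof. by apply: at1_inj; rewrite at1D !of1K. Qed.

Lemma of1_scale (M : rmodType R) (s : S) (m : M) : of1 ((f s : R^c) *: m) = (s : S^c) *: of1 m.
Proof. by apply: at1_inj; rewrite at1_scale !of1K. Qed.

Lemma at1_post (M N : rmodType R) (g : {linear M -> N}) (phi : bihom B M) :
  at1 (bihom_post B g phi) = g (at1 phi).
Proof. by []. Qed.

Lemma finite_over_restriction (k : fieldType) (hS : {rmorphism k -> S})
    (hR : {rmorphism k -> R}) (M : rmodType R) :
  (forall c, f (hS c) = hR c) -> finite_over hR M -> finite_over hS (bihom B M).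
Proof.
move=> fh [n [g gM]]; exists n, (fun i => of1 (g i : M)) => phi _.
have [c cE] := gM (at1 phi) I; exists c; apply: at1_inj; rewrite [LHS]cE.
have at1_sum I (r : seq I) (F : I -> bihom B M) :
    at1 (\sum_(i <- r) F i) = \sum_(i <- r) at1 (F i).
  exact: (big_morph (@at1 M) (@at1D M) (erefl _)).
rewrite at1_sum; apply: eq_bigr => i _.
by rewrite [RHS]at1_scale fh of1K.
Qed.

Section FinitelyGenerated.
Hypothesis fg : forall M : Mod R, fin_gen M -> fin_gen (Hom_functor B M).
Let e : functor (mod R) (mod S) := restrict_functor fg.

Lemma restriction_faithful : faithful e.
Proof.
move=> X Y g g' eg; apply: hom_ext => x.
have := congr1
  (fun u : {linear bihom B (carrier X) -> bihom B (carrier Y)} => at1 (u (of1 x))) eg.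
by rewrite !at1_post of1K.
Qed.

Lemma restriction_exact : exact_functor e.
Proof.
split=> [X Y g g'|X Y Z g g' /short_exactP[ginj g'surj ex]].
  by apply: hom_ext => phi; apply: at1_inj; rewrite at1_post.
apply/short_exactP; split.
- move=> phi psi /(congr1 (@at1 _)); rewrite !at1_post => /ginj; exact: at1_inj.
- move=> psi; have [y yE] := g'surj (at1 psi); exists (of1 y : bihom B (carrier Y)).
  by apply: at1_inj; rewrite at1_post of1K yE.
- move=> phi; split=> [/(congr1 (@at1 _))|[psi <-]].
    rewrite at1_post => /ex[x xE]; exists (of1 x : bihom B (carrier X)).
    by apply: at1_inj; rewrite at1_post of1K xE.
  by apply: at1_inj; rewrite at1_post at1_post; apply/ex; exists (at1 psi).
Qed.

(** Dual bases compose: expand an element of P over R, then expand each coefficient, viewed in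
    Hom(B, R), over S. The products of the two families of generators form the new basis. *)
Lemma restriction_projective : has_dual_basis ((bihom B R^c^o) : rmodType S) ->
  preserves_projectives e.
Proof.
move=> [J [b [d db]]] P /mod_projective_dual_basis[K [p [psi dp]]].
apply: dual_basis_mod_projective.
pose g (q : K * J) : bihom B (carrier P) := of1 ((at1 (b q.2) : R^c) *: p q.1).
exists (K * J)%type, g, (fun q => d q.2 \o bihom_post B (psi q.1) : {linear _ -> _}) => phi.
apply: at1_inj.
have at1_sum I (r : seq I) (F : I -> bihom B (carrier P)) :
    at1 (\sum_(i <- r) F i) = \sum_(i <- r) at1 (F i).
  exact: (big_morph (@at1 _) (@at1D _) (erefl _)).
have at1_sum' I (r : seq I) (F : I -> bihom B R^c^o) :
    at1 (\sum_(i <- r) F i) = \sum_(i <- r) at1 (F i).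
  exact: (big_morph (@at1 _) (@at1D _) (erefl _)).
rewrite at1_sum [LHS](dp (at1 phi)).
rewrite -(pair_bigA _
  (fun i j => at1 ((d j (bihom_post B (psi i) phi) : S^c) *: g (i, j)))) /=.
apply: eq_bigr => i _.
rewrite -(at1_post (psi i)) {1}(db (bihom_post B (psi i) phi)) at1_sum' scaler_suml.
apply: eq_bigr => j _.
by rewrite !at1_scale of1K scalerA.
Qed.
End FinitelyGenerated.
End RestrictionOfScalars.

(** * Exactness and finiteness for projective bimodules *)

Section BimoduleFunctors.
Variables (S R : pzRingType) (B : bimodule S R).

(** The dual basis notion for the left action, spelled out separately because only the right action
    of a bimodule is carried by its module structure. *)
Definition left_dual_basis (J : finType) (g : J -> B) (d : J -> B -> S) : Prop :=
  [/\ forall j x y, d j (x + y) = d j x + d j y,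
      forall j s x, d j (lact B s x) = s * d j x
    & forall x, x = \sum_j lact B (d j x) (g j)].

Section LeftProjective.
Variables (J : finType) (g : J -> B) (d : J -> B -> S).
Hypothesis dg : left_dual_basis g d.

Lemma contract_balanced (N : rmodType S) j :
  balanced_map (fun (n : N) (b : B) => (d j b : S^c) *: n).
Proof.
have [dD dS _] := dg; split=> [n n' x|n x x'|n s x].
- by rewrite scalerDr.
- by rewrite dD scalerDl.
- by rewrite dS scalerA.
Qed.

(** The coordinates of N (x) B in the power of N indexed by J, of which it is a direct summand when
    B has a left dual basis. *)
Definition contract (N : rmodType S) j : tensor N B -> N :=
  tensor_lift (fun (n : N) (b : B) => (d j b : S^c) *: n).

Lemma contract_tens (N : rmodType S) j n b :
  contract j (tens n b : tensor N B) = (d j b : S^c) *: n.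
Proof. exact: (tensor_lift_tens _ _ (contract_balanced N j)). Qed.

Lemma contractK (N : rmodType S) (t : tensor N B) :
  t = \sum_j tens (contract j t) (g j).
Proof.
have [_ _ dE] := dg; elim/tensor_ind: t => [|x y hx hy|n b].
- rewrite big1 // => j _; rewrite /contract tensor_lift0 ?tens0l //.
  exact: contract_balanced.
- rewrite {1}hx {1}hy -sumrB; apply: eq_bigr => j _.
  rewrite /contract tensor_liftB; last exact: contract_balanced.
  by rewrite tensBl.
- rewrite {1}(dE b) tens_sumr; apply: eq_bigr => j _.
  by rewrite contract_tens tens_bal.
Qed.

Lemma contract_map (N N' : rmodType S) (f : {linear N -> N'}) j t :
  contract j (tensor_map B f t) = f (contract j t).
Proof.
elim/tensor_ind: t => [|x y hx hy|n b].
- rewrite (raddf0 (tensor_map B f)) /contract !tensor_lift0 ?(raddf0 f) //;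
    exact: contract_balanced.
- rewrite (raddfB (tensor_map B f)) /contract !tensor_liftB; try exact: contract_balanced.
  by rewrite -!/(contract _ _) hx hy linearB.
- rewrite contract_tens linZ.
  by transitivity (contract j (tens (f n) b : tensor N' B));
    [congr contract; exact: tensor_map_tens | exact: contract_tens].
Qed.

Lemma contract0 (N : rmodType S) (t : tensor N B) :
  (forall j, contract j t = 0) -> t = 0.
Proof. by move=> t0; rewrite (contractK t) big1 // => j _; rewrite t0 tens0l. Qed.

(** The coordinates [contract j] are natural in the module and separate tensors, so injectivity and
    exactness in the middle are checked coordinatewise. Surjectivity lifts pure tensors. *)
Lemma left_projective_tensor_exact
    (fg : forall M : Mod S, fin_gen M -> fin_gen (Tensor_functor B M)) :
  exact_functor (restrict_functor fg : functor (mod S) (mod R)).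
Proof.
split=> [X Y f f'|X Y Z f f' /short_exactP[finj f'surj ex]].
  apply: (tensor_linear_ext (B := B)) => n b.
  rewrite [LHS]tensor_map_tens [LHS]tensDl.
  by congr (_ + _); exact/esym/tensor_map_tens.
apply/short_exactP; split.
- apply: inj_kerP => t ft; apply: contract0 => j; apply: finj.
  by rewrite -contract_map (raddf0 (lin f)) [tensor_map _ _ _]ft /contract tensor_lift0 //;
    exact: contract_balanced.
- elim/tensor_ind=> [|x y [x' <-] [y' <-]|z b].
  + by exists 0; exact: raddf0.
  + by exists (x' - y'); exact: raddfB.
  + have [y <-] := f'surj z; exists (tens y b : tensor (carrier Y) B).
    exact: tensor_map_tens.
- move=> t; split=> [f't|[u <-]].
    have /choice[x xE] : forall j, exists x, lin f x = contract j t.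
      move=> j; apply/ex; rewrite -contract_map [tensor_map _ _ _]f't.
      by rewrite /contract tensor_lift0 //; exact: contract_balanced.
    exists (\sum_j tens (x j) (g j) : tensor (carrier X) B).
    rewrite [RHS]contractK linear_sum; apply: eq_bigr => j _.
    by rewrite -xE; exact: tensor_map_tens.
  apply: contract0 => j.
  transitivity (contract j (tensor_map B (lin f') (tensor_map B (lin f) u))) => //.
  by rewrite !contract_map; apply/ex; exists (contract j u).
Qed.
End LeftProjective.

Lemma projective_hom_exact
    (fg : forall M : Mod R, fin_gen M -> fin_gen (Hom_functor B M)) :
  has_dual_basis (bimod_rmod B) ->
  exact_functor (restrict_functor fg : functor (mod R) (mod S)).
Proof.
move=> dbB; split=> [X Y f f'|X Y Z f f' /short_exactP[finj f'surj ex]].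
  by apply: hom_ext => phi; apply: linear_ext.
apply/short_exactP; split.
- move=> phi psi e; apply: linear_ext => b; apply: finj.
  exact: (congr1 (fun u : bihom B (carrier Y) => bihom_lin u b) e).
- move=> psi; have [h hE] := dual_basis_lift (bihom_lin psi) dbB f'surj.
  by exists (h : bihom B (carrier Y)); apply: linear_ext.
- move=> phi; split=> [f'phi|[psi <-]].
    have [|h hE] := @factor_inj _ _ _ _ (lin f) (bihom_lin phi) finj.
      move=> b; apply/ex.
      exact: (congr1 (fun u : bihom B (carrier Z) => bihom_lin u b) f'phi).
    by exists (h : bihom B (carrier X)); apply: linear_ext.
  apply: linear_ext => b; transitivity (lin f' (lin f (bihom_lin psi b))) => //.
  by apply/ex; exists (bihom_lin psi b).
Qed.

(** A map out of B is determined by its values on the dual basis, so Hom(B, M) is spanned by the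
    maps b to m_i d_j(b). The first two hypotheses let k-scalars pass from the left action through
    to M. *)
Lemma finite_over_hom (k : fieldType) (hS : {rmorphism k -> S}) (hR : {rmorphism k -> R})
    (M : rmodType R) :
  (forall c (b : B), lact B (hS c) b = (hR c : R^c) *: b) ->
  (forall c x, hR c * x = x * hR c) ->
  has_dual_basis (bimod_rmod B) -> finite_over hR M -> finite_over hS (bihom B M).
Proof.
move=> hSR hRC [J [g [d dg]]] [n [m mM]].
pose u (p : J * 'I_n) : bihom B M := orbit_map (m p.2 : M) \o d p.1 : {linear B -> M}.
exists #|{: J * 'I_n}|, (fun i => u (enum_val i)) => phi _.
have /choice[c cE] : forall j, exists c : 'I_n -> k,
    bihom_lin phi (g j) = \sum_i (hR (c i) : R^c) *: (m i : M).
  by move=> j; exact: (mM (bihom_lin phi (g j)) I).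
exists (fun i => c (enum_val i).1 (enum_val i).2).
transitivity (\sum_(p : J * 'I_n) (hS (c p.1 p.2) : S^c) *: u p); last first.
  exact: (big_enum_val (fun p => (hS (c p.1 p.2) : S^c) *: u p)).
have sum_at b I (r : seq I) (F : I -> bihom B M) :
    bihom_lin (\sum_(i <- r) F i) b = \sum_(i <- r) bihom_lin (F i) b.
  exact: (big_morph (fun v : bihom B M => bihom_lin v b) (fun _ _ => erefl _) (erefl _)).
apply: linear_ext => b; rewrite [RHS](sum_at b).
rewrite -(pair_bigA _ (fun j i => bihom_lin ((hS (c j i) : S^c) *: u (j, i)) b)) /=.
transitivity (bihom_lin phi (\sum_j (d j b : R^c) *: g j)).
  by rewrite -dg.
rewrite linear_sum; apply: eq_bigr => j _; rewrite linZ cE scaler_sumr.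
apply: eq_bigr => i _.
transitivity (bihom_lin (u (j, i)) (lact B (hS (c j i)) b)) => //.
rewrite hSR linZ /= !scalerA; congr (_ *: _); exact: (hRC (c j i) (d j b)).
Qed.
End BimoduleFunctors.

(** Every n (x) r equals (n (x) 1) r, so generators of N, tensored with 1, generate over R. *)
Lemma ring_tensor_fin_gen (S R : pzRingType) (f : {rmorphism S -> R}) (N : Mod S) :
  fin_gen N -> fin_gen (Tensor_functor (ring_bimodule f idfun) N).
Proof.
pose B := ring_bimodule f idfun.
move=> [n [x xN]]; pose one : B := (1 : R).
exists n, (fun i => tens (x i) one : tensor N B) => t.
have scale1 m (r : B) : tens m r = ((r : R) : R^c) *: (tens m one : tensor N B).
  by rewrite tensor_scaleE; congr tens; exact/esym/mul1r.
elim/tensor_ind: t => [|t u [c ->] [d ->]|m r].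
- by exists (fun=> 0); rewrite big1 // => i _; rewrite scale0r.
- by exists (fun i => c i - d i); rewrite -sumrB; apply: eq_bigr => i _; rewrite scalerBl.
- have [c ->] := xN m; exists (fun i => f (c i) * (r : R)); rewrite tens_suml.
  by apply: eq_bigr => i _; rewrite tens_bal; exact: scale1.
Qed.

Section Retraction.
Variables (S R : pzRingType) (f : {rmorphism S -> R}) (g : {rmorphism R -> S}).
Hypothesis fK : cancel f g.
Let BS : bimodule R S := ring_bimodule g idfun.
Let BR : bimodule S R := ring_bimodule f idfun.

Section Object.
Variable N : rmodType S.
Definition at11 (phi : bihom BR (bihom BS N)) : N := at1 (at1 phi).
Definition of11 (n : N) : bihom BR (bihom BS N) := of1 f (of1 g n).

Lemma at11_linear : linear at11.
Proof.
move=> s phi psi; rewrite /at11; apply: etrans (at1D (at1 (s *: phi)) (at1 psi)) _.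
congr (_ + _); rewrite at1_scale; apply: etrans (at1_scale _ (at1 phi)) _.
by rewrite fK.
Qed.
Lemma of11_linear : linear of11.
Proof.
move=> s m n; rewrite /of11 (of1D g); apply: etrans (of1D f (of1 g (s *: m)) (of1 g n)) _.
congr (_ + _); rewrite -{1}(fK s) (of1_scale g).
exact: (of1_scale f s (of1 g m)).
Qed.
Lemma at11K : cancel at11 of11.
Proof. by move=> phi; rewrite /of11 /at11 !at1K. Qed.
Lemma of11K : cancel of11 at11.
Proof. by move=> n; rewrite /of11 /at11 !of1K. Qed.
End Object.

(** Restriction along [g] and then along [f] is restriction along [g \o f], the identity. The two
    evaluations at 1 make up the natural isomorphism. *)
Lemma restriction_section
    (fgS : forall M : Mod S, fin_gen M -> fin_gen (Hom_functor BS M))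
    (fgR : forall M : Mod R, fin_gen M -> fin_gen (Hom_functor BR M)) :
  naturally_isomorphic (restrict_functor fgR \of restrict_functor fgS) (id_functor (mod S)).
Proof.
pose a X : hom ((restrict_functor fgR \of restrict_functor fgS) X) (id_functor (mod S) X) :=
  linear_map (@at11_linear (carrier X)).
pose b X : hom (id_functor (mod S) X) ((restrict_functor fgR \of restrict_functor fgS) X) :=
  linear_map (@of11_linear (carrier X)).
have a_nat X Y (u : hom X Y) : a Y \oc fmap (restrict_functor fgR \of restrict_functor fgS) u =
    fmap (id_functor (mod S)) u \oc a X by exact: linear_ext.
have b_nat X Y (u : hom X Y) : b Y \oc fmap (id_functor (mod S)) u =
    fmap (restrict_functor fgR \of restrict_functor fgS) u \oc b X.
  apply: linear_ext => x; apply: (can_inj (@at11K (carrier Y))).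
  rewrite [LHS]of11K.
  by transitivity (lin u (at11 (of11 (x : carrier X)))) => //; rewrite of11K.
exists (NatTrans a_nat), (NatTrans b_nat) => X; split; apply: linear_ext => x.
  exact: at11K.
exact: of11K.
Qed.
End Retraction.

(* Tn is the module M (x)_Gam Lam, described by its universal property. *)
Record induced_module (Lam Gam : pzRingType) (nu : {rmorphism Gam -> Lam})
    (M Tn : rmodType Lam) (tns : M -> Lam -> Tn) : Prop := InducedModule {
  tnsDl : forall m m' x, tns (m + m') x = tns m x + tns m' x;
  tnsDr : forall m x x', tns m (x + x') = tns m x + tns m x';
  tns_bal : forall c m x, tns ((nu c : Lam^c) *: m) x = tns m (nu c * x);
  tns_scale : forall (r : Lam) m x, (r : Lam^c) *: tns m x = tns m (x * r);
  tns_ind : forall P : Tn -> Prop, P 0 -> (forall x y, P x -> P y -> P (x - y)) ->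
    (forall m x, P (tns m x)) -> forall x, P x;
  tns_lift : forall (V : zmodType) (b : M -> Lam -> V),
    (forall m m' x, b (m + m') x = b m x + b m' x) ->
    (forall m x x', b m (x + x') = b m x + b m x') ->
    (forall c m x, b ((nu c : Lam^c) *: m) x = b m (nu c * x)) ->
    exists F : Tn -> V, (forall t u, F (t - u) = F t - F u) /\
      forall m x, F (tns m x) = b m x }.

Section TensorInduced.
Variables (Lam Gam : pzRingType) (nu : {rmorphism Gam -> Lam}) (M : rmodType Lam).
Let B : bimodule Gam Lam := ring_bimodule nu idfun.

Definition tensor_tns (m : M) (x : Lam) : tensor (bihom B M) B := tens (of1 nu m) (x : B).

(** Removes the detour through Hom(B, M): from here on, tensors are written with elements of M
    itself. *)
Lemma tensor_induced : induced_module nu tensor_tns.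
Proof.
split.
- by move=> m m' x; rewrite /tensor_tns of1D tensDl.
- by move=> m x x'; exact: tensDr.
- by move=> c m x; rewrite /tensor_tns of1_scale tens_bal.
- by move=> r m x; exact: tensor_scaleE.
- move=> P P0 PB Pt; apply: tensor_ind => // f x.
  by have := Pt (at1 f) x; rewrite /tensor_tns at1K.
- move=> V b bDl bDr bal.
  have b'bal : balanced_map (fun (f : bihom B M) (x : B) => b (at1 f) (x : Lam)).
    split=> [f f' x|f x x'|f c x]; first by rewrite at1D bDl.
      exact: bDr.
    by rewrite at1_scale bal.
  exists (tensor_lift (fun (f : bihom B M) (x : B) => b (at1 f) (x : Lam))).
  split=> [t u|m x]; first exact: tensor_liftB.
  by rewrite /tensor_tns tensor_lift_tens // of1K.
Qed.

Lemma counit_tns m x : hom_counit B M (tensor_tns m x) = (x : Lam^c) *: m.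
Proof. exact: hom_counit_tens. Qed.
End TensorInduced.

(** * Dual bases from derivations *)

Section RelativeDerivations.
Variables (k : fieldType) (Lam Gam : pzRingType).
Variables (pi : {rmorphism Lam -> Gam}) (nu : {rmorphism Gam -> Lam}).
Variable (h : {rmorphism k -> Lam}).
Hypothesis nuK : cancel nu pi.
Hypothesis hC : forall c x, h c * x = x * h c.
Hypothesis nu_h : forall c, nu (pi (h c)) = h c.

(** These are the additive maps out of Lam (x)_k Lam. *)
Definition bilinear_map (V : zmodType) (b : Lam -> Lam -> V) : Prop :=
  [/\ forall x x' y, b (x + x') y = b x y + b x' y,
      forall x y y', b x (y + y') = b x y + b x y'
    & forall c x y, b (x * h c) y = b x (h c * y)].

Variables (S : finType) (al : S -> Lam) (T : S -> Lam -> seq (Lam * Lam)).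

(* If x is a path of the quiver, then T s x lists the factorisations
   x = u * al s * v, and Delta s b x is the sum of the b u v. *)
Definition Delta (V : zmodType) (s : S) (b : Lam -> Lam -> V) (x : Lam) : V :=
  \sum_(w <- T s x) b w.1 w.2.

Hypothesis DeltaD : forall (V : zmodType) s (b : Lam -> Lam -> V), bilinear_map b ->
  forall x y, Delta s b (x + y) = Delta s b x + Delta s b y.
Hypothesis DeltaM : forall (V : zmodType) s (b : Lam -> Lam -> V), bilinear_map b ->
  forall x y, Delta s b (x * y) =
    Delta s (fun u v => b u (v * y)) x + Delta s (fun u v => b (x * u) v) y.
Hypothesis Delta_nu : forall (V : zmodType) s (b : Lam -> Lam -> V), bilinear_map b ->
  forall c, Delta s b (nu c) = 0.
(** Balance over Gam contains balance over k, because [nu_h] places the scalars in the image of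
    [nu]. *)
Hypothesis Delta_telescope : forall (V : zmodType) (b : Lam -> Lam -> V),
  (forall x x' y, b (x + x') y = b x y + b x' y) ->
  (forall x y y', b x (y + y') = b x y + b x y') ->
  (forall x c y, b (x * nu c) y = b x (nu c * y)) ->
  forall x, \sum_s Delta s (fun u v => b u (al s * v) - b (u * al s) v) x = b 1 x - b x 1.
Hypothesis pi_al : forall s, pi (al s) = 0.
Hypothesis h_finite : finite_over h (Lam^c^o).

Lemma eq_Delta (V : zmodType) s (b b' : Lam -> Lam -> V) x :
  b =2 b' -> Delta s b x = Delta s b' x.
Proof. by move=> bb'; apply: eq_bigr. Qed.

Lemma Delta_additive (V W : zmodType) s (b : Lam -> Lam -> V) (F : {additive V -> W}) x :
  F (Delta s b x) = Delta s (fun u v => F (b u v)) x.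
Proof. exact: raddf_sum. Qed.

Lemma Delta_sum (V : zmodType) s I (r : seq I) (b : I -> Lam -> Lam -> V) x :
  \sum_(i <- r) Delta s (b i) x = Delta s (fun u v => \sum_(i <- r) b i u v) x.
Proof. by rewrite /Delta exchange_big. Qed.

Lemma Delta_mulr s (b : Lam -> Lam -> Lam) x z :
  Delta s b x * z = Delta s (fun u v => b u v * z) x.
Proof. exact: mulr_suml. Qed.
Lemma Delta_mull s (b : Lam -> Lam -> Lam) x z :
  z * Delta s b x = Delta s (fun u v => z * b u v) x.
Proof. exact: mulr_sumr. Qed.

Lemma Lam_scalar_dual_basis : exists m (x : 'I_m -> Lam) (phi : 'I_m -> Lam -> k),
  [/\ forall i u v, phi i (u + v) = phi i u + phi i v,
      forall i c u, phi i (u * h c) = c * phi i u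
    & forall v, v = \sum_i x i * h (phi i v)].
Proof.
have [m [x [phi [phiD phiZ phiE]]]] :=
  fin_gen_scalar_dual_basis h_finite (fin_gen_regular Lam).
by exists m, x, phi; split.
Qed.

(** Cuts each path at its last removed arrow. Telescoping is applied to b(u, v) = u nu(pi v), whose
    terms with al s inside [pi] vanish. The left version below cuts at the first removed arrow
    instead. *)
Lemma Gam_part x :
  x = nu (pi x) + \sum_s Delta s (fun u v => u * al s * nu (pi v)) x.
Proof.
have : \sum_s Delta s (fun u v => u * nu (pi (al s * v)) - u * al s * nu (pi v)) x =
    1 * nu (pi x) - x * nu (pi 1).
  apply: (Delta_telescope (b := fun u v => u * nu (pi v))).
- by move=> *; rewrite mulrDl.
- by move=> *; rewrite !rmorphD mulrDr.
- by move=> *; rewrite !rmorphM nuK mulrA.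
rewrite mul1r rmorph1 rmorph1 mulr1 => /(congr1 -%R); rewrite opprB => e.
rewrite -[LHS](subrK (nu (pi x))) -e addrC; congr (_ + _).
rewrite -sumrN; apply: eq_bigr => s _; rewrite -sumrN; apply: eq_bigr => w _.
by rewrite !rmorphM pi_al rmorph0 mul0r mulr0 sub0r opprK.
Qed.

Lemma Gam_part_left x :
  x = nu (pi x) + \sum_s Delta s (fun u v => nu (pi u) * al s * v) x.
Proof.
have : \sum_s Delta s (fun u v => nu (pi u) * (al s * v) - nu (pi (u * al s)) * v) x =
    nu (pi 1) * x - nu (pi x) * 1.
  apply: (Delta_telescope (b := fun u v => nu (pi u) * v)).
- by move=> *; rewrite !rmorphD mulrDl.
- by move=> *; rewrite mulrDr.
- by move=> *; rewrite !rmorphM nuK mulrA.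
rewrite mulr1 rmorph1 rmorph1 mul1r => e.
rewrite -[LHS](subrK (nu (pi x))) -e addrC; congr (_ + _).
apply: eq_bigr => s _; apply: eq_Delta => u v.
by rewrite !rmorphM pi_al rmorph0 mulr0 mul0r subr0 mulrA.
Qed.

(** In [Gam_part] the left factor u is expanded in a k-basis x_i, so Lam is generated over Gam by 1
    and the x_i al s. The coordinate at x_i al s is [pi] of the sum of the phi_i(u) v, with phi_i
    the i-th k-coordinate. *)
Lemma right_projective : has_dual_basis (restr nu : rmodType Gam).
Proof.
have [m [x [phi [phiD phiZ phiE]]]] := Lam_scalar_dual_basis.
pose b i u v := h (phi i u) * v.
have b_bil i : bilinear_map (b i).
  split=> [u u' v|u v v'|c u v]; rewrite /b.
  - by rewrite phiD rmorphD mulrDl.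
  - by rewrite mulrDr.
  - by rewrite phiZ rmorphM mulrA hC.
pose D (j : 'I_1 + 'I_m * S) (y : restr nu) : Gam^c^o :=
  if j is inr (i, s) then pi (Delta s (b i) y) else pi y.
have D_lin j : linear (D j).
  move=> a y z; case: j => [?|[i s]] /=; rewrite ?DeltaD // rmorphD; congr (_ + _).
    by rewrite -[RHS]/(pi y * a) -[in RHS](nuK a) -rmorphM.
  (* Linearity over Gam is the Leibniz rule: the second term differentiates an element of the image
     of [nu] and vanishes. *)
  rewrite DeltaM // Delta_nu ?addr0; last first.
    have [bD1 bD2 bk] := b_bil i; split=> [u u' v|u v v'|c u v].
    - by rewrite mulrDr bD1.
    - by rewrite bD2.
    - by rewrite mulrA bk.
  rewrite -[RHS]/(pi (Delta s (b i) y) * a) -[in RHS](nuK a) -rmorphM Delta_mulr.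
  by congr (pi _); apply: eq_Delta => u v; rewrite /b mulrA.
pose g (j : 'I_1 + 'I_m * S) : restr nu := if j is inr (i, s) then x i * al s else 1.
exists ('I_1 + 'I_m * S)%type, g, (fun j => linear_map (D_lin j)) => y.
rewrite big_sumType big_ord1 /= [LHS]Gam_part; congr (_ + _); first exact/esym/mul1r.
transitivity (\sum_(p : 'I_m * S) x p.1 * al p.2 * nu (pi (Delta p.2 (b p.1) y))).
  rewrite -(pair_bigA _ (fun i s => x i * al s * nu (pi (Delta s (b i) y)))) /=.
  rewrite exchange_big; apply: eq_bigr => s _ /=.
  transitivity (\sum_i Delta s (fun u v => x i * al s * nu (pi (b i u v))) y); last first.
    by apply: eq_bigr => i _; rewrite !Delta_additive Delta_mull.
  rewrite Delta_sum; apply: eq_Delta => u v; rewrite {1}(phiE u) !mulr_suml.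
  apply: eq_bigr => i _; rewrite /b !rmorphM nu_h -!mulrA; congr (_ * _).
  by rewrite !mulrA hC.
by apply: eq_bigr => -[i s] _.
Qed.

(** The mirror image: [Gam_part_left], with the right factor expanded in the k-basis, so the
    generators are 1 and the al s x_i. *)
Lemma left_projective : exists (J : finType) (g : J -> ring_bimodule nu idfun)
  (d : J -> ring_bimodule nu idfun -> Gam), left_dual_basis g d.
Proof.
have [m [x [phi [phiD phiZ phiE]]]] := Lam_scalar_dual_basis.
pose b i u v := h (phi i v) * u.
have b_bil i : bilinear_map (b i).
  split=> [u u' v|u v v'|c u v]; rewrite /b.
  - by rewrite mulrDr.
  - by rewrite phiD rmorphD mulrDl.
  - by rewrite [h c * v]hC phiZ rmorphM -(hC c u) mulrA [h (phi i v) * _]hC.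
pose D (j : 'I_1 + 'I_m * S) (y : ring_bimodule nu idfun) : Gam :=
  if j is inr q then pi (Delta q.2 (b q.1) y) else pi y.
pose g (j : 'I_1 + 'I_m * S) : ring_bimodule nu idfun :=
  if j is inr q then al q.2 * x q.1 else 1.
exists ('I_1 + 'I_m * S)%type, g, D; split=> [j y z|j c y|y].
- by case: j => [?|q] /=; rewrite -rmorphD //; congr (pi _); exact: DeltaD.
- case: j => [?|q] /=; rewrite -{2}(nuK c) -rmorphM //; congr (pi _).
  rewrite [LHS]DeltaM // Delta_nu ?add0r; last first.
    have [bD1 bD2 bk] := b_bil q.1; split=> [u u' v|u v v'|a u v].
    - by rewrite bD1.
    - by rewrite mulrDl bD2.
    - by rewrite bk mulrA.
  rewrite Delta_mull; apply: eq_Delta => u v.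
  by rewrite /b !mulrA hC.
rewrite big_sumType big_ord1 /= [LHS]Gam_part_left; congr (_ + _); first exact/esym/mulr1.
transitivity (\sum_(p : 'I_m * S) nu (pi (Delta p.2 (b p.1) y)) * (al p.2 * x p.1)) => //.
rewrite -(pair_bigA _ (fun i s => nu (pi (Delta s (b i) y)) * (al s * x i))) /=.
rewrite exchange_big; apply: eq_bigr => s _ /=.
transitivity (\sum_i Delta s (fun u v => nu (pi (b i u v)) * (al s * x i)) y); last first.
  by apply: eq_bigr => i _; rewrite !Delta_additive Delta_mulr.
rewrite Delta_sum; apply: eq_Delta => u v; rewrite {1}(phiE v) !mulr_sumr.
apply: eq_bigr => i _; rewrite /b !rmorphM nu_h -!mulrA hC -!mulrA; congr (_ * _).
Qed.
Let B : bimodule Gam Lam := ring_bimodule nu idfun.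

Lemma right_projective_hom : has_dual_basis (bihom B Lam^c^o : rmodType Gam).
Proof.
have of1_lin : linear (fun y : restr nu => of1 nu (y : Lam^c^o) : bihom B Lam^c^o).
  by move=> a y z; rewrite -(of1_scale nu) -of1D.
have at1_lin : linear (fun f : bihom B Lam^c^o => at1 f : restr nu).
  by move=> a y z; rewrite at1D at1_scale.
apply: (dual_basis_retract (r := linear_map of1_lin) (s := linear_map at1_lin))
  right_projective.
exact: at1K.
Qed.

(** * The kernel of the counit *)

Section CounitKernel.
Variables (M Tn : rmodType Lam) (tns : M -> Lam -> Tn) (mu : {linear Tn -> M}).
Hypothesis induced : induced_module nu tns.
Hypothesis mu_tns : forall m x, mu (tns m x) = (x : Lam^c) *: m.

Let tns0l x : tns 0 x = 0.
Proof. by apply: (addrI (tns 0 x)); rewrite -(tnsDl induced) !addr0. Qed.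

Let tnsBl m m' x : tns (m - m') x = tns m x - tns m' x.
Proof. by apply: (addIr (tns m' x)); rewrite -(tnsDl induced) !subrK. Qed.

Let tns_suml I (r : seq I) (m : I -> M) x :
  tns (\sum_(i <- r) m i) x = \sum_(i <- r) tns (m i) x.
Proof.
by apply: (big_morph (tns^~ x)) => [u v|]; [exact: (tnsDl induced) | exact: tns0l].
Qed.

Section Coefficient.
Variable phi : M -> k.
Hypothesis phiD : forall u v, phi (u + v) = phi u + phi v.
Hypothesis phiZ : forall c u, phi ((h c : Lam^c) *: u) = c * phi u.

Let b (m : M) (u v : Lam) : Lam := h (phi ((u : Lam^c) *: m)) * v.

Let bDm m m' u v : b (m + m') u v = b m u v + b m' u v.
Proof. by rewrite /b scalerDr phiD rmorphD mulrDl. Qed.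

Let bBm m m' u v : b (m - m') u v = b m u v - b m' u v.
Proof. by apply: (addIr (b m' u v)); rewrite -bDm !subrK. Qed.

Let b0m u v : b 0 u v = 0.
Proof. by apply: (addrI (b 0 u v)); rewrite -bDm !addr0. Qed.

Lemma coef_bilinear m : bilinear_map (b m).
Proof.
split=> [u u' v|u v v'|c u v]; rewrite /b.
- by rewrite scalerDl phiD rmorphD mulrDl.
- by rewrite mulrDr.
- rewrite (_ : (u * h c : Lam^c) *: m = (h c : Lam^c) *: ((u : Lam^c) *: m)).
    by rewrite phiZ rmorphM mulrA hC.
  by rewrite scalerA.
Qed.

(** Induces m (x) x to Delta_s(b_m)(x) on tensors. The last clause measures the failure of linearity
    over Lam: the defect depends on t only through [mu t], so F is linear exactly where it is
    needed, on the kernel of [mu]. *)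
Lemma coef_exists s : exists F : Tn -> Lam,
  [/\ forall t u, F (t - u) = F t - F u,
      forall m x, F (tns m x) = Delta s (b m) x
    & forall t (r : Lam), F ((r : Lam^c) *: t) = F t * r + Delta s (b (mu t)) r].
Proof.
have [m m' x|m x y|c m x|F [FB Ftns]] :=
  @tns_lift _ _ _ _ _ _ induced _ (fun m x => Delta s (b m) x).
- by rewrite /Delta -big_split; apply: eq_bigr => w _; rewrite bDm.
- exact: (DeltaD s (coef_bilinear m)).
(* Balance over Gam: by the Leibniz rule, the term differentiating nu c is zero. *)
- rewrite [RHS](DeltaM s (coef_bilinear m)) Delta_nu ?add0r.
    by apply: eq_Delta => u v; rewrite /b scalerA.
  have [bD1 bD2 bk] := coef_bilinear m; split=> [u u' v|u v v'|a u v].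
  + by rewrite bD1.
  + by rewrite mulrDl bD2.
  + by rewrite bk !mulrA.
have F0 : F 0 = 0 by rewrite -(subrr (0 : Tn)) FB subrr.
exists F; split=> // t r; elim/(tns_ind induced): t => [|x y hx hy|m x].
- rewrite scaler0 F0 mul0r add0r (linear0 mu); apply/esym.
  by apply: big1 => w _; exact: b0m.
- rewrite scalerBr !FB hx hy mulrBl opprD addrACA linearB; congr (_ + _).
  by rewrite -sumrB; apply: eq_bigr => w _; rewrite bBm.
- rewrite (tns_scale induced) !Ftns (DeltaM s (coef_bilinear m)) Delta_mulr mu_tns.
  congr (_ + _); apply: eq_Delta => u v; first by rewrite /b mulrA.
  by rewrite /b scalerA.
Qed.
End Coefficient.

Definition gen (m : M) s : Tn := tns m (al s) - tns ((al s : Lam^c) *: m) 1.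

Lemma gen_ker m s : mu (gen m s) = 0.
Proof. by rewrite /gen linearB !mu_tns scale1r subrr. Qed.

Section Reconstruction.
Variables (n : nat) (m : 'I_n -> M) (phi : 'I_n -> M -> k) (F : 'I_n -> S -> Tn -> Lam).
Hypothesis phiE : forall v, v = \sum_i (h (phi i v) : Lam^c) *: m i.
Hypothesis FB : forall i s t u, F i s (t - u) = F i s t - F i s u.
Hypothesis Ftns : forall i s v x, F i s (tns v x) =
  Delta s (fun u w => h (phi i ((u : Lam^c) *: v)) * w) x.

(** Telescoping for the Gam-balanced map (u, w) to v u (x) w. Because the identity holds for all t,
    it can be checked on pure tensors; on the kernel of [mu] its right side is just t. *)
Lemma gen_span (t : Tn) :
  \sum_s \sum_i (F i s t : Lam^c) *: gen (m i) s = t - tns (mu t) 1.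
Proof.
elim/(tns_ind induced): t => [|x y hx hy|v x].
- have F0 i s : F i s 0 = 0 by rewrite -(subrr (0 : Tn)) FB subrr.
  rewrite (linear0 mu) tns0l subrr big1 // => s _.
  by rewrite big1 // => i _; rewrite F0 scale0r.
- transitivity (\sum_s \sum_i (F i s x : Lam^c) *: gen (m i) s -
                \sum_s \sum_i (F i s y : Lam^c) *: gen (m i) s).
    rewrite -sumrB; apply: eq_bigr => s _; rewrite -sumrB; apply: eq_bigr => i _.
    by rewrite FB scalerBl.
  by rewrite hx hy (linearB mu) tnsBl !opprD addrACA.
- rewrite mu_tns.
  have tel : \sum_s Delta s (fun u w => tns ((u : Lam^c) *: v) (al s * w) -
      tns ((u * al s : Lam^c) *: v) w) x =
      tns ((1 : Lam^c) *: v) x - tns ((x : Lam^c) *: v) 1.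
    apply: (Delta_telescope (b := fun u w => tns ((u : Lam^c) *: v) w)).
    + by move=> u u' w; rewrite scalerDl (tnsDl induced).
    + by move=> u w w'; rewrite (tnsDr induced).
    + by move=> u c w; rewrite -(tns_bal induced) scalerA.
  rewrite scale1r in tel; rewrite -tel; apply: eq_bigr => s _.
  transitivity (\sum_i Delta s (fun u w =>
      (h (phi i ((u : Lam^c) *: v)) * w : Lam^c) *: gen (m i) s) x).
    by apply: eq_bigr => i _; rewrite Ftns; exact: scaler_suml.
  rewrite Delta_sum; apply: eq_Delta => u w.
  have -> : tns ((u * al s : Lam^c) *: v) w =
      tns ((al s : Lam^c) *: ((u : Lam^c) *: v)) w by rewrite scalerA.
  (* The element y = v u is expanded in the k-dual basis, and its scalars, lying in the image of
     [nu], cross the tensor sign to become the coefficients F. *)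
  set y := _ *: v; rewrite {2 3}(phiE y) scaler_sumr !tns_suml -sumrB.
  apply: eq_bigr => i _; rewrite /gen scalerBr !(tns_scale induced) mul1r.
  rewrite -nu_h (tns_bal induced) nu_h; congr (_ - _).
    by rewrite !mulrA hC.
  rewrite -{1}nu_h -(tns_bal induced) nu_h !scalerA; congr tns; congr (_ *: _).
  exact: esym (hC _ _).
Qed.
End Reconstruction.

Hypothesis M_fg : fin_gen (M : Mod Lam).

Lemma counit_kernel_generators : exists (n : nat) (m : 'I_n -> M) (F : 'I_n -> S -> Tn -> Lam),
  [/\ forall i s t u, F i s (t - u) = F i s t - F i s u,
      forall i s t (r : Lam), mu t = 0 -> F i s ((r : Lam^c) *: t) = F i s t * r
    & forall t, mu t = 0 -> t = \sum_s \sum_i (F i s t : Lam^c) *: gen (m i) s].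
Proof.
have [n [m [phi [phiD phiZ phiE]]]] := fin_gen_scalar_dual_basis h_finite M_fg.
have /choice[F FP] : forall i, exists F : S -> Tn -> Lam, forall s,
  [/\ forall t u, F s (t - u) = F s t - F s u,
      forall v x, F s (tns v x) = Delta s (fun u w => h (phi i ((u : Lam^c) *: v)) * w) x
    & forall t (r : Lam), F s ((r : Lam^c) *: t) = F s t * r +
        Delta s (fun u w => h (phi i ((u : Lam^c) *: mu t)) * w) r].
  by move=> i; have /choice[F FP] := coef_exists (phiD i) (phiZ i); exists F => s; exact: FP.
exists n, m, F; split=> [i s t u|i s t r mut|t mut].
- by case: (FP i s).
- case: (FP i s) => _ _ ->; rewrite mut /Delta big1 ?addr0 // => w _.
  have phi0 : phi i 0 = 0 by apply: (addrI (phi i 0)); rewrite -phiD !addr0.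
  by rewrite scaler0 phi0 rmorph0 mul0r.
- rewrite (gen_span phiE); first by rewrite mut tns0l subr0.
    by move=> i s; case: (FP i s).
  by move=> i s; case: (FP i s).
Qed.

Lemma counit_kernel_dual_basis (K : rmodType Lam) (i : {linear K -> Tn}) :
  injective i -> (forall t, mu t = 0 <-> exists x, i x = t) -> has_dual_basis K.
Proof.
move=> inj_i exi; have [n [m [F [FB Fscale Fgen]]]] := counit_kernel_generators.
have mu_i x : mu (i x) = 0 by apply/exi; exists x.
have c_lin (q : S * 'I_n) : linear (fun x : K => F q.2 q.1 (i x) : Lam^c^o).
  (* Written as a difference because F is known to respect subtraction. *)
  move=> a x y; have -> : a *: x + y = a *: x - (- 1 : Lam^c) *: y.
    by rewrite scaleN1r opprK.
  by rewrite (linearB i) !(linZ i) FB !Fscale // mulrN1 opprK.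
have /choice[g gE] : forall q : S * 'I_n, exists x, i x = gen (m q.2) q.1.
  by move=> q; apply/exi/gen_ker.
exists (S * 'I_n)%type, g, (fun q => linear_map (c_lin q)) => x; apply: inj_i.
transitivity (\sum_q (F q.2 q.1 (i x) : Lam^c) *: gen (m q.2) q.1).
  rewrite -(pair_bigA _ (fun s j => (F j s (i x) : Lam^c) *: gen (m j) s)) /=.
  exact: Fgen.
by rewrite linear_sum; apply: eq_bigr => q _; rewrite linZ gE.
Qed.

Section Annihilated.
Variable e : S -> Lam.
Hypothesis M_al : forall s (m : M), (al s : Lam^c) *: m = 0.

(** When the al s kill M, each generator is m (x) al s. A coefficient r followed by e s' turns it
    into m (x) al s r e s', which is zero. *)
Lemma counit_kernel_annihilated t s :
  (forall s s' x, al s * x * e s' = 0) -> mu t = 0 -> (e s : Lam^c) *: t = 0.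
Proof.
move=> al_e mut; have [n [m [F [_ _ Fgen]]]] := counit_kernel_generators.
rewrite (Fgen t mut) scaler_sumr big1 // => s' _; rewrite scaler_sumr big1 // => i _.
rewrite scalerA /gen M_al tns0l subr0 (tns_scale induced).
rewrite -[_ * (_ * _)]/(al s' * (F i s' t * e s)) mulrA al_e.
by apply: (addrI (tns (m i) 0)); rewrite -(tnsDr induced) !addr0.
Qed.

(** Each generator is m (x) al s = m (x) e s al s = m e s (x) al s = 0, since e s comes from Gam and
    may cross the tensor sign. *)
Lemma counit_kernel_trivial t :
  (forall s, nu (pi (e s)) = e s) -> (forall s, e s * al s = al s) ->
  (forall s (m : M), (e s : Lam^c) *: m = 0) -> mu t = 0 -> t = 0.
Proof.
move=> e_nu e_al M_e mut; have [n [m [F [_ _ Fgen]]]] := counit_kernel_generators.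
rewrite (Fgen t mut) big1 // => s' _; rewrite big1 // => i _.
by rewrite /gen M_al tns0l subr0 -e_al -e_nu -(tns_bal induced) e_nu M_e tns0l scaler0.
Qed.
End Annihilated.
End CounitKernel.

(** * The functors i, e, l, r and the endofunctors F, G *)

Let hG : {rmorphism k -> Gam} := pi \o h.

Lemma Gam_finite : finite_over hG Gam^c^o.
Proof.
have [n [g gL]] := h_finite; exists n, (fun i => pi (g i)) => x _.
have [c cE] := gL (nu x) I; exists c; rewrite -[LHS]nuK cE rmorph_sum.
by apply: eq_bigr => i _; exact: (rmorphM pi).
Qed.

Let GG : bimodule Lam Gam := ring_bimodule pi idfun.
Let LLG : bimodule Lam Gam := ring_bimodule idfun nu.

Lemma i_fin_gen (M : Mod Gam) : fin_gen M -> fin_gen (Hom_functor GG M).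
Proof.
move=> /(fin_gen_finite_over Gam_finite) M_fin.
by apply: (@finite_over_fin_gen _ _ h); exact: finite_over_restriction M_fin.
Qed.

Lemma e_fin_gen (M : Mod Lam) : fin_gen M -> fin_gen (Hom_functor B M).
Proof.
move=> /(fin_gen_finite_over h_finite) M_fin.
by apply: (@finite_over_fin_gen _ _ hG); exact: finite_over_restriction M_fin.
Qed.

(** The functor r is not a restriction of scalars, so finiteness comes from Lam being projective of
    finite type on the right over Gam. *)
Lemma r_fin_gen (M : Mod Gam) : fin_gen M -> fin_gen (Hom_functor LLG M).
Proof.
move=> /(fin_gen_finite_over Gam_finite) M_fin.
apply: (@finite_over_fin_gen _ _ h); apply: (finite_over_hom (hR := hG)) => //.
- by move=> c b; rewrite -[LHS]/(h c * (b : Lam)) hC -{1}nu_h.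
- by move=> c x; rewrite -[hG c]/(pi (h c)) -(nuK x) -!rmorphM hC.
- exact: right_projective.
Qed.

Lemma Lam_abelian : abelian (mod Lam).
Proof. exact/mod_abelian/finite_over_noetherian/h_finite. Qed.

Lemma Gam_abelian : abelian (mod Gam).
Proof. exact/mod_abelian/finite_over_noetherian/Gam_finite. Qed.

Section Functors.
Hypothesis i_fg : forall M, fin_gen M -> fin_gen (Hom_functor GG M).
Hypothesis e_fg : forall M, fin_gen M -> fin_gen (Hom_functor B M).
Hypothesis l_fg : forall M, fin_gen M -> fin_gen (Tensor_functor B M).
Let i : functor (mod Gam) (mod Lam) := restrict_functor i_fg.
Let e : functor (mod Lam) (mod Gam) := restrict_functor e_fg.
Let l : functor (mod Gam) (mod Lam) := restrict_functor l_fg.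

Lemma e_preserves_projectives : preserves_projectives e.
Proof. exact/restriction_projective/right_projective_hom. Qed.

Definition tensor_adjunction : adjunction l e :=
  restrict_adjunction l_fg e_fg (tensor_hom_adjunction B).

Section Kernel.
Variables (adj : adjunction l e) (G : kernel_functor (adj_counit adj)).

(** Composing with the comparison automorphism makes an arbitrary kernel functor of an arbitrary
    counit a kernel of the explicit evaluation map. *)
Lemma kernel_embedding (X : mod Lam) :
  exists j : {linear carrier (G X) -> tensor (bihom B (carrier X)) B}, injective j /\
    forall t, hom_counit B (carrier X) t = 0 <-> exists x, j x = t.
Proof.
have := kernel_counit_independent tensor_adjunction (kerf_is_kernel G X).
move=> /kernelP[inj_j exj].
by exists (lin (counit_comparison adj tensor_adjunction X \oc kerf_incl G X)).
Qed.

Lemma kernel_dual_basis (X : mod Lam) : has_dual_basis (carrier (G X)).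
Proof.
have [j [inj_j exj]] := kernel_embedding X.
exact: (counit_kernel_dual_basis (tensor_induced nu (carrier X)) (@counit_tns _ _ nu _)
  (svalP X) inj_j exj).
Qed.

Let F : functor (mod Gam) (mod Gam) := e \of (G \of i).

Lemma F_image_projective (Y : mod Gam) : essential_image F Y -> projective_module (sval Y).
Proof.
move=> [X isoXY]; apply/dual_basis_projective_module/(dual_basis_isomorphic isoXY).
apply: mod_projective_dual_basis; apply: e_preserves_projectives.
by apply: dual_basis_mod_projective; exact: kernel_dual_basis.
Qed.

Lemma G_image_projective (Y : mod Lam) : essential_image G Y -> projective_module (sval Y).
Proof.
move=> [X isoXY]; apply/dual_basis_projective_module/(dual_basis_isomorphic isoXY).
exact: kernel_dual_basis.
Qed.

Variable v : S -> Lam.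
Hypothesis v_nu : forall s, nu (pi (v s)) = v s.
Hypothesis v_al : forall s, v s * al s = al s.
Hypothesis al_v : forall s s' x, al s * x * v s' = 0.

Lemma i_al_zero (N : mod Gam) s (m : carrier (i N)) : (al s : Lam^c) *: m = 0.
Proof. by apply: at1_inj; rewrite [LHS](at1_scale (al s) m) pi_al scale0r. Qed.

Lemma kernel_v_zero (N : mod Gam) s (m : carrier (G (i N))) : (v s : Lam^c) *: m = 0.
Proof.
have [j [inj_j exj]] := kernel_embedding (i N).
apply: inj_j; rewrite linZ (linear0 j).
apply: (counit_kernel_annihilated (tensor_induced nu (carrier (i N))) (@counit_tns _ _ nu _)
  (svalP (i N))) => //; first exact: i_al_zero.
by apply/exj; exists m.
Qed.

Lemma i_F_v_zero (N : mod Gam) s (m : carrier (i (F N))) : (v s : Lam^c) *: m = 0.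
Proof.
apply: at1_inj; rewrite [LHS](at1_scale (v s) m).
apply: at1_inj; rewrite [LHS](at1_scale (pi (v s)) (at1 m)) v_nu.
exact: kernel_v_zero.
Qed.

(** Already G i F vanishes: i F N is annihilated by the al s, being in the image of i, and by the v
    s, being built from the kernel for i N. *)
Lemma F_squared_zero : zero_functor (F \of F).
Proof.
move=> N.
have G0 (x : carrier (G (i (F N)))) : x = 0.
  have [j [inj_j exj]] := kernel_embedding (i (F N)).
  apply: inj_j; rewrite (linear0 j).
  apply: (counit_kernel_trivial (tensor_induced nu (carrier (i (F N)))) (@counit_tns _ _ nu _)
    (svalP (i (F N))) (e := v)) => //; first exact: i_al_zero.
  - exact: i_F_v_zero.
  - by apply/exj; exists x.
have FF0 (x : carrier ((F \of F) N)) : x = 0.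
  by apply: at1_inj; rewrite [LHS]G0 [RHS]G0.
move=> X; split=> f; apply: hom_ext => x; first exact: FF0.
by rewrite [x]FF0 [LHS](linear0 (lin f)).
Qed.
End Kernel.
End Functors.

Variable v : S -> Lam.
Hypothesis v_nu : forall s, nu (pi (v s)) = v s.
Hypothesis v_al : forall s, v s * al s = al s.
Hypothesis al_v : forall s s' x, al s * x * v s' = 0.

(** All conclusions for a pair of rings with section [nu] and maps [Delta] as above; quivers enter
    only in verifying these hypotheses. The condition f_j Lam e_i = 0 has become [al_v]. *)
Theorem cleft_extension_of_derivations :
  exists (i_fg : forall M, fin_gen M -> fin_gen (Hom_functor GG M))
         (e_fg : forall M, fin_gen M -> fin_gen (Hom_functor B M))
         (l_fg : forall M, fin_gen M -> fin_gen (Tensor_functor B M))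
         (r_fg : forall M, fin_gen M -> fin_gen (Hom_functor LLG M)),
  let i : functor (mod Gam) (mod Lam) := restrict_functor i_fg in
  let e : functor (mod Lam) (mod Gam) := restrict_functor e_fg in
  let l : functor (mod Gam) (mod Lam) := restrict_functor l_fg in
  let r : functor (mod Gam) (mod Lam) := restrict_functor r_fg in
  [/\ faithful e /\ exact_functor e,
      inhabited (adjunction l e),
      naturally_isomorphic (e \of i) (id_functor (mod Gam)),
      exact_functor l /\ exact_functor r
    & preserves_projectives e] /\
  (forall adj : adjunction l e,
     inhabited (kernel_functor (adj_counit adj)) /\
     forall G : kernel_functor (adj_counit adj),
       let F : functor (mod Gam) (mod Gam) := e \of (G \of i) in
       (forall Y, essential_image F Y -> proj Y) /\ zero_functor (F \of F)) /\
  [/\ cleft_extension e l i,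
      exact_functor l,
      preserves_projectives e
    & forall (adj : adjunction l e) (G : kernel_functor (adj_counit adj)),
        let F : functor (mod Gam) (mod Gam) := e \of (G \of i) in
        (forall Y : mod Gam, essential_image F Y -> projective_module (sval Y)) /\
        (forall Y : mod Lam, essential_image G Y -> projective_module (sval Y))].
Proof.
have l_fg (M : Mod Gam) : fin_gen M -> fin_gen (Tensor_functor B M).
  exact: ring_tensor_fin_gen.
exists i_fin_gen, e_fin_gen, l_fg, r_fin_gen.
move=> i e l r.
have e_faithful : faithful e by exact: restriction_faithful.
have e_exact : exact_functor e by exact: restriction_exact.
have adj_le : inhabited (adjunction l e) by exists; exact: tensor_adjunction.
have ei : naturally_isomorphic (e \of i) (id_functor (mod Gam)).
  exact: restriction_section.
have l_exact : exact_functor l.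
  have [J [g [d dg]]] := left_projective.
  exact: (left_projective_tensor_exact dg).
have r_exact : exact_functor r.
  by apply: projective_hom_exact; exact: right_projective.
have e_proj : preserves_projectives e by exact: e_preserves_projectives.
split; [by split | split; [|split=> //]].
- move=> adj; split=> [|G F].
    by apply: kernel_functor_exists; exact: abelian_kernel Lam_abelian.
  split; first by move=> Y; exact: F_image_projective.
  exact: (F_squared_zero i_fin_gen G v_nu v_al al_v).
- by split=> //; [exact: Gam_abelian | exact: Lam_abelian].
- by move=> adj G F; split=> Y; [exact: F_image_projective | exact: G_image_projective].
Qed.
End RelativeDerivations.

(** * Path algebras *)

Definition ring_morphism (A A' : pzRingType) (f : A -> A') (fB : zmod_morphism f)
    (fM : monoid_morphism f) : {rmorphism A -> A'} :=
  let mB := GRing.isZmodMorphism.Build A A' f fB in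
  let mM := GRing.isMonoidMorphism.Build A A' f fM in
  HB.pack_for {rmorphism A -> A'} f mB mM.

Section QuotientRing.
Variables (A A' : pzRingType) (J : ideal A).

Lemma quot_pi_eq x y : quot_pi J x = quot_pi J y <-> ideal_set J (x - y).
Proof. exact: (zpi_eq (ideal_subgrp J)). Qed.

Lemma quot_pi_eq0 x : quot_pi J x = 0 <-> ideal_set J x.
Proof. by rewrite -(rmorph0 (quot_pi J)) quot_pi_eq subr0. Qed.

Lemma quot_pi_repr (x : quot_ring J) : quot_pi J (zrepr x) = x.
Proof. exact: zreprK. Qed.

Lemma quot_lift (f : {rmorphism A -> A'}) : (forall x, ideal_set J x -> f x = 0) ->
  exists g : {rmorphism quot_ring J -> A'}, forall x, g (quot_pi J x) = f x.
Proof.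
move=> fJ; pose g (x : quot_ring J) := f (zrepr x).
have gE x : g (quot_pi J x) = f x.
  apply/eqP; rewrite /g -subr_eq0 -rmorphB; apply/eqP/fJ.
  by apply/quot_pi_eq; exact: quot_pi_repr.
have gB : zmod_morphism g.
  move=> x y; have [[u ->] [v ->]] := (quot_piP x, quot_piP y).
  by rewrite -rmorphB !gE rmorphB.
have gM : monoid_morphism g.
  split=> [|x y]; first by rewrite -(rmorph1 (quot_pi J)) gE rmorph1.
  have [[u ->] [v ->]] := (quot_piP x, quot_piP y).
  by rewrite -rmorphM !gE rmorphM.
by exists (ring_morphism gB gM).
Qed.

Lemma ideal_gen_sub (X : set A) (P : A -> Prop) :
  P 0 -> (forall x y, P x -> P y -> P (x + y)) -> (forall a x, P x -> P (a * x)) ->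
  (forall x a, P x -> P (x * a)) -> (forall x, X x -> P x) ->
  forall x, ideal_set (ideal_gen X) x -> P x.
Proof. by move=> P0 PD PMl PMr XP x; apply; split. Qed.

Lemma ideal_gen_in (X : set A) x : X x -> ideal_set (ideal_gen X) x.
Proof. by move=> Xx W [_]; apply. Qed.
End QuotientRing.

(** Left multiplication by f x is a homomorphism from eA to fA whose value at e is f x e: the
    identification of Hom(eA, fA) with fAe. *)
Lemma pright_hom_zero (A : pzRingType) (e f : A) :
  (forall h : {linear pright e -> pright f}, h = 0) -> forall x, f * x * e = 0.
Proof.
move=> h0 x.
have mul_in (z : pright e) : pright_pred f (f * (x * (pright_val z : A))).
  by apply/asboolP; exists (x * (pright_val z : A)).
have mul_lin : linear (fun z => PRight (mul_in z)).
  move=> a u v; apply: val_inj.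
  by rewrite /= !mulrDr !mulrA.
have e_in : pright_pred e e by apply/asboolP; exists 1; rewrite mulr1.
have := congr1 (fun h : {linear pright e -> pright f} => (pright_val (h (PRight e_in)) : A))
  (h0 (linear_map mul_lin)).
by rewrite /= mulrA.
Qed.

Section PathAlgebraFacts.
Variables (k : fieldType) (Q : quiver).
Local Notation A := (pathalg k Q).
Local Notation B := (pbase k).
Implicit Types (x y z : A) (c : k) (p q : path Q) (s : seq (arrow Q)).

Lemma scale_mull c x y : (c *: x) * y = c *: (x * y).
Proof. exact: pa_scaleAl. Qed.
Lemma scale_mulr c x y : x * (c *: y) = c *: (x * y).
Proof. exact: pa_scaleAr. Qed.
Lemma mul_base p q : B p * B q = pmul k p q.
Proof. exact: pa_mulBB. Qed.

(** A product in kQ: the empty word is 1, not a trivial path, and arrows that do not compose give 0.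
    Words can thus be cut and concatenated without side conditions. *)
Definition word s : A := \prod_(b <- s) arr k b.

Lemma vert_vert v w : vert k v * vert k w = if v == w then vert k v else 0 :> A.
Proof.
rewrite mul_base; case: eqP => [vw|/eqP vw]; last exact: pmul0.
by rewrite pmulE; congr pbase; apply: val_inj.
Qed.

Lemma src_arr b : vert k (src b) * arr k b = arr k b :> A.
Proof. by rewrite mul_base pmulE; congr pbase; apply: val_inj. Qed.

Lemma arr_tgt b : arr k b * vert k (tgt b) = arr k b :> A.
Proof. by rewrite mul_base pmulE; congr pbase; apply: val_inj. Qed.

Lemma vert_base p : vert k (start p) * B p = B p.
Proof.
rewrite mul_base pmulE; congr pbase; apply: val_inj.
by case: p => -[].
Qed.

Lemma base_vert p : B p * vert k (finish p) = B p.
Proof.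
rewrite mul_base pmulE; congr pbase; apply: val_inj.
by rewrite /= /arrows /= cats0; case: p => -[].
Qed.

Lemma walk_base v s (vs : walk v s) : vert k v * word s = B (@Path Q (v, s) vs).
Proof.
elim: s v vs => [|b s IH] v vs.
  by rewrite /word big_nil mulr1; congr pbase; apply: val_inj.
have /andP[/eqP bv bs] := vs; subst v.
rewrite /word big_cons -/(word s) mulrA src_arr -(arr_tgt b) -mulrA (IH _ bs).
rewrite mul_base pmulE; congr pbase; exact: val_inj.
Qed.

Lemma base_word p : B p = vert k (start p) * word (arrows p).
Proof. by case: p => -[v s] vs; rewrite (walk_base vs). Qed.

Section AdditiveExtension.
Variables (V : zmodType) (G : k -> path Q -> V).
Hypothesis GD : forall c d p, G (c + d) p = G c p + G d p.

Let G0 p : G 0 p = 0. Proof. by apply: (addrI (G 0 p)); rewrite -GD !addr0. Qed.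

(** The coefficient is an argument of G because V is a mere abelian group: k acts on the factors of
    a split, not on V. *)
Definition add_ext (x : A) : V := \sum_(p <- msupp x) G x@_p p.

Lemma add_extEw (d : {fset path Q}) x : (msupp x `<=` d)%fset ->
  add_ext x = \sum_(p <- d) G x@_p p.
Proof.
move=> le; rewrite /add_ext; apply/(big_fset_incl _ le) => p _ pn.
by rewrite mcoeff_outdom.
Qed.

Lemma add_extD x y : add_ext (x + y) = add_ext x + add_ext y.
Proof.
pose d := (msupp (x + y) `|` (msupp x `|` msupp y))%fset.
rewrite !(@add_extEw d); last first.
- exact: fsubsetUl.
- exact: fsubset_trans (fsubsetUl _ _) (fsubsetUr _ _).
- exact: fsubset_trans (fsubsetUr _ _) (fsubsetUr _ _).
by rewrite -big_split /=; apply: eq_bigr => p _; rewrite mcoeffD GD.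
Qed.

Lemma add_extU c p : add_ext (c *: B p) = G c p.
Proof.
rewrite pa_scaleE pbase.unlock -malgUZ (@add_extEw [fset p]%fset) ?msuppU_le //.
by rewrite big_seq_fset1 mcoeffUU.
Qed.
End AdditiveExtension.
End PathAlgebraFacts.

(** * Derivations on the path algebra *)

Section PathDerivations.
Variables (k : fieldType) (Q : quiver).
Local Notation A := (pathalg k Q).
Local Notation B := (pbase k).
Local Notation word := (word k).
Implicit Types (x y z u : A) (c : k) (p q : path Q) (s : seq (arrow Q)) (b e : arrow Q).

(* For a path u followed by the arrows s, the pairs (u', w) with u s = u' b w
   where the displayed b is one of the arrows of s. *)
Fixpoint splits b u s : seq (A * A) :=
  if s is e :: s' then
    (if e == b then [:: (u * vert k (src e), vert k (tgt e) * word s')] else [::])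
    ++ splits b (u * arr k e) s'
  else [::].

Definition split_sum (V : zmodType) b (m : A -> A -> V) u s : V :=
  \sum_(w <- splits b u s) m w.1 w.2.

(** The coefficient of a path is placed on the left factor; against k-balanced maps the side does
    not matter. *)
Definition all_splits b x : seq (A * A) :=
  flatten [seq splits b (x@_p *: vert k (start p)) (arrows p) | p <- msupp x].

Definition path_Delta (V : zmodType) b (m : A -> A -> V) x : V :=
  \sum_(w <- all_splits b x) m w.1 w.2.

Lemma split_sum_cons (V : zmodType) b (m : A -> A -> V) u e s :
  split_sum b m u (e :: s) =
  (if e == b then m (u * vert k (src e)) (vert k (tgt e) * word s) else 0)
  + split_sum b m (u * arr k e) s.
Proof. by rewrite /split_sum /= big_cat; case: eqP; rewrite ?big_seq1 ?big_nil. Qed.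

Lemma split_sum_nil (V : zmodType) b (m : A -> A -> V) u : split_sum b m u [::] = 0.
Proof. exact: big_nil. Qed.

Lemma split_sum_mull (V : zmodType) b (m : A -> A -> V) x u s :
  split_sum b m (x * u) s = split_sum b (fun y z => m (x * y) z) u s.
Proof.
elim: s u => [|e s IH] u; first by rewrite !split_sum_nil.
by rewrite !split_sum_cons -!mulrA IH.
Qed.

Lemma split_sum_cat (V : zmodType) b (m : A -> A -> V) u s s' :
  split_sum b m u (s ++ s') =
  split_sum b (fun y z => m y (z * word s')) u s + split_sum b m (u * word s) s'.
Proof.
elim: s u => [|e s IH] u.
  by rewrite split_sum_nil add0r /word big_nil mulr1.
rewrite /= !split_sum_cons IH addrA /word !big_cons big_cat /= !mulrA.
by rewrite -/(word s) -/(word s').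
Qed.

(** The right factor ends at the end of the path, even when nothing follows the displayed arrow:
    there the explicit vertex replaces the empty word 1. This makes products with a non-composable
    path vanish. *)
Lemma splits_vert b u s v : walk v s ->
  forall w, w \in splits b u s -> w.2 * vert k (last v [seq tgt e | e <- s]) = w.2.
Proof.
elim: s u v => //= e s IH u v /andP[_ es] w; rewrite mem_cat => /orP[|]; last first.
  exact: IH.
case: eqP => // _; rewrite inE => /eqP -> /=.
rewrite (walk_base k es); exact: (base_vert k (@Path Q (tgt e, s) es)).
Qed.

Section Bilinear.
Variables (V : zmodType) (b : arrow Q).
Implicit Type m : A -> A -> V.

Record bilin m : Prop := Bilin {
  bilinDl : forall x x' y, m (x + x') y = m x y + m x' y;
  bilinDr : forall x y y', m x (y + y') = m x y + m x y';
  bilinZ : forall c x y, m (c *: x) y = m x (c *: y) }.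

Lemma bilin_mulr m z : bilin m -> bilin (fun x y => m x (y * z)).
Proof.
by move=> [mDl mDr mZ]; split=> [x x' y|x y y'|c x y];
  rewrite ?mulrDl ?mDl ?mDr ?mZ ?scale_mull.
Qed.

Lemma bilin_mull m z : bilin m -> bilin (fun x y => m (z * x) y).
Proof.
by move=> [mDl mDr mZ]; split=> [x x' y|x y y'|c x y];
  rewrite ?mulrDr ?mDl ?mDr -?mZ ?scale_mulr.
Qed.

Lemma bilin0r m x : bilin m -> m x 0 = 0.
Proof. by move=> [_ mDr _]; apply: (addrI (m x 0)); rewrite -mDr !addr0. Qed.

Lemma split_sumD m u u' s : bilin m ->
  split_sum b m (u + u') s = split_sum b m u s + split_sum b m u' s.
Proof.
move=> mb; elim: s u u' => [|e s IH] u u'; first by rewrite !split_sum_nil addr0.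
rewrite !split_sum_cons !mulrDl IH addrACA; congr (_ + _).
by case: eqP; rewrite ?addr0 // (bilinDl mb).
Qed.

Lemma path_DeltaE m x :
  path_Delta b m x = add_ext (fun c p => split_sum b m (c *: vert k (start p)) (arrows p)) x.
Proof. by rewrite /path_Delta big_flatten /= big_map. Qed.

Lemma split_sum_scaleD m c d p : bilin m ->
  split_sum b m ((c + d) *: vert k (start p)) (arrows p) =
  split_sum b m (c *: vert k (start p)) (arrows p) +
  split_sum b m (d *: vert k (start p)) (arrows p).
Proof. by move=> mb; rewrite scalerDl split_sumD. Qed.

Lemma path_DeltaD m x y : bilin m ->
  path_Delta b m (x + y) = path_Delta b m x + path_Delta b m y.
Proof. by move=> mb; rewrite !path_DeltaE add_extD // => c d p; exact: split_sum_scaleD. Qed.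

Lemma path_Delta0 m : bilin m -> path_Delta b m 0 = 0.
Proof. by move=> mb; apply: (addrI (path_Delta b m 0)); rewrite -path_DeltaD // !addr0. Qed.

Lemma path_DeltaB m x y : bilin m ->
  path_Delta b m (x - y) = path_Delta b m x - path_Delta b m y.
Proof.
by move=> mb; apply: (addIr (path_Delta b m y)); rewrite -path_DeltaD // !subrK.
Qed.

Lemma path_DeltaU m c p : bilin m ->
  path_Delta b m (c *: B p) = split_sum b m (c *: vert k (start p)) (arrows p).
Proof.
by move=> mb; rewrite path_DeltaE add_extU // => *; exact: split_sum_scaleD.
Qed.

(** If p and q compose, an occurrence of b in pq lies either in p or in q. Otherwise pq = 0, and
    both terms on the right vanish by the vertex idempotents in the factors. *)
Lemma path_DeltaM_base m c d p q : bilin m ->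
  path_Delta b m ((c *: B p) * (d *: B q)) =
  path_Delta b (fun x y => m x (y * (d *: B q))) (c *: B p) +
  path_Delta b (fun x y => m ((c *: B p) * x) y) (d *: B q).
Proof.
move=> mb; have mr := bilin_mulr (d *: B q) mb; have ml := bilin_mull (c *: B p) mb.
rewrite !(path_DeltaU _ _ mr) !(path_DeltaU _ _ ml) -split_sum_mull.
rewrite !(scale_mull, scale_mulr) !scalerA mul_base.
have [pq|pq] := eqVneq (finish p) (start q); last first.
  rewrite pmul0 // scaler0 path_Delta0 // [X in _ + X](_ : _ = 0); last first.
    have -> : B p * vert k (start q) = 0 by rewrite mul_base pmul0.
    rewrite scaler0; apply: (addrI (split_sum b m 0 (arrows q))).
    by rewrite -split_sumD // !addr0.
  rewrite addr0 /split_sum big_seq big1 // => w /(splits_vert (path_walk p)) wE.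
  rewrite scale_mulr -wE -mulrA -(vert_base k q) [vert k _ * _]mulrA vert_vert.
  by rewrite (negbTE pq) mul0r mulr0 scaler0 (bilin0r _ mb).
have catE : (c * d) *: pmul k p q = (c * d) *: B (pcat pq) by rewrite pmulE.
rewrite catE path_DeltaU // split_sum_cat; congr (_ + _); last first.
  by rewrite scale_mull -[start (pcat pq)]/(start p) -base_word -pq base_vert.
rewrite mulrC -scalerA.
have scaleE (m' : A -> A -> V) u s' : bilin m' ->
    split_sum b m' (d *: u) s' = split_sum b (fun x y => m' x (d *: y)) u s'.
  move=> mb'; elim: s' u => [|e s' IH] u; first by rewrite !split_sum_nil.
  by rewrite !split_sum_cons !scale_mull IH (bilinZ mb').
rewrite scaleE; last exact: bilin_mulr.
rewrite /split_sum; apply: eq_big_seq => w /(splits_vert (path_walk p)) wE.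
congr m; rewrite scale_mull scale_mulr; congr (_ *: _).
have wq : w.2 * vert k (start q) = w.2 by rewrite -pq.
by rewrite [in RHS]base_word mulrA wq.
Qed.

Lemma path_DeltaM m x y : bilin m ->
  path_Delta b m (x * y) =
  path_Delta b (fun u v => m u (v * y)) x + path_Delta b (fun u v => m (x * u) v) y.
Proof.
move=> mb; have mr := bilin_mulr _ mb; have ml := bilin_mull _ mb.
elim/pa_ind: x => [x x' hx hx'||c p].
- rewrite mulrDl !path_DeltaD // hx hx' addrACA; congr (_ + _).
  by rewrite -big_split; apply: eq_bigr => w _; rewrite mulrDl (bilinDl mb).
- rewrite mul0r !path_Delta0 // add0r /path_Delta big1 // => w _.
  by rewrite mul0r; apply: (addrI (m 0 w.2)); rewrite -(bilinDl mb) !addr0.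
elim/pa_ind: y => [y y' hy hy'||d q]; last exact: path_DeltaM_base.
- rewrite mulrDr !path_DeltaD // hy hy' addrACA; congr (_ + _).
  by rewrite -big_split; apply: eq_bigr => w _; rewrite mulrDr (bilinDr mb).
- rewrite mulr0 !path_Delta0 // addr0 /path_Delta big1 // => w _.
  by rewrite mulr0 (bilin0r _ mb).
Qed.

Definition avoids_arrow x := forall p, p \in msupp x -> b \notin arrows p.

Lemma splits_avoid u s : b \notin s -> splits b u s = [::].
Proof.
by elim: s u => //= e s IH u; rewrite inE negb_or eq_sym => /andP[/negbTE -> /IH ->].
Qed.

Lemma path_Delta_avoid m x : avoids_arrow x -> path_Delta b m x = 0.
Proof.
move=> ax; rewrite path_DeltaE /add_ext big_seq big1 // => p /ax bp.
by rewrite /split_sum splits_avoid ?big_nil.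
Qed.

(** The elements of I on which every admissible m vanishes form an ideal containing X. All m must be
    treated at once, since the Leibniz rule replaces m by its translates. *)
Lemma path_Delta_ideal (X : set A) m x : (forall y, X y -> avoids_arrow y) -> bilin m ->
  (forall y z, ideal_set (ideal_gen X) y -> m y z = 0) ->
  (forall y z, ideal_set (ideal_gen X) z -> m y z = 0) ->
  ideal_set (ideal_gen X) x -> path_Delta b m x = 0.
Proof.
move=> Xav mb ml mr Ix; have [I0 ID IMl IMr] := idealP (ideal_gen X).
pose good m := [/\ bilin m, forall y z, ideal_set (ideal_gen X) y -> m y z = 0
  & forall y z, ideal_set (ideal_gen X) z -> m y z = 0].
pose P z := ideal_set (ideal_gen X) z /\ forall m, good m -> path_Delta b m z = 0.
suff [_ /(_ m)] : P x by apply.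
apply: (ideal_gen_sub (X := X)) Ix => {x} /=.
- by split=> // m' [mb' _ _]; rewrite path_Delta0.
- move=> x y [Ix hx] [Iy hy]; split; first exact: ID.
  by move=> m' gm'; rewrite path_DeltaD ?hx ?hy ?addr0 //; case: gm'.
- move=> z x [Ix hx]; split; first exact: IMl.
  move=> m' [mb' ml' mr']; rewrite path_DeltaM // hx ?addr0.
    by rewrite /path_Delta big1 // => w _; apply: mr'; exact: IMl.
  split=> [|y w Iy|y w Iw]; [exact: bilin_mull | apply: ml'; exact: IMl | exact: mr'].
- move=> x z [Ix hx]; split; first exact: IMr.
  move=> m' [mb' ml' mr']; rewrite path_DeltaM // hx ?add0r.
    by rewrite /path_Delta big1 // => w _; apply: ml'; exact: IMr.
  split=> [|y w Iy|y w Iw]; [exact: bilin_mulr | exact: ml' | apply: mr'; exact: IMr].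
- move=> x Xx; split; first exact: ideal_gen_in.
  by move=> m' _; apply: path_Delta_avoid; exact: Xav.
Qed.
End Bilinear.

(** An arrow e of P followed by s contributes m(u, e s) - m(u e, s); for an arrow outside P this
    difference is zero by balance. Hence every arrow of the word contributes its difference, and the
    sum collapses. *)
Lemma split_sum_telescope (V : zmodType) (P : pred (arrow Q)) (m : A -> A -> V) u s :
  (forall u v z, m (u * vert k v) z = m u (vert k v * z)) ->
  (forall u e z, ~~ P e -> m (u * arr k e) z = m u (arr k e * z)) ->
  \sum_(b | P b) split_sum b (fun y z => m y (arr k b * z) - m (y * arr k b) z) u s =
  m u (word s) - m (u * word s) 1.
Proof.
move=> mv me; elim: s u => [|e s IH] u.
  by rewrite /word big_nil mulr1 subrr big1 // => b _; exact: split_sum_nil.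
under eq_bigr => b _ do rewrite split_sum_cons.
rewrite big_split IH /= /word !big_cons -/(word s) mulrA.
have -> : \sum_(b | P b) (if e == b
    then m (u * vert k (src e)) (arr k b * (vert k (tgt e) * word s)) -
         m (u * vert k (src e) * arr k b) (vert k (tgt e) * word s) else 0) =
    m u (arr k e * word s) - m (u * arr k e) (word s).
  have [Pe|Pe] := boolP (P e).
    rewrite (bigD1 e) //= eqxx big1 ?addr0; last first.
      by move=> b /andP[_ be]; rewrite eq_sym (negbTE be).
    rewrite mv !mulrA src_arr arr_tgt -[u * _ * _]mulrA src_arr; congr (_ - _).
    by rewrite -mv -mulrA arr_tgt.
  rewrite big1 ?me ?subrr // => b Pb; case: eqP => // eb.
  by rewrite eb Pb in Pe.
by rewrite addrA subrK.
Qed.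

Lemma path_Delta_telescope (V : zmodType) (P : pred (arrow Q)) (m : A -> A -> V) x :
  bilin m ->
  (forall u v z, m (u * vert k v) z = m u (vert k v * z)) ->
  (forall u e z, ~~ P e -> m (u * arr k e) z = m u (arr k e * z)) ->
  \sum_(b | P b) path_Delta b (fun y z => m y (arr k b * z) - m (y * arr k b) z) x =
  m 1 x - m x 1.
Proof.
move=> mb mv me.
have mbb b : bilin (fun y z => m y (arr k b * z) - m (y * arr k b) z).
  case: mb => mDl mDr mZ; split=> [y y' z|y z z'|c y z].
  - by rewrite mulrDl !mDl opprD addrACA.
  - by rewrite mulrDr !mDr opprD addrACA.
  - by rewrite scale_mull !mZ scale_mulr.
elim/pa_ind: x => [x y hx hy||c p].
- under eq_bigr => b _ do rewrite path_DeltaD //.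
  by rewrite big_split /= hx hy (bilinDl mb) (bilinDr mb) opprD addrACA.
- rewrite (bilin0r _ mb) big1 => [|b _]; last exact: path_Delta0.
  by apply/esym/eqP; rewrite sub0r oppr_eq0; apply/eqP/(addrI (m 0 1));
    rewrite -(bilinDl mb) !addr0.
under eq_bigr => b _ do rewrite path_DeltaU //.
rewrite split_sum_telescope // scale_mull -base_word; congr (_ - _).
by rewrite (bilinZ mb) -[vert k _]mul1r mv scale_mulr -base_word.
Qed.
End PathDerivations.

(** * The section of the projection, finiteness, and descent of the derivations to Lam *)

Section ArrowRemovalFacts.
Variables (k : fieldType) (Q : quiver) (t : nat) (a : 'I_t -> arrow Q).
Local Notation A := (pathalg k Q).
Local Notation B := (pbase k).
Local Notation word := (word k).
Implicit Types (x y z : A) (c : k) (p q : path Q).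

Definition avoids_path p : bool := all (fun b => b \notin codom a) (arrows p).

(** The projection of kQ onto kQ* along the span of the paths through a removed arrow. It is a ring
    endomorphism, and [nu] is what it induces on Gam. *)
Definition rho (x : A) : A := lin_ext (fun p => if avoids_path p then B p else 0) x.

Lemma rhoB : zmod_morphism rho.
Proof. by move=> x y; exact: (linearB (lin_ext _)). Qed.

Lemma rhoD x y : rho (x + y) = rho x + rho y.
Proof. exact: lin_extD. Qed.

Lemma rhoZ c x : rho (c *: x) = c *: rho x.
Proof. by rewrite /rho [in LHS]pa_scaleE lin_extZ. Qed.

Lemma rho0 : rho 0 = 0.
Proof. by apply: (addrI (rho 0)); rewrite -rhoD !addr0. Qed.

Lemma rho_base p : rho (B p) = if avoids_path p then B p else 0.
Proof. by rewrite {1}pbase.unlock /rho lin_extU. Qed.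

Lemma avoidsP x : avoids a x <-> forall p, p \in msupp x -> avoids_path p.
Proof.
split=> ax p px; last by move=> i; apply/negP => /(allP (ax p px)); rewrite codom_f.
by apply/allP => b bp; apply/negP => /codomP[i bi]; have := ax p px i; rewrite -bi bp.
Qed.

Lemma rho_id x : avoids a x -> rho x = x.
Proof.
move=> /avoidsP ax; rewrite [RHS]monalgE /rho /lin_ext big_seq [RHS]big_seq.
apply: eq_bigr => p px; by rewrite (ax p px) [LHS]pa_scaleE pbase.unlock -malgUZ.
Qed.

Lemma avoids_rho x : avoids a (rho x).
Proof.
apply/avoidsP; elim/pa_ind: x => [x y hx hy||c q].
- move=> p; rewrite rhoD => /(fsubsetP (msuppD_le _ _)); rewrite in_fsetU.
  by case/orP; [exact: hx | exact: hy].
- by move=> p; rewrite rho0 msupp0 in_fset0.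
- move=> p; rewrite rhoZ rho_base; case: ifP => [aq|_].
    rewrite pa_scaleE pbase.unlock -malgUZ => /(fsubsetP (msuppU_le)).
    by rewrite in_fset1 => /eqP ->.
  by rewrite scaler0 msupp0 in_fset0.
Qed.

Lemma rhoM : monoid_morphism rho.
Proof.
split=> [|x y].
  rewrite -[1]/(pa_one k Q) pa_one.unlock.
  rewrite (big_morph rho rhoD rho0); apply: eq_bigr => v _.
  by rewrite rho_base.
elim/pa_ind: x => [x x' hx hx'||c p].
- by rewrite mulrDl !rhoD hx hx' mulrDl.
- by rewrite mul0r rho0 mul0r.
elim/pa_ind: y => [y y' hy hy'||d q].
- by rewrite mulrDr !rhoD hy hy' mulrDr.
- by rewrite mulr0 rho0 mulr0.
rewrite !(scale_mull, scale_mulr, rhoZ); congr (_ *: (_ *: _)).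
rewrite !rho_base mul_base; have [pq|pq] := eqVneq (finish p) (start q); last first.
  rewrite pmul0 // rho0; case: ifP; case: ifP; rewrite ?mulr0 ?mul0r // => _ _.
  by rewrite mul_base pmul0.
rewrite pmulE rho_base /avoids_path all_cat.
by do 2![case: all]; rewrite ?mulr0 ?mul0r // mul_base pmulE.
Qed.

Definition rho_morphism : {rmorphism A -> A} := ring_morphism rhoB rhoM.

Variable I : ideal A.
Hypothesis hgen : not_in_minimal_generators a I.
Local Notation Lam := (quot_ring I).
Local Notation q := (quot_pi I).
Local Notation J := (removal_ideal a I).
Local Notation Gam := (quot_ring J).
Local Notation pi := (quot_pi J).

(** I has generators avoiding the removed arrows; [rho] fixes them, hence maps I into itself. *)
Lemma rho_ideal x : ideal_set I x -> ideal_set I (rho x).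
Proof.
have [X [[XI _] Xav]] := hgen; rewrite -{1}XI.
have [I0 ID IMl IMr] := idealP I.
apply: (ideal_gen_sub (P := fun x => ideal_set I (rho x))).
- by rewrite rho0.
- by move=> y z; rewrite rhoD; exact: ID.
- by move=> y z hz; rewrite rhoM.2; exact: IMl.
- by move=> y z hz; rewrite rhoM.2; exact: IMr.
- by move=> y Xy; rewrite rho_id; [rewrite -XI; exact: ideal_gen_in | exact: Xav].
Qed.

Lemma pi_q_arr b : b \in codom a -> pi (q (arr k b)) = 0.
Proof.
by move=> /codomP[i ->]; apply/quot_pi_eq0; apply: ideal_gen_in; exists i.
Qed.

Lemma pi_q_rho x : pi (q (rho x)) = pi (q x).
Proof.
elim/pa_ind: x => [x y hx hy||c p].
- by rewrite rhoD !rmorphD /= hx hy.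
- by rewrite rho0.
rewrite rhoZ -[c *: rho _]mul1r -[c *: B p]mul1r !scale_mulr -!scale_mull !rmorphM.
congr (_ * _); rewrite rho_base; case: ifP => // /allPn[b bp].
rewrite negbK => ba; rewrite !rmorph0; apply/esym.
rewrite base_word; case/splitPr: bp => s1 s2.
by rewrite /word big_cat big_cons /= !rmorphM /= (pi_q_arr ba) mul0r !mulr0.
Qed.

(** [rho] descends through I by [rho_ideal], and then through the removal ideal because it kills the
    removed arrows. *)
Lemma nu_exists : exists nu : {rmorphism Gam -> Lam}, forall x, nu (pi (q x)) = q (rho x).
Proof.
have [|rho_bar rho_barE] := @quot_lift _ _ I (q \o rho_morphism : {rmorphism A -> Lam}).
  by move=> x /rho_ideal Ix; apply/quot_pi_eq0.
have [|nu nuE] := @quot_lift _ _ J rho_bar.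
  apply: (ideal_gen_sub (P := fun z : Lam => rho_bar z = 0)).
  - exact: rmorph0.
  - by move=> x y hx hy; rewrite rmorphD hx hy addr0.
  - by move=> x y hy; rewrite rmorphM hy mulr0.
  - by move=> x y hx; rewrite rmorphM hx mul0r.
  - move=> _ [i _ <-]; rewrite rho_barE /= rho_base /avoids_path /= codom_f /=.
    exact: rmorph0.
by exists nu => x; rewrite nuE rho_barE.
Qed.

Definition scalar (c : k) : Lam := q (c *: (1 : A)).
Lemma scalarB : zmod_morphism scalar.
Proof. by move=> c d; rewrite /scalar scalerBl rmorphB. Qed.
Lemma scalarM : monoid_morphism scalar.
Proof.
split=> [|c d]; first by rewrite /scalar scale1r rmorph1.
by rewrite /scalar -rmorphM scale_mull mul1r scalerA.
Qed.
Definition scalar_morphism : {rmorphism k -> Lam} := ring_morphism scalarB scalarM.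

Lemma scalar_q c x : scalar c * q x = q (c *: x).
Proof. by rewrite /scalar -rmorphM scale_mull mul1r. Qed.

Lemma q_scalar c x : q x * scalar c = q (c *: x).
Proof. by rewrite /scalar -rmorphM scale_mulr mulr1. Qed.

Lemma scalarC c (z : Lam) : scalar c * z = z * scalar c.
Proof. by have [x ->] := quot_piP z; rewrite scalar_q q_scalar. Qed.

Lemma word_pow n (s : seq (arrow Q)) : (n <= size s)%N ->
  ideal_set (ideal_pow (arrow_ideal k Q) n) (word s).
Proof.
move=> ns; rewrite -(cat_take_drop n s) /word big_cat /=.
have [_ _ _ IMr] := idealP (ideal_pow (arrow_ideal k Q) n); apply: IMr.
have : size (take n s) = n by rewrite size_takel.
elim: n {ns} (take n s) => [|n IH] s'; first by [].
case/lastP: s' => // s' b; rewrite size_rcons => -[ns].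
rewrite -cats1 big_cat big_seq1 /=; apply: ideal_gen_in.
exists (word s'), (arr k b); split=> //; first exact: IH.
by apply: ideal_gen_in; exists b.
Qed.

(** The paths of length less than n, possibly with some zeros: the products are formed without
    checking composability, which is harmless for spanning. *)
Fixpoint short_paths n : seq A :=
  if n is n'.+1 then [seq vert k v | v <- enum (vertex Q)] ++
    [seq arr k b * x | b <- enum (arrow Q), x <- short_paths n'] else [::].

Lemma short_pathsP n p : (size (arrows p) < n)%N -> B p \in short_paths n.
Proof.
elim: n p => // n IH [[v [|b s]] vs] /= ns; rewrite mem_cat; apply/orP.
  left; apply/mapP; exists v; rewrite ?mem_enum //.
  by congr pbase; apply: val_inj.
right; have /andP[/eqP /= bv bs] := vs; subst v.
apply/allpairsP; exists (b, B (@Path Q (tgt b, s) bs)); split=> //=.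
- by rewrite mem_enum.
- exact: IH.
- by rewrite mul_base pmulE; congr pbase; apply: val_inj.
Qed.

Lemma Lam_finite : admissible I -> finite_over scalar_morphism Lam^c^o.
Proof.
move=> [m [_ mI _]]; pose L := short_paths m.
exists (size L), (fun i => q (nth 0 L i)) => z _; have [x ->] := quot_piP z.
suff [c cE] : exists c : 'I_(size L) -> k, q x = \sum_i scalar (c i) * q (nth 0 L i).
  by exists c; rewrite cE; apply: eq_bigr => i _; exact: scalarC.
elim/pa_ind: x => [x y [c xE] [d yE]||c p].
- exists (fun i => c i + d i); rewrite rmorphD /= xE yE -big_split; apply: eq_bigr => i _.
  by rewrite /scalar scalerDl rmorphD mulrDl.
- exists (fun=> 0); rewrite rmorph0 big1 // => i _.
  by rewrite /scalar scale0r rmorph0 mul0r.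
have [pm|pm] := ltnP (size (arrows p)) m.
  have /(nthP 0)[i iL iE] := short_pathsP pm.
  exists (fun j => if j == Ordinal iL then c else 0).
  rewrite (bigD1 (Ordinal iL)) //= eqxx big1 ?addr0.
    by rewrite iE scalar_q.
  by move=> j /negbTE ->; rewrite /scalar scale0r rmorph0 mul0r.
(* A path of length at least m lies in the m-th power of the arrow ideal, hence in I. *)
exists (fun=> 0); rewrite big1 => [|i _]; last by rewrite /scalar scale0r rmorph0 mul0r.
rewrite -scalar_q base_word rmorphM /=.
have -> : q (word (arrows p)) = 0 by apply/quot_pi_eq0/mI/word_pow.
by rewrite !mulr0.
Qed.

Section Derivations.
Variable nu : {rmorphism Gam -> Lam}.
Hypothesis nuE : forall x, nu (pi (q x)) = q (rho x).
(** Indexed by the removed arrows rather than by 'I_t: [a] may repeat an arrow, and the telescoping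
    sum must count each one once. *)
Let S : finType := {b : arrow Q | b \in codom a}.
Let T (s : S) (z : Lam) : seq (Lam * Lam) :=
  [seq (q w.1, q w.2) | w <- all_splits (val s) (zrepr z)].
Let al (s : S) : Lam := q (arr k (val s)).

Section Bilinear.
Variables (V : zmodType) (m : Lam -> Lam -> V).
Hypothesis mb : bilinear_map scalar_morphism m.

Lemma bilin_quot : bilin (fun x y => m (q x) (q y)).
Proof.
have [mDl mDr mZ] := mb; split=> [x x' y|x y y'|c x y].
- by rewrite rmorphD mDl.
- by rewrite rmorphD mDr.
- by rewrite -q_scalar mZ scalar_q.
Qed.

(** The list [T s] is built from the representative chosen by [zrepr]; another one differs by an
    element of I, where the sums vanish by [path_Delta_ideal]. This is where generators avoiding the
    removed arrows make the derivation descend. *)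
Lemma Delta_q s x : Delta T s m (q x) = path_Delta (val s) (fun x y => m (q x) (q y)) x.
Proof.
rewrite /Delta /T big_map -/(path_Delta _ (fun x y => m (q x) (q y)) _).
apply/eqP; rewrite -subr_eq0 -path_DeltaB; last exact: bilin_quot.
have [X [[XI _] Xav]] := hgen.
have m0l (y : Lam) : m 0 y = 0.
  by case: mb => mDl _ _; apply: (addrI (m 0 y)); rewrite -mDl !addr0.
have m0r (y : Lam) : m y 0 = 0.
  by case: mb => _ mDr _; apply: (addrI (m y 0)); rewrite -mDr !addr0.
apply/eqP; apply: (path_Delta_ideal (X := X)).
- move=> y /Xav ay p py; have /codomP[i ->] := valP s.
  exact: ay.
- exact: bilin_quot.
- by move=> y z; rewrite XI => /quot_pi_eq0 ->.
- by move=> y z; rewrite XI => /quot_pi_eq0 ->.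
- by rewrite XI; apply/quot_pi_eq; exact: quot_pi_repr.
Qed.
End Bilinear.

Lemma quot_DeltaD (V : zmodType) s (m : Lam -> Lam -> V) : bilinear_map scalar_morphism m ->
  forall x y : Lam, Delta T s m (x + y) = Delta T s m x + Delta T s m y.
Proof.
move=> mb x y; have [[u ->] [v ->]] := (quot_piP x, quot_piP y).
by rewrite -rmorphD !Delta_q // path_DeltaD //; exact: bilin_quot.
Qed.

Lemma quot_DeltaM (V : zmodType) s (m : Lam -> Lam -> V) : bilinear_map scalar_morphism m ->
  forall x y : Lam, Delta T s m (x * y) =
    Delta T s (fun u v => m u (v * y)) x + Delta T s (fun u v => m (x * u) v) y.
Proof.
move=> mb x y; have [[x' ->] [y' ->]] := (quot_piP x, quot_piP y).
have [mDl mDr mZ] := mb.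
rewrite -rmorphM !Delta_q //.
- rewrite path_DeltaM; last exact: bilin_quot.
  by congr (_ + _); apply: eq_bigr => w _; rewrite rmorphM.
- split=> [u u' v|u v v'|c u v].
  + by rewrite mulrDr mDl.
  + by rewrite mDr.
  + by rewrite mulrA mZ.
- split=> [u u' v|u v v'|c u v].
  + by rewrite mDl.
  + by rewrite mulrDl mDr.
  + by rewrite mZ mulrA.
Qed.

Lemma quot_Delta_nu (V : zmodType) s (m : Lam -> Lam -> V) : bilinear_map scalar_morphism m ->
  forall c : Gam, Delta T s m (nu c) = 0.
Proof.
move=> mb c; have [z ->] := quot_piP c; have [x ->] := quot_piP z.
rewrite nuE Delta_q //; apply: path_Delta_avoid => p px.
have /codomP[i ->] := valP s; exact: (avoids_rho px).
Qed.

(** Scalars, vertices and the arrows that are kept all avoid the removed arrows, so their classes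
    lie in the image of [nu]; balance over Gam gives the balance conditions required on kQ. *)
Lemma quot_Delta_telescope (V : zmodType) (m : Lam -> Lam -> V) :
  (forall x x' y : Lam, m (x + x') y = m x y + m x' y) ->
  (forall x y y' : Lam, m x (y + y') = m x y + m x y') ->
  (forall (x : Lam) (c : Gam) (y : Lam), m (x * nu c) y = m x (nu c * y)) ->
  forall x : Lam,
    \sum_s Delta T s (fun u v => m u (al s * v) - m (u * al s) v) x = m 1 x - m x 1.
Proof.
move=> mDl mDr mnu z; have [x ->] := quot_piP z.
have mq u y v : avoids a y -> m (u * q y) v = m u (q y * v).
  by move=> ay; rewrite -(rho_id ay) -nuE mnu.
have av_rho y : rho y = y -> avoids a y by move=> <-; exact: avoids_rho.
have av_scalar c : avoids a (c *: (1 : A)) by apply: av_rho; rewrite rhoZ rhoM.1.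
have mb : bilinear_map scalar_morphism m by split=> // c u v; exact: mq.
have mbs s : bilinear_map scalar_morphism (fun u v => m u (al s * v) - m (u * al s) v).
  have [_ _ mZ] := mb; split=> [u u' v|u v v'|c u v].
  - by rewrite mulrDl !mDl opprD addrACA.
  - by rewrite mulrDr !mDr opprD addrACA.
  - rewrite mZ -[m (u * al s) (_ * v)]mZ -[scalar_morphism c]/(scalar c) !mulrA.
    by rewrite -[u * scalar c * _]mulrA !(scalarC c (al s)) !mulrA.
transitivity (\sum_(b | b \in codom a) path_Delta b
    (fun y z => m (q y) (q (arr k b * z)) - m (q (y * arr k b)) (q z)) x).
  rewrite (big_sub (mem (codom a))) /=; apply: eq_bigr => s _.
  by rewrite Delta_q //; apply: eq_bigr => w _; rewrite !rmorphM.
apply: (path_Delta_telescope (m := fun y z => m (q y) (q z))).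
- exact: bilin_quot.
- move=> u v w; rewrite !rmorphM; apply: mq; apply: av_rho.
  by rewrite rho_base.
- move=> u e w ea; rewrite !rmorphM; apply: mq; apply: av_rho.
  by rewrite rho_base /avoids_path /= ea.
Qed.
End Derivations.
End ArrowRemovalFacts.

Theorem proposition4p6 (k : fieldType) (Q : quiver) (I : ideal (pathalg k Q))
  (hI : admissible I) (t : nat) (a : 'I_t -> arrow Q)
  (hgen : not_in_minimal_generators a I)
  (hhom : forall (i j : 'I_t)
     (h : {linear pright (quot_pi I (vert k (src (a i)))) ->
                  pright (quot_pi I (vert k (tgt (a j))))}), h = 0) :
  let Lam : pzRingType := quot_ring I in
  let Gam : pzRingType := quot_ring (removal_ideal a I) in
  let pi : {rmorphism Lam -> Gam} := quot_pi (removal_ideal a I) in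
  exists nu : {rmorphism Gam -> Lam},
    [/\ forall x : pathalg k Q, avoids a x -> nu (pi (quot_pi I x)) = quot_pi I x,
        injective nu
      & cancel nu pi] /\
  let GG : bimodule Lam Gam := ring_bimodule pi idfun in
  let GLL : bimodule Gam Lam := ring_bimodule nu idfun in
  let LLG : bimodule Lam Gam := ring_bimodule idfun nu in
  exists (i_fg : forall M, fin_gen M -> fin_gen (Hom_functor GG M))
         (e_fg : forall M, fin_gen M -> fin_gen (Hom_functor GLL M))
         (l_fg : forall M, fin_gen M -> fin_gen (Tensor_functor GLL M))
         (r_fg : forall M, fin_gen M -> fin_gen (Hom_functor LLG M)),
  let i : functor (mod Gam) (mod Lam) := restrict_functor i_fg in
  let e : functor (mod Lam) (mod Gam) := restrict_functor e_fg in
  let l : functor (mod Gam) (mod Lam) := restrict_functor l_fg in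
  let r : functor (mod Gam) (mod Lam) := restrict_functor r_fg in
  [/\ (* (i) *) faithful e /\ exact_functor e,
      (* (ii) *) inhabited (adjunction l e),
      (* (iii) *) naturally_isomorphic (e \of i) (id_functor (mod Gam)),
      (* (iv) *) exact_functor l /\ exact_functor r
    & (* (v) *) preserves_projectives e] /\
  (forall adj : adjunction l e,
     inhabited (kernel_functor (adj_counit adj)) /\
     forall G : kernel_functor (adj_counit adj),
       let F : functor (mod Gam) (mod Gam) := e \of (G \of i) in
       (* (vi) *) (forall Y, essential_image F Y -> proj Y) /\
       (* (vii) *) zero_functor (F \of F)) /\
  [/\ cleft_extension e l i,
      exact_functor l,
      preserves_projectives e
    & forall (adj : adjunction l e) (G : kernel_functor (adj_counit adj)),
        let F : functor (mod Gam) (mod Gam) := e \of (G \of i) in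
        (forall Y : mod Gam, essential_image F Y -> projective_module (sval Y)) /\
        (forall Y : mod Lam, essential_image G Y -> projective_module (sval Y))].
Proof.
move=> Lam Gam pi; have [nu nuE] := nu_exists hgen.
have nuK : cancel nu pi.
  move=> g; have [z ->] := quot_piP g; have [x ->] := quot_piP z.
  by rewrite nuE; exact: pi_q_rho.
exists nu; split.
  split=> [x ax||//]; first by rewrite nuE rho_id.
  exact: can_inj nuK.
(* The idempotents e_i: sources, not targets, since e_i must cross the tensor sign on the left of
   a_i. *)
pose v (s : {b : arrow Q | b \in codom a}) : Lam := quot_pi I (vert k (src (val s))).
have nu_scalar c : nu (pi (scalar_morphism I c)) = scalar_morphism I c.
  by rewrite [LHS]nuE rhoZ (rhoM k a).1.
have pi_al (s : {b : arrow Q | b \in codom a}) : pi (quot_pi I (arr k (val s))) = 0.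
  exact: pi_q_arr (valP s).
have v_nu s : nu (pi (v s)) = v s by rewrite [LHS]nuE rho_base.
have v_al s : v s * quot_pi I (arr k (val s)) = quot_pi I (arr k (val s)).
  by rewrite -rmorphM src_arr.
have al_v (s s' : {b : arrow Q | b \in codom a}) (x : Lam) :
    quot_pi I (arr k (val s)) * x * v s' = 0.
  have /codomP[i si] := valP s; have /codomP[j s'j] := valP s'.
  (* With a_i = a_i f_i, the product contains f_i x e_j, which vanishes by the hypothesis on Hom(e_j
     Lam, f_i Lam). *)
  rewrite -arr_tgt rmorphM /v si s'j -!mulrA [X in _ * X]mulrA.
  by rewrite (pright_hom_zero (hhom j i)) mulr0.
move=> GG GLL LLG.
exact: (@cleft_extension_of_derivations k Lam Gam pi nu (scalar_morphism I) nuK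
  (@scalarC k Q I) nu_scalar _ (fun s => quot_pi I (arr k (val s))) _
  (@quot_DeltaD k Q t a I hgen) (@quot_DeltaM k Q t a I hgen)
  (quot_Delta_nu hgen nuE) (@quot_Delta_telescope k Q t a I hgen nu nuE)
  pi_al (Lam_finite hI) v v_nu v_al al_v).
Qed.
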